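(* Let $B$ be a path-connected paracompact space and let $\mathcal{U}$ be an open cover of $B$ consisting of path-connected sets. Suppose that for each $x\in B$ the inclusion $st(x,\mathcal{U})\to B$ induces the trivial homomorphism $\pi(st(x,\mathcal{U}),x)\to\pi(B,x)$. Then for every $b_0\in B$, the group $\pi(B,b_0)$ is isomorphic to the (classical) fundamental group of the nerve of $\mathcal{U}$.
   Context: All maps are continuous; a Peano space is a connected, locally path-connected space. $st(x,\mathcal{U})$ denotes the union of all members of $\mathcal{U}$ containing $x$. For a class $\mathcal{P}$ of spaces, $p\colon E\to Y$ is a $\mathcal{P}$-covering if for every $e_0\in E$, $X\in\mathcal{P}$, $x_0\in X$ and map $f\colon X\to Y$ with $f(x_0)=p(e_0)$ there is a unique map $g\colon X\to E$ with $p\circ g=f$, $g(x_0)=e_0$. A directed wedge is $(Z,z_0)=\bigvee_{s\in S}(Z_s,z_s)$, a wedge of pointed Peano spaces indexed by a directed set $S$, topologized so that $U\subset Z\setminus\{z_0\}$ is open iff each $U\cap Z_s$ is open, and $U\ni z_0$ is an open neighborhood of $z_0$ iff each $U\cap Z_s$ is open and there is $t\in S$ with $Z_s\subset U$ for all $s>t$. A disk-hedgehog is a directed wedge with each $Z_s\cong D^2$; a disk-hedgehog covering is a $\mathcal{P}$-covering for $\mathcal{P}$ the class of all disk-hedgehogs. Order: for disk-hedgehog coverings $q_i\colon E_i\to Y$ with Peano $E_i$, $q_1\ge q_2$ iff for all $e_1,e_2$ with $q_1(e_1)=q_2(e_2)$ there is a map $f\colon E_1\to E_2$, $q_2\circ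 f=q_1$, $f(e_1)=e_2$. Every path-connected $Y$ has a maximal disk-hedgehog covering $q$ with Peano total space ($q\ge$ all such coverings). The hedgehog fundamental group $\pi(Y,y_0)$ is the monodromy group of $q$: loops at $y_0$ modulo $\alpha\sim\beta$ iff any lifts of $\alpha,\beta$ with the same starting point have the same end point, with product induced by concatenation. A map $h\colon(Y_1,y_1)\to(Y_2,y_2)$ of path-connected spaces induces $\pi(Y_1,y_1)\to\pi(Y_2,y_2)$, $[\alpha]\mapsto[h\circ\alpha]$. *)

(* Defs.v *)
From HB Require Import structures.
From mathcomp Require Import all_boot all_order all_algebra.
From mathcomp Require Import all_classical all_reals all_analysis.
From mathcomp Require Import Rstruct Rstruct_topology.
From Stdlib Require Import Rdefinitions.

Set Implicit Arguments. Unset Strict Implicit. Unset Printing Implicit Defensive.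
Import Order.TTheory GRing.Theory Num.Theory.
Local Open Scope classical_set_scope.
Local Open Scope ring_scope.

Notation RR := Rdefinitions.R.

Definition rel_open (T : topologicalType) (D A : set T) : Prop :=
  exists W : set T, open W /\ A `&` D = W `&` D.

Definition unit_interval : set RR := `[0, 1]%classic.

Definition is_path (T : topologicalType) (g : RR -> T) (x y : T) : Prop :=
  {within unit_interval, continuous g} /\ g 0 = x /\ g 1 = y.

Definition path_connected_set (T : topologicalType) (A : set T) : Prop :=
  forall x y, A x -> A y ->
    exists g : RR -> T, is_path g x y /\ (forall t, unit_interval t -> A (g t)).

Definition path_connected_space (T : topologicalType) : Prop :=
  path_connected_set [set: T].

Definition locally_path_connected (T : topologicalType) : Prop :=
  forall (x : T) (N : set T), nbhs x N ->
    exists W : set T, [/\ open W, W x, W `<=` N & path_connected_set W].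

Definition peano_space (T : topologicalType) : Prop :=
  connected [set: T] /\ locally_path_connected T.

Definition open_cover (T : topologicalType) (C : set (set T)) : Prop :=
  (forall U, C U -> open U) /\ (forall x : T, exists U, C U /\ U x).

Definition locally_finite_family (T : topologicalType) (C : set (set T)) : Prop :=
  forall x : T, exists N, nbhs x N /\ finite_set [set W | C W /\ W `&` N !=set0].

Definition paracompact (T : topologicalType) : Prop :=
  hausdorff_space T /\
  forall C : set (set T), open_cover C ->
    exists D : set (set T), [/\ open_cover D, locally_finite_family D &
      forall W, D W -> exists V, C V /\ W `<=` V].

Definition star (T : Type) (x : T) (C : set (set T)) : set T :=
  \bigcup_(U in [set U | C U /\ U x]) U.

Definition pcat (T : Type) (a b : RR -> T) : RR -> T :=
  fun t => if t <= 2^-1 then a (2 * t) else b (2 * t - 1).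

Definition disk : set (RR * RR) := [set p | p.1 ^+ 2 + p.2 ^+ 2 <= 1].

(* Data of a disk-hedgehog: a directed (preordered) index set S and, for
   each s, the base point z s of the s-th disk Z_s = D^2. *)
Record hedgehog := Hedgehog {
  hS : Type;
  hle : hS -> hS -> Prop;
  hle_refl : forall s, hle s s;
  hle_trans : forall r s t, hle r s -> hle s t -> hle r t;
  hle_directed : forall r s, exists t, hle r t /\ hle s t;
  hz : hS -> RR * RR;
  hz_disk : forall s, disk (hz s) }.

Definition hlt (H : hedgehog) (t s : hS H) : Prop := hle t s /\ ~ hle s t.

(* raw carrier: None is the wedge point z0, Some (s, p) is the point p of
   Z_s \ {z_s}. *)
Definition hpt (H : hedgehog) := option (hS H * (RR * RR)).

Definition hmem (H : hedgehog) (x : hpt H) : Prop :=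
  match x with None => True | Some (s, p) => disk p /\ p <> hz s end.

Definition hproj (H : hedgehog) (s : hS H) (p : RR * RR) : hpt H :=
  if p == hz s then None else Some (s, p).

Definition hopen (H : hedgehog) (U : set (hpt H)) : Prop :=
  (forall s, rel_open disk [set p | disk p /\ U (hproj s p)]) /\
  (U None -> exists t, forall s, hlt t s ->
       forall p, disk p -> U (hproj s p)).

Definition hcontinuous (H : hedgehog) (T : topologicalType) (f : hpt H -> T) :=
  forall O : set T, open O -> hopen [set x | hmem x /\ O (f x)].

Definition dh_covering (E Y : topologicalType) (p : E -> Y) : Prop :=
  continuous p /\
  forall (e0 : E) (H : hedgehog) (x0 : hpt H) (f : hpt H -> Y),
    hmem x0 -> hcontinuous f -> f x0 = p e0 ->
    exists g : hpt H -> E,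
      [/\ hcontinuous g, (forall x, hmem x -> p (g x) = f x), g x0 = e0 &
       forall g' : hpt H -> E, hcontinuous g' ->
         (forall x, hmem x -> p (g' x) = f x) -> g' x0 = e0 ->
         forall x, hmem x -> g' x = g x].

Definition cov_ge (E1 E2 Y : topologicalType) (q1 : E1 -> Y) (q2 : E2 -> Y) :=
  forall e1 e2, q1 e1 = q2 e2 ->
    exists f : E1 -> E2, [/\ continuous f, q2 \o f = q1 & f e1 = e2].

Definition maximal_dh_covering (E Y : topologicalType) (q : E -> Y) : Prop :=
  [/\ dh_covering q, peano_space E &
     forall (E2 : topologicalType) (q2 : E2 -> Y),
       dh_covering q2 -> peano_space E2 -> cov_ge q q2].

Definition is_loop (T : topologicalType) (y0 : T) (a : RR -> T) := is_path a y0 y0.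

Definition is_lift (E Y : topologicalType) (q : E -> Y) (a : RR -> Y) (l : RR -> E) :=
  {within unit_interval, continuous l} /\ forall t, unit_interval t -> q (l t) = a t.

Definition hequiv (Y : topologicalType) (a b : RR -> Y) : Prop :=
  forall (E : topologicalType) (q : E -> Y), maximal_dh_covering q ->
    forall la lb : RR -> E, is_lift q a la -> is_lift q b lb ->
      la 0 = lb 0 -> la 1 = lb 1.

(* points of the geometric realisation |N(C)|: barycentric coordinates *)
Definition supp (T : Type) (w : set T -> RR) : set (set T) := [set V | w V != 0].

Definition nerve_pt (T : Type) (C : set (set T)) (w : set T -> RR) : Prop :=
  [/\ supp w `<=` C, (forall V, 0 <= w V), finite_set (supp w),
      (\sum_(V \in supp w) w V = 1)%R &
      \bigcap_(V in supp w) V !=set0].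

Definition simplex (T : Type) (C : set (set T)) (s : set (set T)) : Prop :=
  [/\ finite_set s, s !=set0, s `<=` C & \bigcap_(V in s) V !=set0].

(* weak (coherent) topology of |N(C)|: O is open iff its trace on every
   closed simplex is open in the Euclidean topology of that simplex *)
Definition nerve_open (T : Type) (C : set (set T)) (O : set (set T -> RR)) :=
  forall s, simplex C s -> forall w, nerve_pt C w -> supp w `<=` s -> O w ->
    exists2 e : RR, 0 < e & forall w', nerve_pt C w' -> supp w' `<=` s ->
      (forall V, s V -> `|w V - w' V| < e) -> O w'.

Definition nerve_cont (X : topologicalType) (T : Type) (C : set (set T))
    (D : set X) (g : X -> (set T -> RR)) : Prop :=
  (forall x, D x -> nerve_pt C (g x)) /\
  forall O, nerve_open C O -> rel_open D [set x | D x /\ O (g x)].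

Definition vertex (T : Type) (V : set T) : set T -> RR :=
  fun W => if W == V then 1 else 0.

Definition nerve_loop (T : Type) (C : set (set T)) (v : set T -> RR)
    (a : RR -> (set T -> RR)) : Prop :=
  nerve_cont C unit_interval a /\ a 0 = v /\ a 1 = v.

Definition nerve_homotopic (T : Type) (C : set (set T)) (v : set T -> RR)
    (a b : RR -> (set T -> RR)) : Prop :=
  exists h : RR * RR -> (set T -> RR),
    [/\ nerve_cont C (unit_interval `*` unit_interval) h,
        (forall s, unit_interval s -> h (s, 0) = a s /\ h (s, 1) = b s) &
        (forall t, unit_interval t -> h (0, t) = v /\ h (1, t) = v)].

(* Groups given as loops modulo an equivalence, product induced by pcat.
   An isomorphism is a map of loops that is well defined and injective on
   classes, surjective on classes and multiplicative. *)
Definition loop_group_iso (T1 T2 : Type)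
    (L1 : (RR -> T1) -> Prop) (eq1 : (RR -> T1) -> (RR -> T1) -> Prop)
    (L2 : (RR -> T2) -> Prop) (eq2 : (RR -> T2) -> (RR -> T2) -> Prop) : Prop :=
  exists phi : (RR -> T1) -> (RR -> T2),
    [/\ forall a, L1 a -> L2 (phi a),
        forall a b, L1 a -> L1 b -> (eq1 a b <-> eq2 (phi a) (phi b)),
        forall c, L2 c -> exists2 a, L1 a & eq2 (phi a) c &
        forall a b, L1 a -> L1 b -> eq2 (phi (pcat a b)) (pcat (phi a) (phi b))].

(* Main.v *)
(* A path in B is developed by words in the members of C, its subdivisions being
   subordinate to the cover; words are identified when they differ by moves inside
   simplices of the nerve, and then the word of a path depends only on its homotopy
   class. The same applies to paths in the nerve and the cover by open stars.

   Let a and b be paths in B with the same ends. If their words agree, their lifts to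
   any hedgehog covering agree: over a member of C the lifts form sheets, and the
   triviality of loops in stars makes sheets over two members match on the whole
   intersection, so that every move of words preserves the transport of sheets. If
   their words differ, the classes of paths modulo "same word" form a hedgehog covering
   in which the lifts of a and b differ. Finally the maximal hedgehog covering is the
   space of paths modulo "same lifts to every hedgehog covering", so the hedgehog group
   of B is the group of words. In the nerve, open stars are cones and pairwise
   intersections of stars are connected through edges, so the same transport argument
   shows that loops with the same word are homotopic: the fundamental group of the
   nerve is the group of words as well. *)

Require Import Defs.
From HB Require Import structures.
From mathcomp Require Import all_boot all_order all_algebra.
From mathcomp Require Import all_classical all_reals all_analysis.
From mathcomp Require Import Rstruct Rstruct_topology.
From mathcomp Require Import lra.
Set Implicit Arguments. Unset Strict Implicit. Unset Printing Implicit Defensive.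
Import Order.TTheory GRing.Theory Num.Theory numFieldNormedType.Exports.
Local Open Scope classical_set_scope.
Local Open Scope ring_scope.

(** * Relative continuity *)

(** [B] need not be locally path-connected, so path classes get a topology made for the test spaces:
    a set is open when its preimages under the canonical lifts of all maps of hedgehogs are open.
    Continuous lifts then exist by construction, and the work lies in their uniqueness, for which an
    invariant constant along segments of disks is enough. Words are developed once, for a space [X]
    with an open set [O u] attached to each member [u] of [C]. The link between [X] and the nerve is
    that the members whose sets contain a given point of [X] have a common point in [B]. The two
    instances are [B] itself with [O u = u], and the nerve with its open stars. Transport along
    words is likewise an abstract calculus with two instances: points of a covering of [B], and
    paths in the nerve, which replace the points of its universal covering. The two base points are
    unrelated: words at [b0] become words at the vertex [V] after conjugation by the word of a path
    from [V] to [b0]. *)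

Notation II := unit_interval.

Lemma IIP (t : RR) : II t <-> 0 <= t /\ t <= 1.
Proof. by rewrite /unit_interval /= in_itv /=; split => [/andP| [-> ->] ]. Qed.

Lemma II0 : II 0. Proof. by apply/IIP; split; lra. Qed.
Lemma II1 : II 1. Proof. by apply/IIP; split; lra. Qed.

Section Continuity.
Variables (T U : topologicalType).

Lemma within_nbhs (D : set T) (f : T -> U) : {within D, continuous f} ->
  forall x O, D x -> open O -> O (f x) ->
    exists2 N, nbhs x N & forall y, N y -> D y -> O (f y).
Proof.
move=> /subspace_continuousP cf x O Dx oO Ofx.
have := cf x Dx O (open_nbhs_nbhs (conj oO Ofx)).
by rewrite /= /fmap /within /= => h; eexists; [exact: h|].
Qed.

Lemma nbhs_within (D : set T) (f : T -> U) :
  (forall x O, D x -> open O -> O (f x) ->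
    exists2 N, nbhs x N & forall y, N y -> D y -> O (f y)) ->
  {within D, continuous f}.
Proof.
move=> H; apply/subspace_continuousP => x Dx A /=; rewrite nbhsE => -[ O [oO Ofx] OA].
have [N nN NO] := H x O Dx oO Ofx.
by apply: filterS nN => y Ny Dy; apply/OA/NO.
Qed.

Lemma withinP (D : set T) (f : T -> U) :
  {within D, continuous f} <->
  forall O, open O -> rel_open D [set x | D x /\ O (f x)].
Proof.
split=> [cf O oO|H].
  move/continuousP: cf => /(_ O oO) /open_subspaceP [V oV VE].
  exists V; split=> //; rewrite VE; apply/seteqP.
  by split=> x /=; [case=> [[]]|case].
apply: nbhs_within => x O Dx oO Ofx.
have [V [oV VE]] := H O oO.
have [Vx _] : (V `&` D) x by rewrite -VE.
exists V; first exact: open_nbhs_nbhs.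
by move=> y Vy Dy; have [[]] : ([set x | D x /\ O (f x)] `&` D) y by rewrite VE.
Qed.

Lemma rel_openNP (D A : set T) :
  (forall x, A x -> D x -> exists2 N, nbhs x N & forall y, N y -> D y -> A y) ->
  rel_open D A.
Proof.
move=> H; exists [set x | exists2 N, nbhs x N & forall y, N y -> D y -> A y]°.
split; first exact: open_interior.
apply/seteqP; split=> x [].
  move=> Ax Dx; split=> //.
  have [N nN NA] := H x Ax Dx.
  by apply: (filterS _ (nbhs_interior nN)) => y Ny; exists N.
move=> /interior_subset [N nN NA] Dx; split=> //.
by apply: NA => //; exact: nbhs_singleton.
Qed.

Lemma rel_open_nbhs (D A : set T) x : rel_open D A -> A x -> D x ->
  exists2 N, nbhs x N & forall y, N y -> D y -> A y.
Proof.
move=> [V [oV VE]] Ax Dx.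
have [Vx _] : (V `&` D) x by rewrite -VE.
exists V; first exact: open_nbhs_nbhs.
by move=> y Vy Dy; have [] : (A `&` D) y by rewrite VE.
Qed.

End Continuity.

Section ContinuityOperations.
Variables (T U W : topologicalType).

Lemma within_comp (D : set T) (A : set U) (f : T -> U) (g : U -> W) :
  (forall x, D x -> A (f x)) ->
  {within A, continuous g} -> {within D, continuous f} ->
  {within D, continuous (fun x => g (f x))}.
Proof.
move=> DA /within_nbhs cg /within_nbhs cf; apply: nbhs_within => x O Dx oO Ogf.
have [N nN NO] := cg _ O (DA x Dx) oO Ogf.
have [M nM MN] := cf _ N° Dx (open_interior _) (nbhs_singleton (nbhs_interior nN)).
exists M => // y My Dy; apply: NO; last exact: DA.
by apply: interior_subset; apply: MN.
Qed.

Lemma within_ext (D : set T) (f g : T -> U) :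
  (forall x, D x -> f x = g x) ->
  {within D, continuous f} -> {within D, continuous g}.
Proof.
move=> fg /within_nbhs cf; apply: nbhs_within => x O Dx oO; rewrite -fg // => Ofx.
by have [N nN NO] := cf _ O Dx oO Ofx; exists N => // y Ny Dy; rewrite -fg //; exact: NO.
Qed.

Lemma within_glue (D D1 D2 : set T) (f g h : T -> U) :
  closed D1 -> closed D2 -> D `<=` D1 `|` D2 ->
  {within D `&` D1, continuous f} -> {within D `&` D2, continuous g} ->
  (forall x, D x -> D1 x -> h x = f x) -> (forall x, D x -> D2 x -> h x = g x) ->
  {within D, continuous h}.
Proof.
move=> c1 c2 DU /within_nbhs cf /within_nbhs cg hf hg; apply: nbhs_within => x O Dx oO Ohx.
have H1 : exists2 N, nbhs x N & forall y, N y -> D y -> D1 y -> O (h y).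
  have [D1x|nD1] := pselect (D1 x).
    rewrite hf // in Ohx.
    have [N nN NO] := cf _ O (conj Dx D1x) oO Ohx.
    by exists N => // y Ny Dy D1y; rewrite hf //; apply: NO.
  exists (~` D1) => //; apply: open_nbhs_nbhs; split=> //; exact: closed_openC.
have H2 : exists2 N, nbhs x N & forall y, N y -> D y -> D2 y -> O (h y).
  have [D2x|nD2] := pselect (D2 x).
    rewrite hg // in Ohx.
    have [N nN NO] := cg _ O (conj Dx D2x) oO Ohx.
    by exists N => // y Ny Dy D2y; rewrite hg //; apply: NO.
  exists (~` D2) => //; apply: open_nbhs_nbhs; split=> //; exact: closed_openC.
have [N1 nN1 H1'] := H1; have [N2 nN2 H2'] := H2.
exists (N1 `&` N2); first exact: filterI.
by move=> y [] N1y N2y Dy; have [|] := DU _ Dy; [exact: H1'|exact: H2'].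
Qed.

Lemma within_pair (D : set T) (f : T -> U) (g : T -> W) :
  {within D, continuous f} -> {within D, continuous g} ->
  {within D, continuous (fun x => (f x, g x))}.
Proof. by move=> cf cg x; apply: (cvg_pair (cf x) (cg x)). Qed.

Lemma within_cst (D : set T) (c : U) : {within D, continuous (fun=> c)}.
Proof. by move=> x; exact: cvg_cst. Qed.

Lemma within_fst (D : set T) (f : T -> U * W) :
  {within D, continuous f} -> {within D, continuous (fun x => (f x).1)}.
Proof. by move=> cf x; apply: (@continuous_comp (subspace D) _ _ f fst); [exact: cf|exact: cvg_fst]. Qed.

Lemma within_snd (D : set T) (f : T -> U * W) :
  {within D, continuous f} -> {within D, continuous (fun x => (f x).2)}.
Proof. by move=> cf x; apply: (@continuous_comp (subspace D) _ _ f snd); [exact: cf|exact: cvg_snd]. Qed.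

Lemma within_of_continuous (D : set T) (f : T -> U) :
  continuous f -> {within D, continuous f}.
Proof. exact: continuous_subspaceT. Qed.
End ContinuityOperations.

Section RealContinuity.
Variables (T : topologicalType) (D : set T).
Implicit Types f g : T -> RR.

Lemma within_id : {within D, continuous (fun x => x)}.
Proof. by apply: within_of_continuous => x; exact: cvg_id. Qed.

Lemma withinD f g : {within D, continuous f} -> {within D, continuous g} ->
  {within D, continuous (fun x => f x + g x)}.
Proof. by move=> cf cg x; exact: (@cvgD RR RR^o _ _ _ (f : _ -> RR^o) g _ _ (cf x) (cg x)). Qed.

Lemma withinM f g : {within D, continuous f} -> {within D, continuous g} ->
  {within D, continuous (fun x => f x * g x)}.
Proof. by move=> cf cg x; exact: (@cvgM RR _ _ _ (f : _ -> RR^o) g _ _ (cf x) (cg x)). Qed.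

Lemma withinB f g : {within D, continuous f} -> {within D, continuous g} ->
  {within D, continuous (fun x => f x - g x)}.
Proof. by move=> cf cg x; exact: (@cvgB RR RR^o _ _ _ (f : _ -> RR^o) g _ _ (cf x) (cg x)). Qed.

Lemma within_max f g : {within D, continuous f} -> {within D, continuous g} ->
  {within D, continuous (fun x => Num.max (f x) (g x))}.
Proof. by move=> cf cg x; exact: (@continuous_max RR (subspace D) (f : _ -> RR^o) g x (cf x) (cg x)). Qed.
End RealContinuity.

Lemma within_translate (D : set RR) (c : RR) : {within D, continuous ( +%R c)}.
Proof.
exact: (@withinD _ D (fun=> c) id (@within_cst _ _ D c) (@within_id RR D)).
Qed.

Lemma within_scale (D : set RR) (c : RR) : {within D, continuous ( *%R c)}.
Proof.
exact: (@withinM _ D (fun=> c) id (@within_cst _ _ D c) (@within_id RR D)).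
Qed.

(** * Paths and congruences of paths *)

Notation cpath a := ({within II, continuous a}).
Notation sq := (II `*` II).

Definition prev (T : Type) (a : RR -> T) : RR -> T := fun t => a (1 - t).

Lemma half_gt1 : ((1 : RR) <= 2^-1) = false.
Proof. by apply/negbTE; rewrite -ltNge; lra. Qed.

Lemma pcat0 (T : Type) (a b : RR -> T) : pcat a b 0 = a 0.
Proof. by rewrite /pcat mulr0 ifT //; lra. Qed.

Lemma pcat1 (T : Type) (a b : RR -> T) : pcat a b 1 = b 1.
Proof. by rewrite /pcat half_gt1; congr b; lra. Qed.

Lemma pcat_comp (T U : Type) (f : T -> U) (a b : RR -> T) :
  pcat (fun t => f (a t)) (fun t => f (b t)) = fun t => f (pcat a b t).
Proof. by apply/funext => t; rewrite /pcat; case: ifP. Qed.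

Lemma pcat_in (T : Type) (A : set T) (a b : RR -> T) :
  (forall t, II t -> A (a t)) -> (forall t, II t -> A (b t)) ->
  forall t, II t -> A (pcat a b t).
Proof.
move=> Aa Ab t /IIP [t0 t1]; rewrite /pcat; case: ifPn => h.
  by apply: Aa; apply/IIP; split; lra.
by apply: Ab; apply/IIP; move: h; rewrite -ltNge => h; split; lra.
Qed.

Lemma prev_II (t : RR) : II t -> II (1 - t).
Proof. by move=> /IIP [? ?]; apply/IIP; split; lra. Qed.

Lemma prev0 (T : Type) (a : RR -> T) : prev a 0 = a 1.
Proof. by rewrite /prev subr0. Qed.

Lemma prev1 (T : Type) (a : RR -> T) : prev a 1 = a 0.
Proof. by rewrite /prev subrr. Qed.

Lemma prevK (T : Type) (a : RR -> T) : prev (prev a) = a.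
Proof. by apply/funext => t; rewrite /prev; congr a; lra. Qed.

Lemma closed_leR (T : topologicalType) (phi : T -> RR) c :
  continuous phi -> closed [set x | phi x <= c].
Proof.
move=> cphi; apply: (@closed_comp _ _ phi [set y | y <= c]).
  by move=> x _; exact: cphi.
exact: (@closed_le RR c).
Qed.

Lemma closed_geR (T : topologicalType) (phi : T -> RR) c :
  continuous phi -> closed [set x | c <= phi x].
Proof.
move=> cphi; apply: (@closed_comp _ _ phi [set y | c <= y]).
  by move=> x _; exact: cphi.
exact: (@closed_ge RR c).
Qed.

Lemma within_if (T U : topologicalType) (phi : T -> RR) c (D : set T) (f g : T -> U) :
  continuous phi ->
  {within D `&` [set x | phi x <= c], continuous f} ->
  {within D `&` [set x | c <= phi x], continuous g} ->
  (forall x, D x -> phi x = c -> f x = g x) ->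
  {within D, continuous (fun x => if phi x <= c then f x else g x)}.
Proof.
move=> cphi cf cg fg.
apply: (@within_glue _ _ D [set x | phi x <= c] [set x | c <= phi x] f g) => //.
- exact: closed_leR.
- exact: closed_geR.
- by move=> x _ /=; have [h|h] := leP (phi x) c; [left|right; exact: ltW].
- by move=> x _ /= ->.
- move=> x Dx /= h; case: ifP => // h'; apply: fg => //.
  by apply/le_anti; rewrite h h'.
Qed.

(** Continuity is read off the syntax; this is why the piecewise linear reparametrizations below are
    written with [Num.max] and not by cases. *)
Ltac wcont := repeat lazymatch goal with
  | |- {within _, continuous (fun=> ?c)} => exact: within_cst
  | |- {within _, continuous (fun x => x)} => exact: within_id
  | |- {within _, continuous (fun x => x.1)} => apply: within_fst; exact: within_id
  | |- {within _, continuous (fun x => x.2)} => apply: within_snd; exact: within_id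
  | |- {within _, continuous (fun x => (@?f x, @?g x))} => apply: within_pair
  | |- {within _, continuous (fun x => @?f x - @?g x)} => apply: withinB
  | |- {within _, continuous (fun x => @?f x + @?g x)} => apply: withinD
  | |- {within _, continuous (fun x => @?f x * @?g x)} => apply: withinM
  | |- {within _, continuous (fun x => Num.max (@?f x) (@?g x))} => apply: within_max
  | |- {within _, continuous ( *%R _)} => exact: within_scale
  | |- {within _, continuous ( +%R _)} => exact: within_translate
  | |- {within _, continuous id} => exact: within_id
  | |- {within _, continuous fst} => apply: within_fst; exact: within_id
  | |- {within _, continuous snd} => apply: within_snd; exact: within_id
  | |- _ => assumption
  end.

(* [lra] fails on equations between points of a space. *)
Ltac rlra := repeat match goal with
  | H : @eq ?A _ _ |- _ => lazymatch A with RR => fail | _ => clear H end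
  end; lra.

Section Paths.
Variable T : topologicalType.
Implicit Types a b c : RR -> T.

Lemma cpath_pcat a b : cpath a -> cpath b -> a 1 = b 0 -> cpath (pcat a b).
Proof.
move=> ca cb ab; apply: (within_if (phi := id)).
- by move=> x; exact: cvg_id.
- apply: (within_comp _ ca); last by wcont.
  by move=> t [/IIP [? ?] /= ?]; apply/IIP; split; lra.
- apply: (within_comp _ cb); last by wcont.
  by move=> t [/IIP [? ?] /= ?]; apply/IIP; split; lra.
- by move=> t _ ->; rewrite divff ?subrr //; lra.
Qed.

Lemma cpath_comp a (p : RR -> RR) : cpath a -> cpath p ->
  (forall t, II t -> II (p t)) -> cpath (fun t => a (p t)).
Proof. by move=> ca cp pI; exact: (within_comp pI ca). Qed.

Lemma cpath_prev a : cpath a -> cpath (prev a).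
Proof. by move=> ca; apply: (cpath_comp (p := fun t => 1 - t)) => //; [wcont|exact: prev_II]. Qed.

Lemma cpath_scale a (c : RR) : II c -> cpath a -> cpath (fun t => a (c * t)).
Proof.
move=> /IIP [c0 c1] ca; apply: (cpath_comp (p := fun t => c * t)) => //; first by wcont.
by move=> t /IIP [? ?]; apply/IIP; split; nra.
Qed.

End Paths.

(** The common interface of homotopy, equality of lifts and equality of words. In [pc_reparam] the
    maps [p] and [r] need not be monotone, so units, inverses and associativity all become
    comparisons of two reparametrizations of one path. *)
Record path_congruence (T : topologicalType) (R : (RR -> T) -> (RR -> T) -> Prop) := {
  pc_refl : forall a, cpath a -> R a a;
  pc_sym : forall a b, R a b -> R b a;
  pc_trans : forall a b c, R a b -> R b c -> R a c;
  pc_end0 : forall a b, R a b -> a 0 = b 0;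
  pc_end1 : forall a b, R a b -> a 1 = b 1;
  pc_pcat : forall a a' b b', R a a' -> R b b' -> a 1 = b 0 ->
    R (pcat a b) (pcat a' b');
  pc_reparam : forall a (p r : RR -> RR), cpath a -> cpath p -> cpath r ->
    (forall t, II t -> II (p t)) -> (forall t, II t -> II (r t)) ->
    p 0 = r 0 -> p 1 = r 1 ->
    R (fun t => a (p t)) (fun t => a (r t)) }.

Section PathCongruence.
Variables (T : topologicalType) (R : (RR -> T) -> (RR -> T) -> Prop).
Hypothesis RC : path_congruence R.
Implicit Types a b c : RR -> T.

Lemma pc_ext a b : cpath a -> (forall t, II t -> a t = b t) -> R a b.
Proof.
move=> ca ab.
(* Precomposed with [r], paths that agree on the interval become equal functions on the whole line,
   so [pc_reparam] leads from [a] to [b]. The value 0 outside is an arbitrary point of the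
   interval. *)
pose r (t : RR) : RR := if (0 <= t) && (t <= 1) then t else 0.
have rE t : II t -> r t = t by move=> /IIP [h0 h1]; rewrite /r h0 h1.
have rI t : II (r t).
  rewrite /r; case: ifP => [/andP [? ?]|_]; [exact/IIP|exact: II0].

have cr : cpath r by apply: (within_ext (f := id)) => [t /rE //|]; wcont.
have cb : cpath b by exact: (within_ext ab).
have e : (fun t => a (r t)) = (fun t => b (r t)) by apply/funext => t; exact: ab.
apply: (pc_trans RC (b := fun t => a (r t))).
  by apply: (pc_reparam RC (p := id)) => //; [wcont|rewrite (rE _ II0)|rewrite (rE _ II1)].
rewrite e; apply: (pc_reparam RC (r := id)) => //; first by wcont.
- by rewrite (rE _ II0).
- by rewrite (rE _ II1).
Qed.

Lemma pc_reparam_ext a a' b' (p r : RR -> RR) : cpath a -> cpath p -> cpath r ->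
  (forall t, II t -> II (p t)) -> (forall t, II t -> II (r t)) ->
  p 0 = r 0 -> p 1 = r 1 ->
  (forall t, II t -> a' t = a (p t)) -> (forall t, II t -> b' t = a (r t)) -> R a' b'.
Proof.
move=> ca cp cr pI rI p0 p1 ap br.
apply: (pc_trans RC (b := fun t => a (p t))).
  by apply: (pc_sym RC); apply: pc_ext => [|t /ap //]; exact: cpath_comp.
apply: (pc_trans RC (b := fun t => a (r t))); first exact: (pc_reparam RC).
by apply: pc_ext => [|t /br //]; exact: cpath_comp.
Qed.

Lemma pc_pcat_cst a : cpath a -> R (pcat a (fun=> a 1)) a.
Proof.
(* The map is the minimum of 1 and 2t. *)
move=> ca; apply: (@pc_reparam_ext a _ _ (fun t => 1 - Num.max 0 (1 - 2 * t)) id) => //.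
- by wcont.
- by wcont.
- by move=> t /IIP [? ?]; apply/IIP; rewrite /Num.max; case: ifPn; rewrite -?leNgt => ?; split; lra.
- by rewrite mulr0 subr0 /Num.max ltr01 subrr.
- by rewrite /Num.max ifF ?subr0 //; apply/negbTE; rewrite -leNgt; lra.
- move=> t /IIP [? ?]; rewrite /pcat /Num.max; case: ifPn; case: ifPn; rewrite -?leNgt -?ltNge => ? ?; congr a; lra.
Qed.

Lemma pc_cst_pcat a : cpath a -> R (pcat (fun=> a 0) a) a.
Proof.
move=> ca; apply: (@pc_reparam_ext a _ _ (fun t => Num.max 0 (2 * t - 1)) id) => //.
- by wcont.
- by wcont.
- by move=> t /IIP [? ?]; apply/IIP; rewrite /Num.max; case: ifPn; rewrite -?leNgt => ?; split; lra.
- by rewrite /Num.max ifF //; apply/negbTE; rewrite -leNgt; lra.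
- by rewrite /Num.max ifT; lra.
- move=> t /IIP [? ?]; rewrite /pcat /Num.max; case: ifPn; case: ifPn; rewrite -?leNgt -?ltNge => ? ?; congr a; lra.
Qed.

Lemma pc_pcat_prev a : cpath a -> R (pcat a (prev a)) (fun=> a 0).
Proof.
move=> ca.
(* The tent 1 - |2t - 1| runs from 0 to 1 and back. *)
apply: (@pc_reparam_ext a _ _ (fun t => 1 - Num.max (1 - 2 * t) (2 * t - 1)) (fun=> 0)) => //.
- by wcont.
- by wcont.
- by move=> t /IIP [? ?]; apply/IIP; rewrite /Num.max; case: ifPn; rewrite -?leNgt => ?; split; lra.
- by move=> t _; exact: II0.
- by rewrite /Num.max ifF; [lra|apply/negbTE; rewrite -leNgt; lra].
- by rewrite /Num.max ifT; lra.
- move=> t /IIP [? ?]; rewrite /pcat /prev /Num.max; case: ifPn; case: ifPn; rewrite -?leNgt -?ltNge => ? ?; congr a; lra.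
Qed.

Lemma pc_prev_pcat a : cpath a -> R (pcat (prev a) a) (fun=> a 1).
Proof.
by move=> ca; rewrite -{2}(prevK a) -(prev0 a); apply: pc_pcat_prev; exact: cpath_prev.
Qed.

Lemma pc_assoc a b c : cpath a -> cpath b -> cpath c -> a 1 = b 0 -> b 1 = c 0 ->
  R (pcat (pcat a b) c) (pcat a (pcat b c)).
Proof.
move=> ca cb cc ab bc.
have cm : cpath (pcat (pcat a b) c).
  by apply: cpath_pcat => //; [exact: cpath_pcat|rewrite pcat1].
(* The convex piecewise linear map taking 1/2 to 1/4 and 3/4 to 1/2, that is, the breakpoints of one
   bracketing to those of the other; being convex, it is the maximum of its three linear pieces. *)
apply: (@pc_reparam_ext (pcat (pcat a b) c) _ _ id
  (fun t => Num.max (2^-1 * t) (Num.max (t - 4^-1) (2 * t - 1)))) => //.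
- by wcont.
- by wcont.
- move=> t /IIP [? ?]; apply/IIP.
  case: (ltP (t - 4^-1) (2 * t - 1)) => ?; last by case: (ltP (2^-1 * t) (t - 4^-1)) => ?; split; lra.
  by case: (ltP (2^-1 * t) (2 * t - 1)) => ?; split; lra.
- case: (ltP (0 - 4^-1) (2 * 0 - 1 : RR)) => ?; first by lra.
  by case: (ltP (2^-1 * 0) (0 - 4^-1 : RR)) => ?; lra.
- case: (ltP (1 - 4^-1) (2 * 1 - 1 : RR)) => ?; last by lra.
  by case: (ltP (2^-1 * 1) (2 * 1 - 1 : RR)) => ?; lra.
- move=> t /IIP [? ?]; rewrite /pcat.
  case: (ltP (t - 4^-1) (2 * t - 1)) => ?.
    case: (ltP (2^-1 * t) (2 * t - 1)) => ?; last (by exfalso; rlra).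
    repeat (case: ifPn; rewrite -?leNgt -?ltNge => ?); try reflexivity; exfalso; rlra.
  case: (ltP (2^-1 * t) (t - 4^-1)) => ?.
    repeat (case: ifPn; rewrite -?leNgt -?ltNge => ?); try (exfalso; rlra); congr b; rlra.
  repeat (case: ifPn; rewrite -?leNgt -?ltNge => ?); try (exfalso; rlra); try (congr a; rlra).
Qed.

End PathCongruence.

(** * Homotopy of paths *)

Definition lerp (p q : RR * RR) (t : RR) : RR * RR :=
  ((1 - t) * p.1 + t * q.1, (1 - t) * p.2 + t * q.2).

Definition convex2 (D : set (RR * RR)) :=
  forall p q t, D p -> D q -> II t -> D (lerp p q t).

Lemma lerp0 p q : lerp p q 0 = p.
Proof. by case: p => x y; rewrite /lerp /= subr0 !mul1r !mul0r !addr0. Qed.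

Lemma lerp1 p q : lerp p q 1 = q.
Proof. by case: q => x y; rewrite /lerp /= subrr !mul1r !mul0r !add0r. Qed.

Lemma lerp_same p t : lerp p p t = p.
Proof. by case: p => x y; rewrite /lerp /= -!mulrDl subrK !mul1r. Qed.

Lemma convex2_sq : convex2 sq.
Proof.
move=> p q t [/= /IIP [? ?] /IIP [? ?]] [/IIP [? ?] /IIP [? ?]] /IIP [? ?].
by split; apply/IIP => /=; split; nra.
Qed.

Lemma convex2_disk : convex2 disk.
Proof.
move=> p q t; rewrite /disk /= => hp hq /IIP [? ?].
set a := p.1 in hp *; set b := p.2 in hp *; set c := q.1 in hq *; set d := q.2 in hq *.
(* The squared norm falls short of its linear interpolation by t(1 - t) times the squared distance
   of the two points. *)
have -> : ((1 - t) * a + t * c) ^+ 2 + ((1 - t) * b + t * d) ^+ 2 =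
  (1 - t) * (a ^+ 2 + b ^+ 2) + t * (c ^+ 2 + d ^+ 2)
    - t * (1 - t) * ((a - c) ^+ 2 + (b - d) ^+ 2) by rewrite !expr2; lra.
have h1 : 0 <= t * (1 - t) * ((a - c) ^+ 2 + (b - d) ^+ 2).
  by apply: mulr_ge0; [apply: mulr_ge0; lra|apply: addr_ge0; exact: sqr_ge0].
move: h1 hp hq; set X := t * (1 - t) * _; set Y := a ^+ 2 + _; set Z := c ^+ 2 + _ => *.
nra.
Qed.

Lemma within_lerp (T : topologicalType) (D : set T) (p q : T -> RR * RR) (t : T -> RR) :
  {within D, continuous p} -> {within D, continuous q} -> {within D, continuous t} ->
  {within D, continuous (fun x => lerp (p x) (q x) (t x))}.
Proof.
move=> cp cq ct.
have := within_fst cp; have := within_snd cp; have := within_fst cq; have := within_snd cq.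
by move=> c1 c2 c3 c4; rewrite /lerp; wcont.
Qed.

Lemma continuous_lerp (p q : RR * RR) (D : set RR) : {within D, continuous (lerp p q)}.
Proof.
apply: (@within_lerp _ _ (fun=> p) (fun=> q) id); by wcont.
Qed.

Definition htpy (T : topologicalType) (a b : RR -> T) :=
  exists h : RR * RR -> T,
    [/\ {within sq, continuous h},
        (forall s, II s -> h (s, 0) = a s /\ h (s, 1) = b s) &
        (forall t, II t -> h (0, t) = a 0 /\ h (1, t) = a 1)].

Section Homotopy.
Variable T : topologicalType.
Implicit Types a b c : RR -> T.

(** The linear homotopy from [p] to [r] stays in the convex set [D], and [f] carries it to [T].
    Reparametrizations, triangles in a disk and cones over a path are all handled as images of such
    planar homotopies. *)
Lemma htpy_straight (D : set (RR * RR)) (f : RR * RR -> T) (p r : RR -> RR * RR) :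
  convex2 D -> {within D, continuous f} ->
  {within II, continuous p} -> {within II, continuous r} ->
  (forall t, II t -> D (p t)) -> (forall t, II t -> D (r t)) ->
  p 0 = r 0 -> p 1 = r 1 ->
  htpy (fun t => f (p t)) (fun t => f (r t)).
Proof.
move=> cD cf cp cr pD rD e0 e1.
exists (fun x => f (lerp (p x.1) (r x.1) x.2)); split.
- apply: (within_comp (A := D) _ cf).
    by move=> x [h1 h2]; apply: cD => //; [exact: pD|exact: rD].
  have c1 : {within sq, continuous (fun x : RR * RR => x.1)} by wcont.
  apply: within_lerp; last by wcont.
  + by apply: (within_comp _ cp c1) => x [].
  + by apply: (within_comp _ cr c1) => x [].
- by move=> s _ /=; rewrite lerp0 lerp1.
- by move=> t _ /=; rewrite -e0 -e1 !lerp_same.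
Qed.

Lemma htpy_cpath a b : htpy a b -> cpath a /\ cpath b.
Proof.
move=> [h [ch h1 h2]]; split.
  apply: (within_ext (f := fun s => h (s, 0))); first by move=> s /h1 [].
  by apply: (within_comp (A := sq) _ ch); [move=> s hs; split=> //; exact: II0|wcont].
apply: (within_ext (f := fun s => h (s, 1))); first by move=> s /h1 [].
by apply: (within_comp (A := sq) _ ch); [move=> s hs; split=> //; exact: II1|wcont].
Qed.

Lemma htpy_path_congruence : path_congruence (@htpy T).
Proof.
have ends a b : htpy a b -> a 0 = b 0 /\ a 1 = b 1.
  move=> [h [ch h1 h2]]; have [e0 e1] := h2 _ II1.
  by have [_ <-] := h1 _ II0; have [_ <-] := h1 _ II1.
split.
- move=> a ca; exists (fun x => a x.1); split=> //.
  by apply: (within_comp (A := II) _ ca); [move=> x []|wcont].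
- move=> a b hab; have [e0 e1] := ends _ _ hab.
  case: hab => h [ch h1 h2].
  exists (fun x => h (x.1, 1 - x.2)); split.
  + apply: (within_comp (A := sq) _ ch); last by wcont.
    by move=> x [? ?]; split=> //; exact: prev_II.
  + by move=> s hs /=; rewrite subr0 subrr; have [-> ->] := h1 _ hs.
  + by move=> t ht /=; have [-> ->] := h2 _ (prev_II ht).
- move=> a b c hab hbc; have [e0 e1] := ends _ _ hab.
  case: hab => h [ch h1 h2]; case: hbc => k [ck k1 k2].
  exists (fun x => if x.2 <= 2^-1 then h (x.1, 2 * x.2) else k (x.1, 2 * x.2 - 1)); split.
  + apply: (within_if (phi := snd)); first by move=> x; exact: cvg_snd.
    * apply: (within_comp (A := sq) _ ch); last by wcont.
      by move=> x [[? /IIP [? ?]] /= ?]; split=> //; apply/IIP => /=; split; rlra.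
    * apply: (within_comp (A := sq) _ ck); last by wcont.
      by move=> x [[? /IIP [? ?]] /= ?]; split=> //; apply/IIP => /=; split; rlra.
    * move=> x [hx _] /= ->; rewrite mulfV ?pnatr_eq0 //.
      by rewrite subrr; have [_ ->] := h1 _ hx; have [-> _] := k1 _ hx.
  + move=> s hs /=; rewrite half_gt1 ifT; last by rlra.
    rewrite mulr0 (_ : 2 * 1 - 1 = 1); last by rlra.
    by have [-> _] := h1 _ hs; have [_ ->] := k1 _ hs.
  + move=> t /IIP [? ?] /=; case: ifPn => h3.
      by have [] := h2 (2 * t); first by apply/IIP; split; rlra.
    rewrite -ltNge in h3; rewrite e0 e1.
    by have [] := k2 (2 * t - 1); first by apply/IIP; split; rlra.
- by move=> a b /ends [].
- by move=> a b /ends [].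
- move=> a a' b b' ha hb ab; have [e0 e1] := ends _ _ ha; have [e2 e3] := ends _ _ hb.
  case: ha => h [ch h1 h2]; case: hb => k [ck k1 k2].
  exists (fun x => if x.1 <= 2^-1 then h (2 * x.1, x.2) else k (2 * x.1 - 1, x.2)); split.
  + apply: (within_if (phi := fst)); first by move=> x; exact: cvg_fst.
    * apply: (within_comp (A := sq) _ ch); last by wcont.
      by move=> x [[/IIP [? ?] ?] /= ?]; split=> //; apply/IIP => /=; split; rlra.
    * apply: (within_comp (A := sq) _ ck); last by wcont.
      by move=> x [[/IIP [? ?] ?] /= ?]; split=> //; apply/IIP => /=; split; rlra.
    * move=> x [_ hx] /= ->; rewrite mulfV ?pnatr_eq0 //.
      by rewrite subrr; have [_ ->] := h2 _ hx; have [-> _] := k2 _ hx.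
  + move=> s /IIP [? ?] /=; rewrite /pcat; case: ifPn => h3.
      by apply: h1; apply/IIP; split; rlra.
    by rewrite -ltNge in h3; apply: k1; apply/IIP; split; rlra.
  + move=> t ht /=; rewrite half_gt1 ifT; last by rlra.
    rewrite pcat0 pcat1 mulr0 (_ : 2 * 1 - 1 = 1); last by rlra.
    by have [-> _] := h2 _ ht; have [_ ->] := k2 _ ht.
- move=> a p r ca cp cr pI rI e0 e1.
  apply: (@htpy_straight sq (fun x => a x.1) (fun t => (p t, 0)) (fun t => (r t, 0))).
  + exact: convex2_sq.
  + by apply: (within_comp (A := II) _ ca); [move=> x []|wcont].
  + by wcont.
  + by wcont.
  + by move=> t ht; split; [exact: pI|exact: II0].
  + by move=> t ht; split; [exact: rI|exact: II0].
  + by rewrite e0.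
  + by rewrite e1.
Qed.
End Homotopy.

(** * Words in a cover *)

(** A Lebesgue number argument. Every [n] from [n0] on is allowed, so that [n] can later be a common
    multiple of given subdivisions. Compactness gives one radius for all centres, and a cell lies in
    the closed sup-norm ball of radius 1/n about its lower left corner. [i0] fills the indices
    outside the grid. *)
Lemma lebesgue_square (I : Type) (i0 : I) (P : I -> set (RR * RR)) :
  (forall p, sq p -> exists i, exists2 N, nbhs p N & forall q, N q -> sq q -> P i q) ->
  exists n0 : nat, forall n : nat, (n0 <= n)%N -> exists c : nat -> nat -> I,
    forall k l, (k < n)%N -> (l < n)%N -> forall q, sq q ->
      k%:R <= n%:R * q.1 <= k.+1%:R -> l%:R <= n%:R * q.2 <= l.+1%:R -> P (c k l) q.
Proof.
move=> H.
pose S (n : nat) (p : RR * RR) := exists i, forall q, sq q ->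
  `|q.1 - p.1| <= n.+1%:R^-1 -> `|q.2 - p.2| <= n.+1%:R^-1 -> P i q.
have csq : compact sq by apply: compact_setX; exact: (@segment_compact RR).
have [n0 _ Hn0] : \forall n \near \oo, sq `<=` S n.
  apply: (iffLR (compact_near_coveringP sq) csq) => p Dp.
  have [i [N nN NP]] := H p Dp.
  have /nbhs_ballP [e /= e0 eN] := nN.
  have h0 : 0 < e / 2 by rewrite divr_gt0.
  near=> p' n => /=.
  exists i => q Dq q1 q2; apply: NP => //; apply: eN.
  have nle : n.+1%:R^-1 < e / 2.
    by near: n; exact: (near_infty_natSinv_lt (PosNum h0)).
  have [b1 b2] : ball p (e / 2) p' by near: p'; exact: nbhsx_ballx.
  split.
    rewrite (_ : e = e / 2 + e / 2); last by lra.
    apply: (ball_triangle b1); rewrite /ball /= distrC; exact: le_lt_trans nle.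
  rewrite (_ : e = e / 2 + e / 2); last by lra.
  apply: (ball_triangle b2); rewrite /ball /= distrC; exact: le_lt_trans nle.
(* Mesh [n] needs radius 1/n, which is [S n.-1]; hence the shift by one. *)
exists n0.+1 => n n0n.
have Sn : sq `<=` S n.-1 by apply: Hn0 => /=; rewrite -ltnS prednK // (leq_trans _ n0n).
have npos : (0 < n)%N by exact: leq_trans n0n.
have n0' : 0 < n%:R :> RR by rewrite ltr0n.
rewrite /S prednK // in Sn.
have kI (k : nat) : (k < n)%N -> II (k%:R / n%:R).
  move=> kn; apply/IIP; split; first by rewrite divr_ge0 // ler0n.
  by rewrite ler_pdivrMr // mul1r ler_nat ltnW.
have near_grid (k : nat) (t : RR) : k%:R <= n%:R * t <= k.+1%:R -> `|t - k%:R / n%:R| <= n%:R^-1.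
  move=> /andP [h1 h2].
  have -> : t - k%:R / n%:R = (n%:R * t - k%:R) / n%:R.
    by rewrite mulrBl mulrAC mulfV ?mul1r // gt_eqF.
  rewrite ger0_norm; last by rewrite divr_ge0 ?ler0n // subr_ge0.
  by rewrite ler_pdivrMr // mulVf ?gt_eqF // lerBlDl -natr1 in h2 *.
have /choice [c Hc] : forall kl : nat * nat, exists i, (kl.1 < n)%N -> (kl.2 < n)%N ->
    forall q, sq q -> kl.1%:R <= n%:R * q.1 <= kl.1.+1%:R ->
      kl.2%:R <= n%:R * q.2 <= kl.2.+1%:R -> P i q.
  move=> [k l] /=; have [kn|kn] := boolP (k < n)%N; last by exists i0.
  have [ln|ln] := boolP (l < n)%N; last by exists i0.
  have [|i Hi] := Sn (k%:R / n%:R, l%:R / n%:R); first by split; exact: kI.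
  by exists i => _ _ q Dq h1 h2; apply: Hi => //=; exact: near_grid.
by exists (fun k l => c (k, l)) => k l kn ln; exact: (Hc (k, l)).
Unshelve. all: by end_near.
Qed.

Section Words.
Variables (B : Type) (C : set (set B)).

(** These are the moves of edge paths in the nerve: merging a repeated letter, and cutting a corner
    inside a simplex. Taking [x = u] in the second move, followed by the first, cancels a
    backtracking. *)
Inductive weq : seq (set B) -> seq (set B) -> Prop :=
| weq_refl w : weq w w
| weq_sym w w' : weq w w' -> weq w' w
| weq_trans w w' w'' : weq w w' -> weq w' w'' -> weq w w''
| weq_dup_in w1 u w2 : weq (w1 ++ [:: u, u & w2]) (w1 ++ u :: w2)
| weq_tri_in w1 u v x w2 b : C u -> C v -> C x -> u b -> v b -> x b ->
    weq (w1 ++ [:: u, v, x & w2]) (w1 ++ [:: u, x & w2]).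

Lemma weq_catl w w1 w2 : weq w1 w2 -> weq (w ++ w1) (w ++ w2).
Proof.
elim=> {w1 w2}; [by constructor|by move=> *; apply: weq_sym| | |].
- by move=> ? y ? *; apply: (weq_trans (w' := w ++ y)).
- by move=> *; rewrite !catA; exact: weq_dup_in.
- by move=> w1 u v x w2 b *; rewrite !catA; apply: weq_tri_in; eassumption.
Qed.

Lemma weq_catr w w1 w2 : weq w1 w2 -> weq (w1 ++ w) (w2 ++ w).
Proof.
elim=> {w1 w2}; [by constructor|by move=> *; apply: weq_sym| | |].
- by move=> ? y ? *; apply: (weq_trans (w' := y ++ w)).
- by move=> *; rewrite -!catA; exact: weq_dup_in.
- by move=> w1 u v x w2 b *; rewrite -!catA; apply: weq_tri_in; eassumption.
Qed.

Lemma weq_cat w1 w1' w2 w2' : weq w1 w1' -> weq w2 w2' -> weq (w1 ++ w2) (w1' ++ w2').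
Proof. by move=> h1 h2; apply: weq_trans (weq_catr _ h1) (weq_catl _ h2). Qed.

Lemma weq_cons u w w' : weq w w' -> weq (u :: w) (u :: w').
Proof. exact: (weq_catl [:: u]). Qed.

Lemma weq_dup u w : weq [:: u, u & w] (u :: w).
Proof. exact: (weq_dup_in [::]). Qed.

Lemma weq_tri u v x w b : C u -> C v -> C x -> u b -> v b -> x b ->
  weq [:: u, v, x & w] [:: u, x & w].
Proof. exact: (@weq_tri_in [::]). Qed.

Lemma weq_nseq M u w : weq (nseq M.+1 u ++ w) (u :: w).
Proof. by elim: M => [|M IH]; [constructor|apply: weq_trans IH; exact: weq_dup]. Qed.

Lemma weq_rep M w : weq (flatten [seq nseq M.+1 u | u <- w]) w.
Proof.
elim: w => [|u w IH]; first by constructor.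
by apply: weq_trans (weq_cons _ IH); exact: weq_nseq.
Qed.

(** Piece [k] of the refined subdivision lies in piece [k %/ M.+1] of the old one, so refining
    repeats each letter, which [weq_rep] undoes. *)
Lemma mkseq_rep (i : nat -> set B) n M :
  mkseq (fun k => i (k %/ M.+1)%N) (n * M.+1) = flatten [seq nseq M.+1 u | u <- mkseq i n].
Proof.
elim: n => [|n IH] //.
rewrite mkseqS map_rcons flatten_rcons -IH mulSn addnC /mkseq iotaD map_cat add0n; congr (_ ++ _).
apply: (@eq_from_nth _ set0); rewrite ?size_map ?size_iota ?size_nseq // => k kM.
rewrite (nth_map 0%N) ?size_iota // nth_iota // nth_nseq kM.
by rewrite divnMDl // divn_small // addn0.
Qed.

Lemma mkseq_cons (i : nat -> set B) n : mkseq i n.+1 = i 0%N :: mkseq (fun k => i k.+1) n.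
Proof. by rewrite /mkseq /= -[1%N]addn0 iotaDl -map_comp. Qed.

Lemma mkseq_cat (i j : nat -> set B) n m :
  mkseq (fun k => if (k < n)%N then i k else j (k - n)%N) (n + m) = mkseq i n ++ mkseq j m.
Proof.
rewrite /mkseq iotaD map_cat add0n; congr (_ ++ _).
  by apply/eq_in_map => k; rewrite mem_iota add0n => /= ->.
have -> : iota n m = [seq (n + k)%N | k <- iota 0 m] by rewrite -iotaDl addn0.
rewrite -map_comp; apply: eq_map => k /=.
by rewrite ltnNge leq_addr /= addKn.
Qed.

Fixpoint chain (u : set B) (w : seq (set B)) : Prop :=
  if w is v :: w' then [/\ C v, (exists b, u b /\ v b) & chain v w'] else True.

Lemma chain_cat u w w' : chain u (w ++ w') <-> chain u w /\ chain (last u w) w'.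
Proof.
elim: w u => [|v w IH] u /=; first by split=> // -[].
split=> [[? ? /IH [? ?]]|[[? ? ?] ?]]; first by [].
by split=> //; apply/IH.
Qed.

(** The end letters [U] and [W] are prescribed, so words of different subdivisions have the same
    ends, and concatenation only has to merge letters at the junction. *)
Definition wdev (U : set B) n (i : nat -> set B) (W : set B) := U :: rcons (mkseq i n) W.

End Words.

(** * Words developing a path *)

Section Developments.
Variables (B : Type) (C : set (set B)) (X : topologicalType) (O : set B -> set X).
Hypothesis Oopen : forall u, C u -> open (O u).
Hypothesis Ocover : forall x, exists2 u, C u & O u x.
Hypothesis Opoint : forall x, exists b, forall u, C u -> O u x -> u b.

Local Notation weq := (weq C).

Lemma weq_pt u v x w p : C u -> C v -> C x -> O u p -> O v p -> O x p ->
  weq [:: u, v, x & w] [:: u, x & w].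
Proof.
move=> Cu Cv Cx up vp xp; have [b Hb] := Opoint p.
by apply: (@weq_tri _ _ _ _ _ _ b) => //; exact: Hb.
Qed.

Lemma wdev_points n U W i j (x : nat -> X) : C U -> C W -> O U (x 0%N) -> O W (x n) ->
  (forall k, (k < n)%N -> [/\ C (i k), O (i k) (x k) & O (i k) (x k.+1)]) ->
  (forall k, (k < n)%N -> [/\ C (j k), O (j k) (x k) & O (j k) (x k.+1)]) ->
  weq (wdev U n i W) (wdev U n j W).
Proof.
elim: n U i j x => [|n IH] U i j x CU CW Ux Wx Hi Hj; first by constructor.
rewrite /wdev !mkseq_cons !rcons_cons.
have [Ci i0 i1] := Hi 0%N isT; have [Cj j0 j1] := Hj 0%N isT.
(* The tails are exchanged behind the letter [i 0]; then [j 0] is inserted before [i 0] at the point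
   [x 0], and [i 0] is dropped at the point [x 1]. *)
have IH' := IH (i 0%N) (fun k => i k.+1) (fun k => j k.+1) (fun k => x k.+1) Ci CW i1 Wx
  (fun k => Hi k.+1) (fun k => Hj k.+1).
apply: weq_trans (weq_cons _ IH') _; rewrite /wdev.
have [v [w [-> Cv vx]]] : exists v w,
    [/\ rcons (mkseq (fun k => j k.+1) n) W = v :: w, C v & O v (x 1%N)].
  case: n Wx Hj {IH IH' Hi} => [|n] Wx Hj; first by exists W, [::].
  by rewrite mkseq_cons rcons_cons; do 2 eexists; split; [reflexivity| |]; case: (Hj 1%N isT).
apply: (weq_trans (w' := [:: U, j 0%N, i 0%N, v & w])).
  by apply: weq_sym; exact: (weq_pt _ (p := x 0%N)).
by apply: weq_cons; exact: (weq_pt _ (p := x 1%N)).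
Qed.

Definition devs n (i : nat -> set B) (a : RR -> X) := forall k, (k < n)%N ->
  C (i k) /\ forall t, II t -> k%:R <= n%:R * t <= k.+1%:R -> O (i k) (a t).

Lemma grid_II n k : (0 < n)%N -> (k <= n)%N -> II (k%:R / n%:R).
Proof.
move=> n0 kn; apply/IIP; split; first by rewrite divr_ge0 // ler0n.
by rewrite ler_pdivrMr ?ltr0n // mul1r ler_nat.
Qed.

Lemma gridE n k : (0 < n)%N -> n%:R * (k%:R / n%:R) = k%:R :> RR.
Proof. by move=> n0; rewrite mulrC divfK // pnatr_eq0 -lt0n. Qed.

Lemma devs_points n i a : (0 < n)%N -> devs n i a -> forall k, (k < n)%N ->
  [/\ C (i k), O (i k) (a (k%:R / n%:R)) & O (i k) (a (k.+1%:R / n%:R))].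
Proof.
move=> n0 D k kn; have [Ck Hk] := D k kn; split=> //; apply: Hk.
- by apply: grid_II => //; exact: ltnW.
- by rewrite gridE // lexx ler_nat leqnSn.
- exact: grid_II.
- by rewrite gridE // lexx ler_nat leqnSn.
Qed.

Lemma devs_refine n i a M : devs n i a -> devs (n * M.+1) (fun k => i (k %/ M.+1)%N) a.
Proof.
move=> D k kn.
have kn' : (k %/ M.+1 < n)%N by rewrite ltn_divLR.
have [Ck Hk] := D _ kn'; split=> // t It /andP [h1 h2]; apply: Hk => //.
have M0 : 0 < M.+1%:R :> RR by rewrite ltr0n.
rewrite -(ler_pM2r M0) -(ler_pM2r M0 (n%:R * t)) mulrAC -!natrM.
apply/andP; split.
  by apply: le_trans h1; rewrite ler_nat leq_divM.
by apply: (le_trans h2); rewrite ler_nat; exact: ltn_ceil.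
Qed.

Lemma wdev_refine n i U W M :
  weq (wdev U (n * M.+1) (fun k => i (k %/ M.+1)%N) W) (wdev U n i W).
Proof.
rewrite /wdev -!cats1 mkseq_rep; apply: weq_cons; apply: weq_catr; exact: weq_rep.
Qed.

Lemma devs_ext n i a b : (forall t, II t -> a t = b t) -> devs n i a -> devs n i b.
Proof.
by move=> ab D k /D [Ck Hk]; split=> // t It h; rewrite -ab //; exact: Hk.
Qed.

(** A fine grid on the square yields one word per row of cells. Rows [l] and [l.+1] both contain the
    values on the line at height [l.+1], so [wdev_points] identifies their words; the bottom and top
    rows are compared with the given developments in the same way. The sides stay in [O U] and
    [O W], so the end letters never change. *)
Lemma wdev_homotopy (h : RR * RR -> X) U W n i m j :
  {within sq, continuous h} ->
  (forall t, II t -> O U (h (0, t)) /\ O W (h (1, t))) -> C U -> C W ->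
  (0 < n)%N -> (0 < m)%N ->
  devs n i (fun s => h (s, 0)) -> devs m j (fun s => h (s, 1)) ->
  weq (wdev U n i W) (wdev U m j W).
Proof.
move=> ch hUW CU CW n0 m0 Di Dj.
have [n1 Hn1] := @lebesgue_square (set B) set0 (fun u => [set p | C u /\ O u (h p)]) (fun p Dp =>
  let: ex_intro2 u Cu Ou := Ocover (h p) in
  let: ex_intro2 N nN NO := within_nbhs ch Dp (Oopen Cu) Ou in
  ex_intro _ u (ex_intro2 _ _ N nN (fun q Nq Dq => conj Cu (NO q Nq Dq)))).
(* A multiple of [n] and of [m], so that both given developments can be refined to it, and large
   enough for the grid. *)
pose M := (n * m * n1.+1)%N.
have M0 : (0 < M)%N by rewrite !muln_gt0 n0 m0.
have [|c Hc] := Hn1 M.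
  by rewrite /M (leq_trans (leqnSn n1)) // leq_pmull // muln_gt0 n0.
have HC k l (kM : (k < M)%N) (lM : (l < M)%N) (k' l' : nat) : (k' == k) || (k' == k.+1) ->
    (l' == l) || (l' == l.+1) -> C (c k l) /\ O (c k l) (h (k'%:R / M%:R, l'%:R / M%:R)).
  move=> hk hl; apply: Hc => //=.
  - split; apply: grid_II => //.
      by case/orP: hk => /eqP -> //; exact: ltnW.
    by case/orP: hl => /eqP -> //; exact: ltnW.
  - by rewrite gridE // !ler_nat; case/orP: hk => /eqP ->; rewrite leqnn leqnSn.
  - by rewrite gridE // !ler_nat; case/orP: hl => /eqP ->; rewrite leqnn leqnSn.
have row k l (l' : nat) : (k < M)%N -> (l < M)%N -> (l' == l) || (l' == l.+1) ->
    [/\ C (c k l), O (c k l) (h (k%:R / M%:R, l'%:R / M%:R)) &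
        O (c k l) (h (k.+1%:R / M%:R, l'%:R / M%:R))].
  move=> kM lM hl.
  have hk : (k == k) || (k == k.+1) by rewrite eqxx.
  have hk' : (k.+1 == k) || (k.+1 == k.+1) by rewrite eqxx orbT.
  have [Ck Ok] := HC k l kM lM k l' hk hl.
  by have [_ Ok'] := HC k l kM lM k.+1 l' hk' hl.
have MM : M%:R / M%:R = 1 :> RR by rewrite divff // pnatr_eq0 -lt0n.
have ends l' : (l' <= M)%N -> O U (h (0%:R / M%:R, l'%:R / M%:R)) /\
    O W (h (M%:R / M%:R, l'%:R / M%:R)).
  by move=> lM; rewrite mul0r MM; apply: hUW; exact: grid_II.
have rows l : (l < M)%N -> weq (wdev U M (c^~ 0%N) W) (wdev U M (c^~ l) W).
  elim: l => [|l IH] lM; first by constructor.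
  apply: weq_trans (IH (ltnW lM)) _.
  have [e0 e1] := ends l.+1 (ltnW lM).
  apply: (@wdev_points M U W _ _ (fun k => h (k%:R / M%:R, l.+1%:R / M%:R))) => // k kM.
    by apply: row => //; [exact: ltnW|rewrite eqxx orbT].
  by apply: row => //; rewrite eqxx.
have M1 : (M.-1 < M)%N by rewrite prednK.
have ME : M = (n * (m * n1.+1).-1.+1)%N by rewrite prednK ?muln_gt0 ?m0 // /M mulnA.
have ME' : M = (m * (n * n1.+1).-1.+1)%N.
  by rewrite prednK ?muln_gt0 ?n0 // /M mulnA (mulnC m).
apply: weq_trans (weq_sym (wdev_refine n i U W (m * n1.+1).-1)) _.
apply: weq_trans (wdev_refine m j U W (n * n1.+1).-1).
apply: weq_trans (weq_trans (rows _ M1) _).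
  have [e0 e1] := ends 0%N (leq0n _).
  have := devs_refine (M := (m * n1.+1).-1) Di.
  rewrite -ME => Di'.
  apply: (@wdev_points M U W _ _ (fun k => h (k%:R / M%:R, 0%:R / M%:R))) => // k kM.
    by rewrite mul0r; exact: (devs_points M0 Di').
  exact: row.
have [e0 e1] := ends M (leqnn _).
have := devs_refine (M := (n * n1.+1).-1) Dj.
rewrite -ME' => Dj'.
apply: (@wdev_points M U W _ _ (fun k => h (k%:R / M%:R, M%:R / M%:R))) => // k kM.
  by apply: row => //; rewrite prednK // eqxx orbT.
by rewrite MM; exact: (devs_points M0 Dj').
Qed.

(** The graph of the monodromy from paths to word classes: closed under [weq], total by
    [mono_exists], and by [mono_htpy] single-valued up to [weq] on homotopic paths. *)
Definition mono (a : RR -> X) (U W : set B) (w : seq (set B)) :=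
  exists n i, [/\ (0 < n)%N, devs n i a & weq w (wdev U n i W)].

Lemma mono_weq a U W w w' : weq w w' -> mono a U W w -> mono a U W w'.
Proof.
move=> ww' [n [i [n0 D H]]]; exists n, i; split=> //.
by apply: weq_trans H; exact: weq_sym.
Qed.

Lemma mono_htpy a b U W w w' : htpy a b -> C U -> C W -> O U (a 0) -> O W (a 1) ->
  mono a U W w -> mono b U W w' -> weq w w'.
Proof.
move=> [h [ch h1 h2]] CU CW Ua Wa [n [i [n0 Di Hi]]] [m [j [m0 Dj Hj]]].
apply: weq_trans Hi (weq_trans _ (weq_sym Hj)).
apply: (wdev_homotopy ch) => //.
- by move=> t It; have [-> ->] := h2 t It.
- by apply: devs_ext Di => t It; have [-> _] := h1 t It.
- by apply: devs_ext Dj => t It; have [_ ->] := h1 t It.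
Qed.

Lemma mono_unique a U W w w' : cpath a -> C U -> C W -> O U (a 0) -> O W (a 1) ->
  mono a U W w -> mono a U W w' -> weq w w'.
Proof. by move=> ca; apply: mono_htpy; exact: (pc_refl (htpy_path_congruence X)). Qed.

(** The path is viewed as a map of the square that ignores the second coordinate, and the bottom row
    of cells is read off. *)
Lemma devs_exist a : cpath a -> exists n i, (0 < n)%N /\ devs n i a.
Proof.
move=> ca.
have ca2 : {within sq, continuous (fun p : RR * RR => a p.1)}.
  by apply: (within_comp (A := II) _ ca); [move=> x []|wcont].
have [n1 Hn1] := @lebesgue_square (set B) set0 (fun u => [set p | C u /\ O u (a p.1)]) (fun p Dp =>
  let: ex_intro2 u Cu Ou := Ocover (a p.1) in
  let: ex_intro2 N nN NO := within_nbhs ca2 Dp (Oopen Cu) Ou in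
  ex_intro _ u (ex_intro2 _ _ N nN (fun q Nq Dq => conj Cu (NO q Nq Dq)))).
have [c Hc] := Hn1 n1.+1 (leqnSn n1).
exists n1.+1, (c^~ 0%N); split=> // k kn; split.
  have [] := Hc k 0%N kn isT (k%:R / n1.+1%:R, 0) => //=.
  - by split; [apply: grid_II => //; exact: ltnW|exact: II0].
  - by rewrite gridE // lexx ler_nat leqnSn.
  - by rewrite mulr0 lexx ler01.
move=> t It h.
have [] // := Hc k 0%N kn isT (t, 0) => //=.
- by split=> //; exact: II0.
- by rewrite mulr0 lexx ler01.
Qed.

Lemma mono_exists a U W : cpath a -> exists w, mono a U W w.
Proof.
by move=> /devs_exist [n [i [n0 D]]]; exists (wdev U n i W), n, i; split=> //; constructor.
Qed.

Lemma wdev_chain a U W n i : C U -> C W -> O U (a 0) -> O W (a 1) -> (0 < n)%N ->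
  devs n i a -> chain C U (rcons (mkseq i n) W).
Proof.
move=> CU CW Ua Wa n0 D.
have Ua' : O U (a (0%:R / n%:R)) by rewrite mul0r.
have Wa' : O W (a (n%:R / n%:R)) by rewrite divff // pnatr_eq0 -lt0n.
have := devs_points n0 D.
move: Ua' Wa'; set x := (fun k : nat => a (k%:R / n%:R)).
rewrite -[a (0%:R / _)]/(x 0%N) -[a (n%:R / _)]/(x n).
rewrite -/(forall k, (k < n)%N -> [/\ C (i k), O (i k) (x k) & O (i k) (x k.+1)]).
move: x; clear n0 D Ua Wa; elim: n i U CU => [|n IH] i U CU x Ux Wx Hi.
  split=> //; have [b Hb] := Opoint (x 0%N).
  by exists b; split; exact: Hb.
rewrite mkseq_cons rcons_cons /=; have [Ci i0 i1] := Hi 0%N isT.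
split=> //.
  by have [b Hb] := Opoint (x 0%N); exists b; split; exact: Hb.
exact: (IH (fun k => i k.+1) _ Ci (fun k => x k.+1) i1 Wx (fun k => Hi k.+1)).
Qed.

Lemma mono_chain a U W : cpath a -> C U -> C W -> O U (a 0) -> O W (a 1) ->
  exists w, [/\ mono a U W (U :: w), chain C U w & last U w = W].
Proof.
move=> /devs_exist [n [i [n0 D]]] CU CW Ua Wa.
exists (rcons (mkseq i n) W); split.
- by exists n, i; split=> //; constructor.
- exact: (wdev_chain CU CW Ua Wa n0 D).
- by rewrite last_rcons.
Qed.

Lemma weq_mono_head a U W w : mono a U W w -> weq (U :: w) w.
Proof.
move=> [n [i [_ _ H]]].
by apply: weq_trans (weq_cons _ H) (weq_trans _ (weq_sym H)); exact: weq_dup.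
Qed.

Lemma weq_mono_last a U W w : mono a U W w -> weq (w ++ [:: W]) w.
Proof.
move=> [n [i [_ _ H]]].
apply: weq_trans (weq_catr _ H) (weq_trans _ (weq_sym H)).
rewrite /wdev -cats1 /= -catA /= -cat_cons -(cat_cons U).
exact: weq_dup_in.
Qed.

Lemma mono_pcat a b U V W w w' : C V -> O V (a 1) -> a 1 = b 0 ->
  mono a U V w -> mono b V W w' -> mono (pcat a b) U W (w ++ w').
Proof.
move=> CV Va ab [n [i [n0 Di Hi]]] [m [j [m0 Dj Hj]]].
(* Each half gets the common number [M] of pieces, so that the concatenation is cut into [M + M]
   pieces of equal length. *)
pose M := (n * m)%N.
have M0 : (0 < M)%N by rewrite muln_gt0 n0 m0.
have ME : M = (n * m.-1.+1)%N by rewrite prednK.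
have ME' : M = (m * n.-1.+1)%N by rewrite prednK // mulnC.
have := devs_refine (M := m.-1) Di; rewrite -ME; set i' := (fun k => i _) => Di'.
have := devs_refine (M := n.-1) Dj; rewrite -ME'; set j' := (fun k => j _) => Dj'.
exists (M + M)%N, (fun k => if (k < M)%N then i' k else j' (k - M)%N); split.
- by rewrite addn_gt0 M0.
- move=> k kM; have [k1|k1] := ltnP k M.
    have [Ck Hk] := Di' k k1; split=> // t /IIP [t0 t1] /andP [h1 h2].
    rewrite natrD in h1 h2.
    have M0' : 0 < M%:R :> RR by rewrite ltr0n.
    have k1' : k.+1%:R <= M%:R :> RR by rewrite ler_nat.
    have t2 : t <= 2^-1 by rewrite -(ler_pM2l M0'); lra.
    rewrite /pcat t2; apply: Hk; first by apply/IIP; split; lra.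
    by apply/andP; split; lra.
  have k2 : (k - M < M)%N by rewrite ltn_subLR.
  have [Ck Hk] := Dj' _ k2; split=> // t /IIP [t0 t1] /andP [h1 h2].
  rewrite natrD in h1 h2.
  have M0' : 0 < M%:R :> RR by rewrite ltr0n.
  have k1' : M%:R <= k%:R :> RR by rewrite ler_nat.
  have t2 : 2^-1 <= t by rewrite -(ler_pM2l M0'); lra.
  have e1 : (k - M)%:R = k%:R - M%:R :> RR by rewrite natrB.
  have e2 : (k - M).+1%:R = k%:R - M%:R + 1 :> RR by rewrite -natr1 e1.
  have e3 : k.+1%:R = k%:R + 1 :> RR by rewrite -natr1.
  (* At the midpoint [pcat] takes its value from [a]; there [a 1 = b 0] is needed. *)
  have -> : pcat a b t = b (2 * t - 1).
    rewrite /pcat; case: ifPn => // t3.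
    have -> : t = 2^-1 by apply/le_anti; rewrite t2 t3.
    by rewrite mulfV ?pnatr_eq0 // subrr ab.
  apply: Hk; first by apply/IIP; split; lra.
  by rewrite e1 e2; apply/andP; split; lra.
- apply: weq_trans (weq_cat Hi Hj) _.
  apply: weq_trans (weq_cat (weq_sym (wdev_refine n i U V m.-1))
    (weq_sym (wdev_refine m j V W n.-1))) _.
  rewrite -ME -ME' -/i' -/j' /wdev mkseq_cat rcons_cat.
  have [p pM] : exists p, M = p.+1 by exists M.-1; rewrite prednK.
  have [_ _ ip] := devs_points M0 Di' (k := p) (etrans (congr1 (leq p.+1) pM) (leqnn _)).
  have [Cj j0 _] := devs_points M0 Dj' M0.
  have [Ci _ _] := devs_points M0 Di' (k := p) (etrans (congr1 (leq p.+1) pM) (leqnn _)).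
  have e1 : p.+1%:R / M%:R = 1 :> RR by rewrite -pM divff // pnatr_eq0 -lt0n.
  rewrite e1 in ip; rewrite mul0r -ab in j0.
  rewrite pM mkseqS mkseq_cons -!cats1 /= -!catA /= -!(cat_cons U).
  (* At the junction the word reads [i' p, V, V, j' 0]. The two [V] are merged and then dropped,
     since all three letters contain the point [a 1]. *)
  apply: weq_trans (weq_catl _ (weq_catl [:: _] (weq_dup _ _ _))) _.
  by apply: weq_catl; exact: (weq_pt _ (p := a 1)).
Qed.

Lemma mono_in a U : cpath a -> C U -> (forall t, II t -> O U (a t)) -> mono a U U [:: U].
Proof.
move=> ca CU Ua; exists 1%N, (fun=> U); split=> //.
  by move=> k _; split=> // t It _; exact: Ua.
apply: weq_sym; apply: weq_trans (weq_dup _ _ _) _; exact: weq_dup.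
Qed.

(** The letter of the last piece, [W] and [W'] share the point [a 1], so [W] may be dropped once
    [W'] is appended. *)
Lemma mono_move a U W W' w : C W -> C W' -> O W (a 1) -> O W' (a 1) ->
  mono a U W w -> mono a U W' (w ++ [:: W']).
Proof.
move=> CW CW' Wa Wa' [n [i [n0 D H]]]; exists n, i; split=> //.
apply: weq_trans (weq_catr _ H) _.
have [p pM] : exists p, n = p.+1 by exists n.-1; rewrite prednK.
subst n; have [Ci _ ip] := devs_points n0 D (ltnSn p).
rewrite divff ?pnatr_eq0 // in ip.
rewrite /wdev mkseqS -!cats1 /= -!catA /= -!(cat_cons U).
by apply: weq_catl; exact: (weq_pt _ (p := a 1)).
Qed.

Hypothesis Opc : forall u x y, C u -> O u x -> O u y ->
  exists a, [/\ cpath a, a 0 = x, a 1 = y & forall t, II t -> O u (a t)].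
Hypothesis Omeet : forall u v, C u -> C v -> (exists b, u b /\ v b) -> exists x, O u x /\ O v x.

(** Points are chosen where consecutive letters meet and are joined inside the letters; thus every
    edge path of the nerve is the word of some path. *)
Lemma mono_realize U w x y : C U -> O U x -> chain C U w -> O (last U w) y ->
  exists a, [/\ cpath a, a 0 = x, a 1 = y & mono a U (last U w) (U :: w)].
Proof.
elim: w U x => [|V w IH] U x CU Ux /=.
  move=> _ Uy; have [a [ca a0 a1 aU]] := Opc CU Ux Uy.
  by exists a; split=> //; exact: mono_in.
move=> [CV UV ch] Wy; have [z [Uz Vz]] := Omeet CU CV UV.
have [a [ca a0 a1 aU]] := Opc CU Ux Uz.
have [b [cb b0 b1 Hb]] := IH V z CV Vz ch Wy.
exists (pcat a b); split.
- by apply: cpath_pcat => //; rewrite a1.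
- by rewrite pcat0.
- by rewrite pcat1.
- apply: (mono_weq (w := [:: U; V] ++ V :: w)).
    by apply: weq_cons; exact: weq_dup.
  apply: (mono_pcat (V := V) (w := [:: U; V]) (w' := V :: w)) => //; rewrite ?a1 //.
  by apply: (mono_move (w := [:: U])) (mono_in ca CU aU) => //; rewrite a1.
Qed.
End Developments.

(** * Hedgehogs and path lifting *)

Section Hedgehogs.
Variable H : hedgehog.

Lemma hproj_mem (s : hS H) p : disk p -> hmem (hproj s p).
Proof. by move=> Dp; rewrite /hproj; case: eqP. Qed.

Lemma hproj_base (s : hS H) : hproj s (hz s) = None.
Proof. by rewrite /hproj eqxx. Qed.

Lemma hproj_id (s : hS H) p : hmem (Some (s, p)) -> hproj s p = Some (s, p).
Proof. by case=> _ /eqP /negbTE h; rewrite /hproj h. Qed.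

Lemma hpt_hproj (x : hpt H) : hmem x -> x = None \/ exists s p, disk p /\ x = hproj s p.
Proof.
case: x => [[s p]|]; last by left.
by move=> h; right; exists s, p; rewrite hproj_id //; case: h.
Qed.

Variable T : topologicalType.
Implicit Type f : hpt H -> T.

Lemma hcontinuous_disk f (s : hS H) : hcontinuous f ->
  {within disk, continuous (fun p => f (hproj s p))}.
Proof.
move=> cf; apply: nbhs_within => p O Dp oO Of.
have [/(_ s) h _] := cf O oO.
have [|N nN HN] := rel_open_nbhs h (x := p) _ Dp.
  by split=> //; split=> //; exact: hproj_mem.
by exists N => // y Ny Dy; have [_ []] := HN y Ny Dy.
Qed.

Lemma hcontinuous_tail f O : hcontinuous f -> open O -> O (f None) ->
  exists t, forall s, hlt t s -> forall p, disk p -> O (f (hproj s p)).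
Proof.
move=> cf oO Of; have [_ /(_ (conj I Of)) [t Ht]] := cf O oO.
by exists t => s ts p Dp; have [] := Ht s ts p Dp.
Qed.

Lemma hcontinuousI f :
  (forall s, {within disk, continuous (fun p => f (hproj s p))}) ->
  (forall O, open O -> O (f None) ->
    exists t, forall s, hlt t s -> forall p, disk p -> O (f (hproj s p))) ->
  hcontinuous f.
Proof.
move=> cf tf O oO; split=> [s|[_ /(tf O oO) [t Ht]]].
  apply: rel_openNP => p [_ [_ Of]] Dp.
  have [N nN NO] := within_nbhs (cf s) Dp oO Of.
  by exists N => // y Ny Dy; split=> //; split; [exact: hproj_mem|exact: NO].
by exists t => s ts p Dp; split; [exact: hproj_mem|exact: Ht].
Qed.

Lemma hcontinuous_comp (U : topologicalType) f (g : T -> U) :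
  continuous g -> hcontinuous f -> hcontinuous (fun x => g (f x)).
Proof.
by move=> /continuousP cg cf O oO; exact: (cf (g @^-1` O) (cg O oO)).
Qed.
End Hedgehogs.

Lemma disk0 : disk (0, 0).
Proof. by rewrite /disk /= expr0n /= addr0 ler01. Qed.

(** A single disk. With one index nothing is strictly above anything, so the tail condition at the
    wedge point asks nothing. *)
Definition hdisk : hedgehog := @Hedgehog unit (fun _ _ => True) (fun _ => I)
  (fun _ _ _ _ _ => I) (fun _ _ => ex_intro _ tt (conj I I)) (fun _ => (0, 0)) (fun _ => disk0).

Definition hfun (T : Type) (F : RR * RR -> T) (x : hpt hdisk) : T :=
  if x is Some (_, p) then F p else F (0, 0).

Lemma hfun_hproj (T : Type) (F : RR * RR -> T) s p : hfun F (hproj s p) = F p.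
Proof. by rewrite /hproj; case: eqP => // ->. Qed.

Lemma hcontinuous_hfun (T : topologicalType) (F : RR * RR -> T) :
  {within disk, continuous F} -> hcontinuous (hfun F).
Proof.
move=> cF; apply: hcontinuousI => [s|O oO _]; last by exists tt => s [_ []].
by apply: (within_ext _ cF) => p _; rewrite hfun_hproj.
Qed.

(** A retraction of the disk onto its radius on the positive first axis. Composed with it a path
    becomes a map of the disk, and this is how hedgehog coverings lift paths. *)
Definition ret (p : RR * RR) : RR := Num.max 0 p.1.

Lemma ret_II p : disk p -> II (ret p).
Proof.
rewrite /disk /= /ret => h; apply/IIP; split; first by rewrite le_max lexx.
rewrite ge_max ler01 /=; have := sqr_ge0 p.2; rewrite leNgt => h2; apply/negP => h1.
move: h h2; rewrite !expr2; nra.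
Qed.

Lemma ret_path t : II t -> disk (t, 0) /\ ret (t, 0) = t.
Proof.
move=> /IIP [t0 t1]; split; last by rewrite /ret /= max_r.
by rewrite /disk /= !expr2; nra.
Qed.

Lemma within_ret (T : topologicalType) (a : RR -> T) : cpath a ->
  {within disk, continuous (fun p => a (ret p))}.
Proof. by move=> ca; apply: (within_comp (@ret_II) ca); rewrite /ret; wcont. Qed.

Section Lifting.
Variables (E Y : topologicalType) (q : E -> Y).
Hypothesis dq : dh_covering q.

Lemma dh_cont : continuous q. Proof. by case: dq. Qed.

Lemma hlift_unique (H : hedgehog) (g g' : hpt H -> E) x0 :
  hcontinuous g -> hcontinuous g' -> hmem x0 -> g x0 = g' x0 ->
  (forall x, hmem x -> q (g x) = q (g' x)) -> forall x, hmem x -> g x = g' x.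
Proof.
move=> cg cg' m0 e0 qe x mx.
have [k [_ _ _ Hk]] := dq.2 (g x0) H x0 (fun x => q (g x)) m0
  (hcontinuous_comp dh_cont cg) erefl.
rewrite (Hk g) // (Hk g') // => y my; exact/esym/qe.
Qed.

Lemma path_lift a e : cpath a -> q e = a 0 -> exists l, is_lift q a l /\ l 0 = e.
Proof.
move=> ca qe.
have [g [cg qg g0 _]] := dq.2 e hdisk None (hfun (fun p => a (ret p))) I
  (hcontinuous_hfun (within_ret ca)) (etrans (congr1 a (joinxx 0)) (esym qe)).
have [d0 r0] := ret_path II0.
exists (fun t => g (hproj (tt : hS hdisk) (t, 0))); split; last by rewrite hproj_base.
split.
  apply: (within_comp (A := disk) (f := fun t => (t, 0)) _ (@hcontinuous_disk hdisk _ _ tt cg)); last by wcont.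
  by move=> t /ret_path [].
move=> t It; have [dt rt] := ret_path It.
by rewrite qg ?hfun_hproj ?rt //; exact: hproj_mem.
Qed.

Lemma path_lift_unique a l l' : is_lift q a l -> is_lift q a l' -> l 0 = l' 0 ->
  forall t, II t -> l t = l' t.
Proof.
move=> [cl ql] [cl' ql'] e0 t It.
have [dt rt] := ret_path It; have [d0 r0] := ret_path II0.
have := @hlift_unique hdisk (hfun (fun p => l (ret p))) (hfun (fun p => l' (ret p)))
  None (hcontinuous_hfun (within_ret cl)) (hcontinuous_hfun (within_ret cl')) I.
rewrite /= r0 => /(_ e0) h.
have := h _ (hproj (tt : hS hdisk) (t, 0)) (@hproj_mem hdisk tt _ dt); rewrite !hfun_hproj rt; apply.
by move=> [[s p]|] /= => [[dp _]|_]; rewrite ?ql ?ql' ?r0 //; (exact: ret_II || exact: II0).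
Qed.
End Lifting.

(** * Transport of sheets along words *)

Section Sheets.
Variables (B : Type) (C : set (set B)) (E : Type) (dom : set B -> set E)
  (Sh : set B -> E -> E -> Prop).
Hypothesis Sh_dom : forall u e e', Sh u e e' -> dom u e.
Hypothesis Sh_refl : forall u e, C u -> dom u e -> Sh u e e.
Hypothesis Sh_sym : forall u e e', Sh u e e' -> Sh u e' e.
Hypothesis Sh_trans : forall u e e' e'', Sh u e e' -> Sh u e' e'' -> Sh u e e''.
Hypothesis Sh_change : forall u v e e', C u -> C v -> Sh u e e' -> dom v e -> dom v e' ->
  Sh v e e'.
Hypothesis Sh_move : forall u v x e b, C u -> C v -> C x -> u b -> v b -> x b -> dom u e ->
  exists e', [/\ Sh u e e', dom v e' & dom x e'].

(** [Sh u e e'] reads: [e] and [e'] lie on one sheet over [u]. Since every letter allows motion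
    within its sheet, transport is a relation, single-valued only up to the sheet over the last
    letter. *)
Fixpoint transport (w : seq (set B)) (e e' : E) : Prop :=
  if w is u :: w' then exists2 e1, Sh u e e1 & transport w' e1 e' else e = e'.

Lemma transport_cat w w' e e' :
  transport (w ++ w') e e' <-> exists2 e1, transport w e e1 & transport w' e1 e'.
Proof.
elim: w e => [|u w IH] e /=; first by split=> [h|[e1 ->]]; [exists e|].
split=> [[e1 h /IH [e2 h1 h2]]|[e1 [e2 h h1] h2]].
  by exists e2 => //; exists e1.
by exists e2 => //; apply/IH; exists e1.
Qed.

Lemma transport_weq w w' : weq C w w' -> forall e e', transport w e e' <-> transport w' e e'.
Proof.
elim=> {w w'}.
- by [].
- by move=> w w' _ IH e e'; split => /IH.
- by move=> w w' w'' _ IH1 _ IH2 e e'; split=> [/IH1 /IH2|/IH2 /IH1].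
- move=> w1 u w2 e e'; split=> /transport_cat [e1 h1 h2]; apply/transport_cat; exists e1 => //.
    by case: h2 => e2 h2 [e3 h3 h4]; exists e3 => //; exact: Sh_trans h3.
  by case: h2 => e2 h2 h4; exists e2 => //; exists e2 => //; exact: Sh_trans (Sh_sym h2) h2.
- move=> w1 u v x w2 b Cu Cv Cx ub vb xb e e'.
  split=> /transport_cat [e1 h1 h2]; apply/transport_cat; exists e1 => //.
    case: h2 => e2 h2 [e3 h3 [e4 h4 h5]].
    (* [eb] lies over all three letters, on the [u]-sheet of [e2]. By [Sh_change] it is on the
       [v]-sheet of [e3], and then on the [x]-sheet of [e4], which bypasses [v]. *)
    have [eb [sb vd xd]] := Sh_move Cu Cv Cx ub vb xb (Sh_dom (Sh_sym h2)).
    exists eb; first exact: Sh_trans sb.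
    exists e4 => //; apply: (Sh_trans _ h4).
    apply: (Sh_change Cv Cx) => //; last by exact: Sh_dom (h4).
    apply: (Sh_trans _ h3); apply: Sh_sym; apply: (Sh_change Cu Cv) => //; exact: Sh_dom h3.
  case: h2 => e2 h2 [e3 h3 h4].
  have [eb [sb vd xd]] := Sh_move Cu Cv Cx ub vb xb (Sh_dom (Sh_sym h2)).
  exists eb; first exact: Sh_trans sb.
  exists eb; first exact: Sh_refl.
  exists e3 => //; apply: (Sh_trans _ h3); apply: Sh_sym.
  by apply: (Sh_change Cu Cx) => //; exact: Sh_dom h3.
Qed.

Lemma transport_functional w u e e' f f' : C u -> chain C u w -> Sh u e e' ->
  transport (u :: w) e f -> transport (u :: w) e' f' -> Sh (last u w) f f'.
Proof.
elim: w u e e' => [|v w IH] u e e' Cu /=.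
  move=> _ h [e1 h1 <-] [e2 h2 <-].
  exact: Sh_trans (Sh_sym h1) (Sh_trans h h2).
move=> [Cv _ ch] h [e1 h1 [e2 h2 h3]] [e1' h1' [e2' h2' h3']].
apply: (IH v e1 e1' Cv ch).
- apply: (Sh_change Cu Cv); [|exact: Sh_dom h2|exact: Sh_dom h2'].
  exact: Sh_trans (Sh_sym h1) (Sh_trans h h1').
- by exists e2.
- by exists e2'.
Qed.

Lemma transport_mkseq n (i : nat -> set B) (e : nat -> E) :
  (forall k, (k < n)%N -> Sh (i k) (e k) (e k.+1)) -> transport (mkseq i n) (e 0%N) (e n).
Proof.
elim: n => [|n IH] h //.
rewrite mkseqS -cats1; apply/transport_cat; exists (e n).
  by apply: IH => k kn; apply: h; exact: ltnW.
by exists (e n.+1) => //; exact: h.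
Qed.

Lemma transport_wdev n U W (i : nat -> set B) (e : nat -> E) :
  Sh U (e 0%N) (e 0%N) -> Sh W (e n) (e n) ->
  (forall k, (k < n)%N -> Sh (i k) (e k) (e k.+1)) -> transport (wdev U n i W) (e 0%N) (e n).
Proof.
move=> hU hW h; exists (e 0%N) => //.
rewrite -cats1; apply/transport_cat; exists (e n); first exact: transport_mkseq.
by exists (e n).
Qed.
End Sheets.

(** * Path spaces with the hedgehog topology *)

Section HOpen.
Variable H : hedgehog.

Lemma hlt_le_trans (r t s : hS H) : hle r t -> hlt t s -> hlt r s.
Proof.
move=> rt [ts nst]; split; first exact: (hle_trans rt ts).
by move=> sr; apply: nst; exact: (hle_trans sr rt).
Qed.

(** This is where directedness of the index set enters: the tails required by [P] and [Q] at the
    wedge point contain a common tail. *)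
Lemma hopenI (P Q : set (hpt H)) : hopen P -> hopen Q -> hopen (P `&` Q).
Proof.
move=> [oP tP] [oQ tQ]; split=> [s|[/tP [t Ht] /tQ [r Hr]]].
  apply: rel_openNP => p [_ [Pp Qp]] Dp.
  have [N nN NP] := rel_open_nbhs (oP s) (conj Dp Pp) Dp.
  have [M nM MQ] := rel_open_nbhs (oQ s) (conj Dp Qp) Dp.
  exists (N `&` M); first exact: filterI.
  by move=> y [Ny My] Dy; split=> //; split; [exact: (NP y Ny Dy).2|exact: (MQ y My Dy).2].
have [m [tm rm]] := hle_directed t r.
exists m => s ms p Dp; split; first by apply: Ht => //; exact: hlt_le_trans ms.
by apply: Hr => //; exact: hlt_le_trans ms.
Qed.

Lemma hopen_bigcup (I : Type) (P : I -> set (hpt H)) :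
  (forall i, hopen (P i)) -> hopen (\bigcup_i P i).
Proof.
move=> oP; split=> [s|[i _ Pi]].
  apply: rel_openNP => p [_ [i _ Pp]] Dp.
  have [N nN NP] := rel_open_nbhs ((oP i).1 s) (conj Dp Pp) Dp.
  by exists N => // y Ny Dy; split=> //; exists i => //; exact: (NP y Ny Dy).2.
have [t Ht] := (oP i).2 Pi; exists t => s ts p Dp; exists i => //; exact: Ht.
Qed.

(* Balls of the sup norm meet the disk in convex sets, so a set that spreads along
   those segments which stay in an open set [O] is open. *)
Lemma hopen_segments (T : topologicalType) (f : hpt H -> T) (O : set T) (W : set (hpt H)) :
  hcontinuous f -> open O -> (forall x, hmem x -> W x -> O (f x)) ->
  (forall s p y, disk p -> disk y -> (forall t, II t -> O (f (hproj s (lerp p y t)))) ->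
     W (hproj s p) -> W (hproj s y)) ->
  hopen [set x | hmem x /\ W x].
Proof.
move=> cf oO WO HW; split=> [s|[_ W0]].
  apply: rel_openNP => p [_ [mp Wp]] Dp.
  have [N nN NO] := within_nbhs (@hcontinuous_disk _ _ _ s cf) Dp oO (WO _ mp Wp).
  have /nbhs_ballP [e /= e0 eN] := nN.
  exists (ball p e); first exact: nbhsx_ballx.
  move=> y [b1 b2] Dy; split=> //; split; first exact: hproj_mem.
  apply: (HW s p) => // t It; apply: NO; last exact: convex2_disk.
  apply: eN; move: b1 b2 It; rewrite /ball /= => b1 b2 /IIP [t0 t1].
  have conv (a b : RR) : `|a - b| < e -> `|a - ((1 - t) * a + t * b)| < e.
    move=> ab; rewrite (_ : _ - _ = t * (a - b)); last by lra.
    rewrite normrM ger0_norm //; apply: le_lt_trans ab.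
    by rewrite ler_piMl // normr_ge0.
  by split; exact: conv.
have [t Ht] := hcontinuous_tail cf oO (WO None I W0).
exists t => s ts p Dp; split; first exact: hproj_mem.
apply: (HW s (hz s)) => //; first exact: hz_disk.
  by move=> r Ir; apply: Ht => //; apply: convex2_disk => //; exact: hz_disk.
by rewrite hproj_base.
Qed.

Definition hline (T : Type) (f : hpt H -> T) (x : hpt H) : RR -> T :=
  if x is Some (s, p) then fun t => f (hproj s (lerp (hz s) p t)) else fun=> f None.

Lemma hline_hproj (T : Type) (f : hpt H -> T) s p :
  hline f (hproj s p) = fun t => f (hproj s (lerp (hz s) p t)).
Proof.
rewrite /hproj; case: eqP => [->|_] //=.
by apply/funext => t; rewrite lerp_same eqxx.
Qed.

Lemma hline0 (T : Type) (f : hpt H -> T) x : hline f x 0 = f None.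
Proof. by case: x => [[s p]|] //=; rewrite lerp0 hproj_base. Qed.

Lemma hline1 (T : Type) (f : hpt H -> T) x : hmem x -> hline f x 1 = f x.
Proof.
move=> /hpt_hproj [->|[s [p [Dp ->]]]] //.
by rewrite hline_hproj lerp1.
Qed.

Lemma hsegment (T : topologicalType) (f : hpt H -> T) s p y :
  hcontinuous f -> disk p -> disk y -> cpath (fun t => f (hproj s (lerp p y t))).
Proof.
move=> cf Dp Dy.
apply: (within_comp (A := disk) _ (@hcontinuous_disk _ _ _ s cf)).
  by move=> t It; exact: convex2_disk.
exact: continuous_lerp.
Qed.

Lemma cpath_hline (T : topologicalType) (f : hpt H -> T) x :
  hcontinuous f -> hmem x -> cpath (hline f x).
Proof.
move=> cf /hpt_hproj [->|[s [p [Dp ->]]]]; first exact: within_cst.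
by rewrite hline_hproj; apply: hsegment => //; exact: hz_disk.
Qed.
End HOpen.

(** A class is stored as the set of its members. As [R] takes values in [Prop], the space is a
    subtype of [set (RR -> B)] even if [R] quantifies over all coverings, so it can itself serve as
    a covering space. *)
Definition pathspace (B : topologicalType) (R : (RR -> B) -> (RR -> B) -> Prop) (b0 : B) : Type :=
  {c : set (RR -> B) | exists a, [/\ cpath a, a 0 = b0 & c = R a]}.

Section PathSpaceTopology.
Variables (B : topologicalType) (R : (RR -> B) -> (RR -> B) -> Prop) (b0 : B).
Local Notation PS := (pathspace R b0).

Definition canonical_lift (H : hedgehog) (f : hpt H -> B) (g : hpt H -> PS) :=
  exists a, [/\ cpath a, a 0 = b0, a 1 = f None &
    forall x, hmem x -> sval (g x) = R (pcat a (hline f x))].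

(** The finest topology that makes all canonical lifts of hedgehog maps continuous. *)
Definition pathspace_open (O : set PS) : Prop :=
  forall (H : hedgehog) (f : hpt H -> B) (g : hpt H -> PS),
    hcontinuous f -> canonical_lift f g -> hopen [set x | hmem x /\ O (g x)].

Lemma pathspace_openT : pathspace_open setT.
Proof. by move=> H f g cf _; exact: (cf _ openT). Qed.

Lemma pathspace_openI : setI_closed pathspace_open.
Proof.
move=> O P oO oP H f g cf fg.
have := hopenI (oO H f g cf fg) (oP H f g cf fg); congr hopen.
by apply/seteqP; split=> x /= => [[[? ?] [? ?]]|[? [? ?]]].
Qed.

Lemma pathspace_open_bigU (I : Type) (O : I -> set PS) :
  (forall i, pathspace_open (O i)) -> pathspace_open (\bigcup_i O i).
Proof.
move=> oO H f g cf fg.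
have := hopen_bigcup (fun i => oO i H f g cf fg); congr hopen.
by apply/seteqP; split=> x /= => [[i _ [? ?]]|[? [i _ ?]]]; [split=> //; exists i|exists i].
Qed.

HB.instance Definition _ := gen_eqMixin PS.
HB.instance Definition _ := gen_choiceMixin PS.
HB.instance Definition _ :=
  isOpenTopological.Build PS pathspace_openT pathspace_openI pathspace_open_bigU.
End PathSpaceTopology.

(** * Lifting properties of path spaces *)

Section PathSpace.
Variables (B : topologicalType) (R : (RR -> B) -> (RR -> B) -> Prop) (b0 : B).
Hypothesis RC : path_congruence R.
Local Notation PS := (pathspace R b0).

Lemma canonical_lift_hcontinuous (H : hedgehog) (f : hpt H -> B) (g : hpt H -> PS) :
  hcontinuous f -> canonical_lift f g -> hcontinuous g.
Proof. by move=> cf fg O oO; exact: (oO H f g cf fg). Qed.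

Lemma pathspace_openP (O : set PS) : open O <-> pathspace_open O.
Proof. by []. Qed.

Definition psrepr (e : PS) : RR -> B := sval (cid (svalP e)).
Definition psend (e : PS) : B := psrepr e 1.

Lemma psreprP e : [/\ cpath (psrepr e), psrepr e 0 = b0 & sval e = R (psrepr e)].
Proof. by rewrite /psrepr; case: cid. Qed.

Lemma class_eq a a' : R a a' -> R a = R a'.
Proof.
move=> aa'; apply/funext => b; apply/propext; split=> h.
  exact: (pc_trans RC (pc_sym RC aa') h).
exact: (pc_trans RC aa' h).
Qed.

Lemma class_inj a a' : cpath a' -> R a = R a' -> R a a'.
Proof. by move=> ca ->; exact: pc_refl. Qed.

Lemma ps_inj (e e' : PS) : sval e = sval e' -> e = e'.
Proof. by case: e e' => [c Hc] [c' Hc'] /= e; subst c'; congr exist; exact: Prop_irrelevance. Qed.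

Lemma psrepr_R e a : cpath a -> sval e = R a -> R (psrepr e) a.
Proof. by have [ca' _ ->] := psreprP e => ca; exact: class_inj. Qed.

Lemma psendE e a : cpath a -> sval e = R a -> psend e = a 1.
Proof. by move=> ca ea; exact: (pc_end1 RC (psrepr_R ca ea)). Qed.

Lemma pathspace_point a : cpath a -> a 0 = b0 -> exists e : PS, sval e = R a.
Proof.
move=> ca a0; have h : exists a', [/\ cpath a', a' 0 = b0 & R a = R a'] by exists a.
by exists (exist _ (R a) h).
Qed.

Lemma canonical_lift_end (H : hedgehog) (f : hpt H -> B) (g : hpt H -> PS) x :
  hcontinuous f -> canonical_lift f g -> hmem x -> psend (g x) = f x.
Proof.
move=> cf [a [ca a0 a1 ag]] mx.
rewrite (psendE _ (ag x mx)) ?pcat1 ?hline1 //.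
by apply: cpath_pcat => //; [exact: cpath_hline|rewrite hline0].
Qed.

Lemma continuous_psend : continuous psend.
Proof.
apply/continuousP => O oO; apply/pathspace_openP => H f g cf fg.
have := cf O oO; congr hopen; apply/seteqP.
by split=> x /= [mx]; rewrite (canonical_lift_end cf fg mx).
Qed.

Lemma canonical_lift_exists (H : hedgehog) (f : hpt H -> B) a :
  hcontinuous f -> cpath a -> a 0 = b0 -> a 1 = f None ->
  exists g : hpt H -> PS, canonical_lift f g /\
    forall x, hmem x -> sval (g x) = R (pcat a (hline f x)).
Proof.
move=> cf ca a0 a1.
have [e0 He0] := pathspace_point ca a0.
have /choice [g Hg] : forall x : hpt H, exists e : PS, hmem x -> sval e = R (pcat a (hline f x)).
  move=> x; have [mx|nmx] := pselect (hmem x); last by exists e0.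
  have [||e He] := @pathspace_point (pcat a (hline f x)).
  - by apply: cpath_pcat => //; [exact: cpath_hline|rewrite hline0].
  - by rewrite pcat0.
  by exists e.
by exists g; split=> //; exists a.
Qed.

Lemma pathspace_dh_covering :
  (forall (H : hedgehog) (g g' : hpt H -> PS) x0, hcontinuous g -> hcontinuous g' ->
     hmem x0 -> g x0 = g' x0 -> (forall x, hmem x -> psend (g x) = psend (g' x)) ->
     forall x, hmem x -> g x = g' x) ->
  dh_covering psend.
Proof.
move=> uniq; split; first exact: continuous_psend.
move=> e0 H x0 f m0 cf fx0.
have [ca a0 ea] := psreprP e0.
pose l := hline f x0; pose a := psrepr e0.
have cl : cpath l by exact: cpath_hline.
have al : a 1 = prev l 0 by rewrite prev0 /l hline1.
have cal : cpath (pcat a (prev l)) by apply: cpath_pcat => //; exact: cpath_prev.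
(* The starting path goes back from the end of [a] along the segment to the wedge point; the
   canonical lift travels out again along it to [x0], so by cancellation its value there is [e0]. *)
have [||||g [fg Hg]] := @canonical_lift_exists H f (pcat a (prev l)) => //.
- by rewrite pcat0.
- by rewrite pcat1 prev1 /l hline0.
have cg := canonical_lift_hcontinuous cf fg.
have gx0 : g x0 = e0.
  apply: ps_inj; rewrite Hg // ea -/a -/l; apply: class_eq.
  apply: (pc_trans RC); first apply: (pc_assoc RC) => //.
  - exact: cpath_prev.
  - by rewrite prev1.
  apply: (pc_trans RC (b := pcat a (fun=> a 1))); last exact: (pc_pcat_cst RC).
  apply: (pc_pcat RC); first exact: (pc_refl RC).
    by rewrite al prev0; exact: (pc_prev_pcat RC).
  by rewrite pcat0.
exists g; split=> //.
- by move=> x mx; exact: canonical_lift_end.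
- move=> g' cg' qg' g'x0 x mx.
  apply: (uniq H g' g x0) => //; first by rewrite g'x0.
  by move=> y my; rewrite qg' // (canonical_lift_end cf fg).
Qed.

(** The lift at time [t] is the class of the part of [a] before [t]: on the disk carrying
    [a \o ret], the segment from the centre to the point at distance [t] on the radius is exactly
    this part. *)
Lemma pathspace_path_lift a : cpath a -> a 0 = b0 -> exists l : RR -> PS,
  is_lift psend a l /\ forall t, II t -> sval (l t) = R (fun s => a (t * s)).
Proof.
move=> ca a0; pose f := hfun (fun p => a (ret p)).
have cf : hcontinuous f by apply: hcontinuous_hfun; exact: within_ret.
have [||||g [fg Hg]] := @canonical_lift_exists hdisk f (fun=> b0) => //.
- exact: within_cst.
- by rewrite /f /= (ret_path II0).2 a0.
have cg := canonical_lift_hcontinuous cf fg.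
have mt t : II t -> hmem (hproj (tt : hS hdisk) (t, 0)).
  by move=> /ret_path [dt _]; exact: hproj_mem.
exists (fun t => g (hproj (tt : hS hdisk) (t, 0))); split; first split.
- apply: (within_comp (A := disk) (f := fun t => (t, 0)) _ (@hcontinuous_disk hdisk _ _ tt cg)).
    by move=> t /ret_path [].
  by wcont.
- move=> t It; rewrite (canonical_lift_end cf fg (mt t It)).
  by rewrite /f hfun_hproj (ret_path It).2.
- move=> t It; rewrite (Hg _ (mt t It)); apply: class_eq.
  rewrite hline_hproj.
  have cat : cpath (fun s => a (t * s)) by exact: cpath_scale.
  apply: (pc_trans RC (b := pcat (fun=> a (t * 0)) (fun s => a (t * s)))); last first.
    exact: (pc_cst_pcat RC cat).
  apply: (pc_ext RC).
    apply: cpath_pcat; [exact: within_cst| |by rewrite lerp0 /f hfun_hproj (ret_path II0).2 a0].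
    by apply: hsegment => //; [exact: disk0|exact: (ret_path It).1].
  move=> s /IIP [s0 s1]; rewrite /pcat mulr0 a0; case: ifPn => // hs.
  rewrite /f hfun_hproj /ret /lerp /= mulr0 add0r mulrC max_r //.
  rewrite -ltNge in hs; have /IIP [t0 t1] := It; apply: mulr_ge0 => //; lra.
Qed.

Lemma pathspace_connected : connected [set: PS].
Proof.
have [e0 He0] := @pathspace_point (fun=> b0) (@within_cst _ _ II b0) erefl.
have path_to e : exists l : RR -> PS, [/\ cpath l, l 0 = e0 & l 1 = e].
  have [ca a0 ea] := psreprP e.
  have [l [[cl _] Hl]] := pathspace_path_lift ca a0.
  exists l; split=> //; apply: ps_inj.
    rewrite Hl; last exact: II0.
    rewrite He0; congr R; apply/funext => s; by rewrite mul0r a0.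
  by rewrite Hl ?ea; [congr R; apply/funext => s; rewrite mul1r|exact: II1].
have /choice [l Hl] := path_to.
rewrite (_ : [set: PS] = \bigcup_(e in setT) (l e @` II)); last first.
  apply/seteqP; split=> // e _; exists e => //; exists 1; first exact: II1.
  by have [] := Hl e.
apply: bigcup_connected.
  by exists e0 => e _; exists 0; [exact: II0|have [] := Hl e].
move=> e _; apply: connected_continuous_connected.
  exact: (@segment_connected RR).
by have [] := Hl e.
Qed.

Lemma pathspace_lpc : locally_path_connected PS.
Proof.
move=> x N; rewrite nbhsE => -[ O [oO Ox] ON].
(* The path component of [x] in [O]. It spreads along segments that stay in [O], hence is open by
   [hopen_segments]. *)
exists [set y | exists l, [/\ cpath l, l 0 = x, l 1 = y & forall t, II t -> O (l t)]]; split.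
- apply/pathspace_openP => H f g cf fg.
  have cg := canonical_lift_hcontinuous cf fg.
  apply: (@hopen_segments H _ g O) => //.
    by move=> y my [l [_ _ <- lO]]; apply: lO; exact: II1.
  move=> s p y Dp Dy Oseg [l [cl l0 l1 lO]].
  exists (pcat l (fun t => g (hproj s (lerp p y t)))); split.
  + by apply: cpath_pcat => //; [exact: hsegment|rewrite lerp0].
  + by rewrite pcat0.
  + by rewrite pcat1 lerp1.
  + exact: pcat_in.
- by exists (fun=> x); split=> //; exact: within_cst.
- by move=> y [l [_ _ <- lO]]; apply/ON/lO/II1.
- move=> y z [l [cl l0 l1 lO]] [k [ck k0 k1 kO]].
  exists (pcat (prev l) k); split; last first.
    apply: pcat_in.
      move=> t It; exists (fun s => l ((1 - t) * s)).
      have It' := prev_II It; split.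
      * exact: cpath_scale.
      * by rewrite mulr0.
      * by rewrite mulr1.
      * move=> s Is; apply: lO; have /IIP [? ?] := It'; have /IIP [? ?] := Is.
        by apply/IIP; split; nra.
    move=> t It; exists (fun s => k (t * s)); split.
    * exact: cpath_scale.
    * by rewrite mulr0.
    * by rewrite mulr1.
    * move=> s Is; apply: kO; have /IIP [? ?] := It; have /IIP [? ?] := Is.
      by apply/IIP; split; nra.
  split; last by rewrite pcat0 pcat1 prev0.
  by apply: cpath_pcat => //; [exact: cpath_prev|rewrite prev1 l0].
Qed.

Lemma pathspace_peano : peano_space PS.
Proof. by split; [exact: pathspace_connected|exact: pathspace_lpc]. Qed.
End PathSpace.

(** * The universal congruence and the maximal covering *)

Section UniversalCongruence.
Variable B : topologicalType.
Implicit Types a b : RR -> B.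

(** All hedgehog coverings are tested here, not only the maximal ones as in [hequiv], so that no
    maximal covering has to be at hand before one is built from this relation. Continuity and common
    ends are included to obtain a path congruence. *)
Definition same_lifts a b := [/\ cpath a, cpath b, a 0 = b 0, a 1 = b 1 &
  forall (E : topologicalType) (q : E -> B), dh_covering q ->
    forall la lb, is_lift q a la -> is_lift q b lb -> la 0 = lb 0 -> la 1 = lb 1].

Lemma is_lift_comp (E : topologicalType) (q : E -> B) a l (p : RR -> RR) :
  is_lift q a l -> cpath p -> (forall t, II t -> II (p t)) ->
  is_lift q (fun t => a (p t)) (fun t => l (p t)).
Proof.
move=> [cl ql] cp pI; split; first exact: cpath_comp.
by move=> t It; apply: ql; exact: pI.
Qed.

Lemma is_lift_pcat (E : topologicalType) (q : E -> B) a b la lb :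
  is_lift q a la -> is_lift q b lb -> la 1 = lb 0 -> is_lift q (pcat a b) (pcat la lb).
Proof.
move=> [ca qa] [cb qb] e; split; first exact: cpath_pcat.
move=> t /IIP [t0 t1]; rewrite /pcat; case: ifPn => h.
  by apply: qa; apply/IIP; split; lra.
by rewrite -ltNge in h; apply: qb; apply/IIP; split; lra.
Qed.

Lemma is_lift_ext (E : topologicalType) (q : E -> B) a b l :
  (forall t, II t -> a t = b t) -> is_lift q a l -> is_lift q b l.
Proof. by move=> ab [cl ql]; split=> // t It; rewrite ql // ab. Qed.

Lemma pcat_fst (T : Type) (a b : RR -> T) t : II t -> pcat a b (2^-1 * t) = a t.
Proof.
by move=> /IIP [? ?]; rewrite /pcat ifT; [congr a; lra|lra].
Qed.

Lemma pcat_snd (T : Type) (a b : RR -> T) t : a 1 = b 0 -> II t ->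
  pcat a b (2^-1 * t + 2^-1) = b t.
Proof.
move=> ab /IIP [? ?]; rewrite /pcat; case: ifPn => h; last by congr b; lra.
have -> : t = 0 by apply/le_anti; lra.
by rewrite mulr0 add0r mulfV ?pnatr_eq0 // ab.
Qed.

Lemma is_lift_fst (E : topologicalType) (q : E -> B) a b l :
  is_lift q (pcat a b) l -> is_lift q a (fun t => l (2^-1 * t)).
Proof.
move=> h; apply: is_lift_ext (is_lift_comp (p := fun t => 2^-1 * t) h _ _).
- by move=> t It; rewrite pcat_fst.
- by wcont.
- by move=> t /IIP [? ?]; apply/IIP; split; lra.
Qed.

Lemma is_lift_snd (E : topologicalType) (q : E -> B) a b l : a 1 = b 0 ->
  is_lift q (pcat a b) l -> is_lift q b (fun t => l (2^-1 * t + 2^-1)).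
Proof.
move=> ab h; apply: is_lift_ext (is_lift_comp (p := fun t => 2^-1 * t + 2^-1) h _ _).
- by move=> t It; rewrite pcat_snd.
- by wcont.
- by move=> t /IIP [? ?]; apply/IIP; split; lra.
Qed.

(** The part of [a] before [t0] is lifted backwards from [e]. The lift of [a] from the point so
    reached returns to [e] at [t0] by uniqueness. *)
Lemma lift_through (E : topologicalType) (q : E -> B) a e t0 :
  dh_covering q -> cpath a -> II t0 -> q e = a t0 -> exists l, is_lift q a l /\ l t0 = e.
Proof.
move=> dq ca It0 qe.
have It0' : II 1 by exact: II1.
have c1 : cpath (fun t => a (t0 * (1 - t))).
  apply: (cpath_comp (p := fun t => t0 * (1 - t))) => //; first by wcont.
  move=> t /IIP [? ?]; have /IIP [? ?] := It0; apply/IIP; split; nra.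
have [|k [[ck qk] k0]] := path_lift (e := e) dq c1; first by rewrite subr0 mulr1.
have [|l [[cl ql] l0]] := path_lift (e := k 1) dq ca.
  by rewrite qk // subrr mulr0.
exists l; split=> //.
rewrite -k0 -[in RHS](subrr 1) -[t0]mulr1.
apply: (path_lift_unique dq (a := fun t => a (t0 * t)) (l := fun t => l (t0 * t))
  (l' := fun t => k (1 - t)) _ _ _ II1).
- split; first exact: cpath_scale.
  move=> t /IIP [? ?]; have /IIP [? ?] := It0; apply: ql; apply/IIP; split; nra.
- split; first by exact: (cpath_prev ck).
  by move=> t It; rewrite qk; [congr a; lra|exact: prev_II].
- by rewrite mulr0 subr0.
Qed.

Lemma same_lifts_congruence : path_congruence same_lifts.
Proof.
split.
- move=> a ca; split=> // E q dq la lb ha hb e0.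
  by apply: (path_lift_unique dq ha hb e0); exact: II1.
- move=> a b [ca cb e0 e1 H]; split=> // E q dq la lb ha hb e.
  by apply/esym; exact: (H E q dq).
- move=> a b c [ca cb e0 e1 H] [_ cc e0' e1' H']; split=> //; [by rewrite e0|by rewrite e1|].
  move=> E q dq la lc ha hc e.
  have [|l [hl l0]] := path_lift (e := la 0) dq cb.
    by case: ha => _ ->; rewrite ?e0 //; exact: II0.
  rewrite (H E q dq la l) //.
  by apply: (H' E q dq) => //; rewrite l0.
- by move=> a b [].
- by move=> a b [].
- move=> a a' b b' [ca ca' e0 e1 H] [cb cb' e0' e1' H'] ab.
  have ab' : a' 1 = b' 0 by rewrite -e1 ab.
  split; [exact: cpath_pcat|exact: cpath_pcat|by rewrite !pcat0|by rewrite !pcat1|].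
  move=> E q dq la lb ha hb e.
  have h1 : la (2^-1 * 1) = lb (2^-1 * 1).
    by apply: (H E q dq _ _ (is_lift_fst ha) (is_lift_fst hb)); rewrite mulr0.
  have := H' E q dq _ _ (is_lift_snd ab ha) (is_lift_snd ab' hb).
  rewrite mulr1 in h1; rewrite mulr0 add0r mulr1 (_ : 2^-1 + 2^-1 = 1 :> RR); last by lra.
  exact.
- move=> a p r ca cp cr pI rI e0 e1; split; [exact: cpath_comp|exact: cpath_comp|by rewrite e0|by rewrite e1|].
  move=> E q dq la lb ha hb e.
  (* One lift [l] of [a] serves both sides: its composites with [p] and [r] lift the two
     reparametrizations and end together because [p 1 = r 1]. *)
  have [||l [hl lp]] := lift_through (t0 := p 0) (e := la 0) dq ca.
  + by apply: pI; exact: II0.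
  + by case: ha => _ ->; rewrite ?e0 //; exact: II0.
  have -> : la 1 = l (p 1).
    apply: (path_lift_unique dq ha (is_lift_comp hl cp pI)); [by rewrite lp|exact: II1].
  rewrite e1; apply/esym.
  by apply: (path_lift_unique dq hb (is_lift_comp hl cr rI)); [rewrite -e -e0 lp|exact: II1].
Qed.

Variable b0 : B.
Local Notation PS := (pathspace same_lifts b0).
Local Notation RC := same_lifts_congruence.

(** A class goes to the end of the lift from [e] of any representative, which is well defined by the
    very definition of [same_lifts]. Along a canonical lift of [f] this map gives the lift of [f] to
    [E], hence it is continuous. *)
Lemma pathspace_end_map (E : topologicalType) (q : E -> B) e : dh_covering q -> q e = b0 ->
  exists rho : PS -> E, [/\ continuous rho, forall x, q (rho x) = psend x &
    forall x a l, cpath a -> sval x = same_lifts a -> is_lift q a l -> l 0 = e -> rho x = l 1].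
Proof.
move=> dq qe.
have /choice [rho Hr] : forall x : PS, exists y : E, exists l,
    [/\ is_lift q (psrepr x) l, l 0 = e & l 1 = y].
  move=> x; have [ca a0 _] := psreprP x.
  by have [|l [hl l0]] := path_lift (e := e) dq ca; [rewrite qe a0|exists (l 1), l].
have rhoE x a l : cpath a -> sval x = same_lifts a -> is_lift q a l -> l 0 = e -> rho x = l 1.
  move=> ca xa hl l0; have [k [hk k0 <-]] := Hr x.
  have [_ _ _ _ h] := psrepr_R RC ca xa.
  by apply: (h E q dq) => //; rewrite k0 l0.
exists rho; split=> //; last first.
  by move=> x; have [k [[_ qk] _ <-]] := Hr x; rewrite qk //; exact: II1.
apply/continuousP => O oO; apply/pathspace_openP => H f g cf [a [ca a0 a1 ag]].
have [|l [hl l0]] := path_lift (e := e) dq ca; first by rewrite qe a0.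
have ql1 : f None = q (l 1) by case: hl => _ ->; rewrite ?a1 //; exact: II1.
have [k [ck qk k0 _]] := dq.2 (l 1) H None f I cf ql1.
have -> : [set x | hmem x /\ (rho @^-1` O) (g x)] = [set x | hmem x /\ O (k x)]; last exact: ck.
have rg x : hmem x -> rho (g x) = k x.
  move=> mx; have chf := cpath_hline cf mx; have chk := cpath_hline ck mx.
  rewrite -(hline1 k mx) -(pcat1 l (hline k x)).
  apply: (rhoE _ (pcat a (hline f x))).
  - by apply: cpath_pcat => //; rewrite hline0.
  - exact: ag.
  - apply: is_lift_pcat => //; last by rewrite hline0.
    split=> // t It; case: x mx {chf chk} => [[s p]|] /= mx; last exact: qk.
    apply: qk; apply: hproj_mem; apply: convex2_disk => //; first exact: hz_disk.
    by case: mx.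
  - by rewrite pcat0.
by apply/seteqP; split=> x /= [mx]; rewrite rg.
Qed.

(** The end maps into all hedgehog coverings separate the points of the path space, so uniqueness of
    lifts is inherited from those coverings. *)
Lemma universal_maximal : maximal_dh_covering (@psend B same_lifts b0).
Proof.
split.
- apply: (pathspace_dh_covering RC) => H g g' x0 cg cg' m0 e0 eg x mx.
  have [ca a0 ea] := psreprP (g x); have [ca' a0' ea'] := psreprP (g' x).
  apply: ps_inj; rewrite ea ea'; apply: (class_eq RC); split=> //.
  + by rewrite a0 a0'.
  + exact: eg.
  move=> E q dq la lb ha hb e.
  have [|rho [crho qrho Hrho]] := @pathspace_end_map E q (la 0) dq.
    by case: ha => _ ->; [|exact: II0].
  rewrite -(Hrho _ _ la ca ea) // -(Hrho _ _ lb ca' ea') //.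
  apply: (hlift_unique dq (x0 := x0) (g := fun x => rho (g x)) (g' := fun x => rho (g' x))) => //.
  + exact: hcontinuous_comp.
  + exact: hcontinuous_comp.
  + by rewrite e0.
  + by move=> y my; rewrite !qrho eg.
- exact: pathspace_peano RC.
- move=> E2 q2 dq2 _ e1 e2 qe.
  have [ca a0 ea] := psreprP e1.
  (* Lifting the reverse of the representative of [e1] from [e2] finds the point over [b0] whose end
     map sends [e1] to [e2]. *)
  have [|l [hl l0]] := path_lift (e := e2) dq2 (cpath_prev ca); first by rewrite prev0 -qe.
  have [|rho [crho qrho Hrho]] := @pathspace_end_map E2 q2 (l 1) dq2.
    by case: hl => _ ->; rewrite ?prev1 //; exact: II1.
  exists rho; split=> //; first by apply/funext => x /=.
  rewrite (Hrho _ _ (prev l) ca ea) ?prev1 ?prev0 //.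
  split; first by apply: cpath_prev; case: hl.
  by case: hl => _ ql t It; rewrite /prev ql ?/prev; [congr psrepr; lra|exact: prev_II].
Qed.

End UniversalCongruence.

(** In the maximal covering by path classes the lifts from the constant class end at the classes of
    [a] and of [b] themselves. Conversely, a maximal covering is one of those tested by
    [same_lifts]. *)
Lemma hequivE (B : topologicalType) (a b : RR -> B) :
  cpath a -> cpath b -> a 0 = b 0 -> a 1 = b 1 -> hequiv a b <-> same_lifts a b.
Proof.
move=> ca cb e0 e1; have RC := same_lifts_congruence B; split=> [h|[_ _ _ _ h] E q [dq _ _]].
  have [l [hl Hl]] := pathspace_path_lift RC ca erefl.
  have [k [hk Hk]] := pathspace_path_lift RC cb (esym e0).
  have scale1 (c : RR -> B) : (fun s => c (1 * s)) = c by apply/funext => s; rewrite mul1r.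
  have lk : l 0 = k 0.
    apply: ps_inj; rewrite (Hl _ II0) (Hk _ II0); congr same_lifts.
    by apply/funext => s; rewrite !mul0r.
  have := h _ _ (universal_maximal (a 0)) l k hl hk lk.
  move=> /(congr1 sval); rewrite (Hl _ II1) (Hk _ II1) !scale1.
  exact: class_inj.
exact: h.
Qed.

(** * The covering of the base defined by words *)

(** Connectedness of the interval, for an arbitrary predicate: on each piece of a fine subdivision
    the truth value is constant. *)
Lemma locally_constant_II (P : RR -> Prop) :
  (forall t0, II t0 -> exists2 N, nbhs t0 N & forall t, N t -> II t -> (P t <-> P t0)) ->
  P 0 -> P 1.
Proof.
move=> H P0.
have [|n1 Hn1] := @lebesgue_square RR 0 (fun t0 => [set p | P p.1 <-> P t0]).
  move=> p [Dp _]; have [N nN NP] := H p.1 Dp.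
  exists p.1, (fst @^-1` N); first exact: (@cvg_fst _ _ (nbhs p.1) (nbhs p.2)).
  by move=> x Nx [Dx _]; exact: NP.
have [c Hc] := Hn1 n1.+1 (leqnSn n1).
have steps k : (k <= n1.+1)%N -> P (k%:R / n1.+1%:R).
  elim: k => [|k IH] kn; first by rewrite mul0r.
  have hk := Hc k 0%N kn isT.
  have [] := hk (k.+1%:R / n1.+1%:R, 0) => //=.
  - by split; [exact: grid_II|exact: II0].
  - by rewrite gridE // lexx ler_nat leqnSn.
  - by rewrite mulr0 lexx ler01.
  move=> _; apply.
  have [] := hk (k%:R / n1.+1%:R, 0) => //=.
  - by split; [apply: grid_II => //; exact: ltnW|exact: II0].
  - by rewrite gridE // lexx ler_nat leqnSn.
  - by rewrite mulr0 lexx ler01.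
  by move=> h _; apply: h; apply: IH; exact: ltnW.
by have := steps n1.+1 (leqnn _); rewrite divff // pnatr_eq0.
Qed.

Section SameWords.
Variables (B : topologicalType) (C : set (set B)).
Hypothesis Copen : forall u, C u -> open u.
Hypothesis Ccover : forall x : B, exists2 u, C u & u x.
Implicit Types a b : RR -> B.

Lemma Cpoint (x : B) : exists y : B, forall u : set B, C u -> u x -> u y.
Proof. by exists x. Qed.

Local Notation mono := (mono C (fun u : set B => u)).

Lemma mono_move_start a U U' W w : C U -> C U' -> U (a 0) -> U' (a 0) ->
  mono a U W w -> mono a U' W (U' :: w).
Proof.
move=> CU CU' Ua U'a [n [i [n0 D H]]]; exists n, i; split=> //.
apply: weq_trans (weq_cons _ H) _.
case: n n0 D {H} => // n n0 D.
have [Ci i0 _] := devs_points n0 D (ltn0Sn n); rewrite mul0r in i0.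
rewrite /wdev mkseq_cons rcons_cons.
exact: (@weq_tri _ _ _ _ _ _ (a 0)).
Qed.

Definition same_words a b := [/\ cpath a, cpath b, a 0 = b 0, a 1 = b 1 &
  forall U W w w', C U -> C W -> U (a 0) -> W (a 1) -> mono a U W w -> mono b U W w' ->
    weq C w w'].

(** A common word for one choice of end letters suffices, since a change of end letters alters the
    words of both paths alike. *)
Lemma same_wordsI a b U W w : cpath a -> cpath b -> a 0 = b 0 -> a 1 = b 1 ->
  C U -> C W -> U (a 0) -> W (a 1) -> mono a U W w -> mono b U W w -> same_words a b.
Proof.
move=> ca cb e0 e1 CU CW Ua Wa ma mb; split=> // U' W' w1 w2 CU' CW' U'a W'a m1 m2.
have h1 := mono_move Cpoint CW CW' Wa W'a (mono_move_start CU CU' Ua U'a ma).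
rewrite e0 in Ua U'a; rewrite e1 in Wa W'a.
have h2 := mono_move Cpoint CW CW' Wa W'a (mono_move_start CU CU' Ua U'a mb).
rewrite -e0 in U'a; rewrite -e1 in W'a.
apply: weq_trans (mono_unique Copen Ccover Cpoint ca CU' CW' U'a W'a m1 h1) _.
rewrite e0 in U'a; rewrite e1 in W'a.
exact: (mono_unique Copen Ccover Cpoint cb CU' CW' U'a W'a h2 m2).
Qed.

Lemma same_words_htpy a b : htpy a b -> same_words a b.
Proof.
move=> ab; have RC := htpy_path_congruence B; have [ca cb] := htpy_cpath ab.
split=> //; [exact: (pc_end0 RC ab)|exact: (pc_end1 RC ab)|].
by move=> U W w w' CU CW Ua Wa; exact: (mono_htpy Copen Ccover Cpoint ab).
Qed.

Lemma same_words_congruence : path_congruence same_words.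
Proof.
split.
- by move=> a ca; apply: same_words_htpy; exact: (pc_refl (htpy_path_congruence B)).
- move=> a b [ca cb e0 e1 H]; split=> // U W w w' CU CW Ua Wa m1 m2.
  by apply: weq_sym; apply: (H U W); rewrite ?e0 ?e1.
- move=> a b c [ca cb e0 e1 H] [_ cc e0' e1' H'].
  split=> //; [by rewrite e0|by rewrite e1|] => U W w w' CU CW Ua Wa m1 m2.
  have [w3 m3] := mono_exists Copen Ccover U W cb.
  apply: weq_trans (H U W _ _ CU CW Ua Wa m1 m3) _.
  by apply: (H' U W); rewrite -?e0 -?e1.
- by move=> a b [].
- by move=> a b [].
- move=> a a' b b' [ca ca' e0 e1 H] [cb cb' e0' e1' H'] ab.
  have ab' : a' 1 = b' 0 by rewrite -e1 ab.
  have [U CU Ua] := Ccover (a 0); have [V CV Va] := Ccover (a 1).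
  have [W CW Wa] := Ccover (b 1).
  have [wa ma] := mono_exists Copen Ccover U V ca.
  have [wa' ma'] := mono_exists Copen Ccover U V ca'.
  have [wb mb] := mono_exists Copen Ccover V W cb.
  have [wb' mb'] := mono_exists Copen Ccover V W cb'.
  apply: (@same_wordsI _ _ U W (wa ++ wb)); rewrite ?pcat0 ?pcat1 //.
  + exact: cpath_pcat.
  + exact: cpath_pcat.
  + exact: (mono_pcat Cpoint CV Va ab ma mb).
  + apply: mono_weq (mono_pcat Cpoint CV _ ab' ma' mb'); last by rewrite -e1.
    apply: weq_sym; apply: weq_cat; first exact: (H U V).
    by apply: (H' V W) => //; rewrite -ab.
- move=> a p r ca cp cr pI rI e0 e1; apply: same_words_htpy.
  exact: (pc_reparam (htpy_path_congruence B)).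
Qed.

Variables (b0 : B) (U0 : set B).
Hypotheses (CU0 : C U0) (U0b : U0 b0).
Local Notation PS := (pathspace same_words b0).
Local Notation RC := same_words_congruence.

Definition sheet (U : set B) (w : seq (set B)) : set PS :=
  [set e | U (psend e) /\ mono (psrepr e) U0 U w].

(** Moving along a segment inside [U] appends only the letter [U], which is absorbed; so the label
    [w] persists and [hopen_segments] applies. *)
Lemma sheet_open U w : C U -> open (sheet U w).
Proof.
move=> CU; apply/pathspace_openP => H f g cf fg.
have [a [ca a0 a1 ag]] := fg.
have word x : hmem x -> U (f x) -> sheet U w (g x) <-> mono (pcat a (hline f x)) U0 U w.
  move=> mx Ux.
  have cax : cpath (pcat a (hline f x)).
    by apply: cpath_pcat => //; [exact: cpath_hline|rewrite hline0].
  have [c1 c2 e0 e1 Hw] := psrepr_R RC cax (ag x mx).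
  have [_ p0 _] := psreprP (g x).
  have Ue : U (psend (g x)) by rewrite (canonical_lift_end RC cf fg).
  have [w1 m1] := mono_exists Copen Ccover U0 U c1.
  have [w2 m2] := mono_exists Copen Ccover U0 U c2.
  have U0e : U0 (psrepr (g x) 0) by rewrite p0.
  split=> [[_ m]|m].
    by apply: (mono_weq _ m2); apply: weq_sym; exact: (Hw U0 U).
  by split=> //; apply: (mono_weq _ m1); exact: (Hw U0 U).
apply: (@hopen_segments H _ f U) => //; first exact: Copen.
  by move=> x mx [Ux _]; rewrite -(canonical_lift_end RC cf fg mx).
move=> s p y Dp Dy Useg.
have Up : U (f (hproj s p)) by rewrite -[p in hproj s p](lerp0 p y); apply: Useg; exact: II0.
have Uy : U (f (hproj s y)) by rewrite -[y in hproj s y](lerp1 p y); apply: Useg; exact: II1.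
have mp := hproj_mem s Dp; have my := hproj_mem s Dy.
move=> /(word _ mp Up) m; apply/(word _ my Uy).
pose seg t := f (hproj s (lerp p y t)).
have cseg : cpath seg by exact: hsegment.
have chp := cpath_hline cf mp; have chy := cpath_hline cf my.
have cap : cpath (pcat a (hline f (hproj s p))) by apply: cpath_pcat => //; rewrite hline0.
have capy : cpath (pcat a (hline f (hproj s y))) by apply: cpath_pcat => //; rewrite hline0.
have j1 : hline f (hproj s p) 1 = seg 0 by rewrite hline1 // /seg lerp0.
have m2 := mono_pcat Cpoint CU _ _ m (mono_in cseg CU Useg).
rewrite pcat1 j1 /seg lerp0 in m2; have {m2} m2 := m2 Up erefl.
have m3 : mono (pcat (pcat a (hline f (hproj s p))) seg) U0 U w.
  by apply: mono_weq m2; exact: (weq_mono_last m).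
have HC := htpy_path_congruence B.
(* In the convex disk the broken line from the base point through [p] to [y] is homotopic to the
   straight segment. *)
have hh : htpy (pcat (pcat a (hline f (hproj s p))) seg) (pcat a (hline f (hproj s y))).
  apply: (pc_trans HC (pc_assoc HC ca chp cseg _ j1)); first by rewrite hline0.
  apply: (pc_pcat HC); [exact: (pc_refl HC)| |by rewrite pcat0 hline0].
  rewrite !hline_hproj /seg.
  pose F q := f (hproj s q).
  rewrite -/(F) (pcat_comp F (lerp (hz s) p) (lerp p y)).
  apply: (htpy_straight convex2_disk (@hcontinuous_disk _ _ _ s cf)).
  - by apply: cpath_pcat; [exact: continuous_lerp|exact: continuous_lerp|rewrite lerp0 lerp1].
  - exact: continuous_lerp.
  - apply: pcat_in => t It; apply: convex2_disk => //; exact: hz_disk.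
  - by move=> t It; apply: convex2_disk => //; exact: hz_disk.
  - by rewrite pcat0 !lerp0.
  - by rewrite pcat1 !lerp1.
have [w4 m4] := mono_exists Copen Ccover U0 U capy.
apply: (mono_weq _ m4); apply: weq_sym.
apply: (mono_htpy Copen Ccover Cpoint hh CU0 CU _ _ m3 m4).
  by rewrite !pcat0 a0.
by rewrite pcat1 /seg lerp1.
Qed.

Lemma same_sheet (e e' : PS) U w w' : C U -> U (psend e) -> psend e = psend e' ->
  mono (psrepr e) U0 U w -> mono (psrepr e') U0 U w' -> e = e' <-> weq C w w'.
Proof.
move=> CU Ue ee m m'.
have [ca a0 ea] := psreprP e; have [ca' a0' ea'] := psreprP e'.
split=> [e1|ww].
  subst e'; apply: (mono_unique Copen Ccover Cpoint ca CU0 CU _ _ m m') => //.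
  by rewrite a0.
apply: ps_inj; rewrite ea ea'; apply: (class_eq RC).
apply: (@same_wordsI _ _ U0 U w') => //; first by rewrite a0 a0'.
- by rewrite a0.
- exact: mono_weq m.
Qed.

(** Near [t0] the two lifts stay in sheets labelled [w] and [w']. Over one point, equality of
    classes is equality of labels, so whether the lifts agree is locally constant. *)
Lemma sheets_unique_path (G G' : RR -> PS) : cpath G -> cpath G' ->
  (forall t, II t -> psend (G t) = psend (G' t)) -> G 0 = G' 0 -> G 1 = G' 1.
Proof.
move=> cG cG' ee; apply: (locally_constant_II (P := fun t => G t = G' t)) => t0 It0.
have [U CU Ut0] := Ccover (psend (G t0)).
have [ca a0 ea] := psreprP (G t0); have [ca' a0' ea'] := psreprP (G' t0).
have [w m] := mono_exists Copen Ccover U0 U ca.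
have [w' m'] := mono_exists Copen Ccover U0 U ca'.
have Ut0' : U (psend (G' t0)) by rewrite -ee.
have [N nN NS] := within_nbhs cG It0 (sheet_open w CU) (conj Ut0 m).
have [N' nN' NS'] := within_nbhs cG' It0 (sheet_open w' CU) (conj Ut0' m').
exists (N `&` N'); first exact: filterI.
move=> t [Nt N't] It.
have [Ut mt] := NS t Nt It; have [Ut' mt'] := NS' t N't It.
rewrite (same_sheet CU Ut (ee t It) mt mt').
by rewrite (same_sheet CU Ut0 (ee t0 It0) m m').
Qed.

(** Each point of a hedgehog is joined to the wedge point by a segment, so uniqueness along paths is
    enough. *)
Lemma same_words_dh_covering : dh_covering (@psend B same_words b0).
Proof.
apply: (pathspace_dh_covering RC) => H g g' x0 cg cg' m0 e0 ee.
have seg s p y : disk p -> disk y -> g (hproj s p) = g' (hproj s p) ->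
    g (hproj s y) = g' (hproj s y).
  move=> Dp Dy gp; rewrite -(lerp1 p y).
  apply: (@sheets_unique_path (fun t => g (hproj s (lerp p y t)))
    (fun t => g' (hproj s (lerp p y t)))).
  - exact: hsegment.
  - exact: hsegment.
  - by move=> t It; apply: ee; apply: hproj_mem; exact: convex2_disk.
  - by rewrite lerp0.
have gN : g None = g' None.
  move: e0; have [->|[s [p [Dp ->]]]] := hpt_hproj m0; first by [].
  by rewrite -(hproj_base s); apply: seg => //; exact: hz_disk.
move=> x /hpt_hproj [->|[s [p [Dp ->]]]] //.
by apply: (seg s (hz s)) => //; [exact: hz_disk|rewrite hproj_base].
Qed.
End SameWords.

(** * Hedgehog equivalence in terms of words *)

Section SameLiftsWords.
Variables (B : topologicalType) (C : set (set B)).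
Hypothesis Copen : forall u, C u -> open u.
Hypothesis Ccover : forall x : B, exists2 u, C u & u x.
Local Notation mono := (mono C (fun u : set B => u)).
Implicit Types a b : RR -> B.

Lemma same_lifts_words a b : same_lifts a b -> same_words C a b.
Proof.
move=> [ca cb e0 e1 H]; have RC := same_words_congruence Copen Ccover.
have [U0 CU0 U0a] := Ccover (a 0).
have [l [hl Hl]] := pathspace_path_lift RC ca erefl.
have [k [hk Hk]] := pathspace_path_lift RC cb (esym e0).
have scale1 (c : RR -> B) : (fun s => c (1 * s)) = c by apply/funext => s; rewrite mul1r.
have lk : l 0 = k 0.
  apply: ps_inj; rewrite (Hl _ II0) (Hk _ II0); congr same_words.
  by apply/funext => s; rewrite !mul0r.
have := H _ _ (same_words_dh_covering Copen Ccover CU0 U0a) l k hl hk lk.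
move=> /(congr1 sval); rewrite (Hl _ II1) (Hk _ II1) !scale1.
exact: class_inj.
Qed.

Hypothesis Cpc : forall u, C u -> path_connected_set u.
Hypothesis Cstar : forall (x : B) a, is_loop x a ->
  (forall t, II t -> star x C (a t)) -> same_lifts a (fun=> x).

Section Cover.
Variables (E : topologicalType) (q : E -> B).
Hypothesis dq : dh_covering q.

Definition sheet_path (u : set B) (e e' : E) := exists l : RR -> E,
  [/\ cpath l, l 0 = e, l 1 = e' & forall t, II t -> u (q (l t))].

Lemma sheet_path_sym u e e' : sheet_path u e e' -> sheet_path u e' e.
Proof.
move=> [l [cl l0 l1 lu]]; exists (prev l); split.
- exact: cpath_prev.
- by rewrite prev0.
- by rewrite prev1.
- by move=> t It; apply: lu; exact: prev_II.
Qed.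

Lemma sheet_path_trans u e e' e'' : sheet_path u e e' -> sheet_path u e' e'' ->
  sheet_path u e e''.
Proof.
move=> [l [cl l0 l1 lu]] [k [ck k0 k1 ku]]; exists (pcat l k); split.
- by apply: cpath_pcat => //; rewrite l1.
- by rewrite pcat0.
- by rewrite pcat1.
- exact: (pcat_in (A := fun e => u (q e))).
Qed.

Lemma sheet_path_dom u e e' : sheet_path u e e' -> u (q e).
Proof. by move=> [l [_ <- _ lu]]; apply: lu; exact: II0. Qed.

(** The projection of a path over [u] from [e] to [e'], followed by a path in [v] from [q e'] back
    to [q e], is a loop in the star of [q e]. Its lift closes up, so the lift of the return path
    joins [e'] to [e] over [v]. *)
Lemma sheet_path_change u v e e' : C u -> C v -> sheet_path u e e' -> v (q e) -> v (q e') ->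
  sheet_path v e e'.
Proof.
move=> Cu Cv h ve ve'; have ue := sheet_path_dom h.
case: h => l [cl l0 l1 lu].
have [b [[cb [b0 b1]] bv]] := Cpc Cv ve' ve.
have [k [hk k0]] := path_lift dq cb (esym b0).
have hl : is_lift q (fun t => q (l t)) l by [].
have lk : l 1 = k 0 by rewrite l1 k0.
have hp := is_lift_pcat hl hk lk.
have cql : cpath (fun t => q (l t)).
  by apply: (within_comp (A := setT) _ _ cl) => //; apply: within_of_continuous; exact: dh_cont dq.
have cp : cpath (pcat (fun t => q (l t)) b) by apply: cpath_pcat => //; rewrite l1.
have [_ _ _ _ H] : same_lifts (pcat (fun t => q (l t)) b) (fun=> q e).
  apply: Cstar; first by split=> //; rewrite pcat0 pcat1 l0.
  apply: pcat_in => t It; first by exists u => //; exact: lu.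
  by exists v => //; exact: bv.
have he : is_lift q (fun=> q e) (fun=> e) by split=> //; exact: within_cst.
have := H E q dq _ _ hp he; rewrite pcat0 pcat1 => /(_ l0) k1.
apply: sheet_path_sym; exists k; split=> //; first by case: hk.
by move=> t It; case: hk => _ -> //; exact: bv.
Qed.

Lemma sheet_path_lift u a l : is_lift q a l -> (forall t, II t -> u (a t)) -> sheet_path u (l 0) (l 1).
Proof. by move=> [cl ql] ua; exists l; split=> // t It; rewrite ql //; exact: ua. Qed.

(** The path projects to a loop in [u], hence in the star of [q e], and the lift of such a loop
    closes up. *)
Lemma sheet_path_functional u e e' : C u -> sheet_path u e e' -> q e = q e' -> e = e'.
Proof.
move=> Cu [l [cl l0 l1 lu]] ee.
have cql : cpath (fun t => q (l t)).
  by apply: (within_comp (A := setT) _ _ cl) => //; apply: within_of_continuous; exact: dh_cont dq.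
have ue : u (q e) by rewrite -l0; apply: lu; exact: II0.
have [_ _ _ _ H] : same_lifts (fun t => q (l t)) (fun=> q e).
  apply: Cstar; first by split=> //; rewrite l0 l1 -ee.
  by move=> t It; exists u => //; exact: lu.
have he : is_lift q (fun=> q e) (fun=> e) by split=> //; exact: within_cst.
have hl : is_lift q (fun t => q (l t)) l by [].
by have := H E q dq l _ hl he l0; rewrite l1.
Qed.

Lemma words_lifts U W n i a l : C U -> C W -> U (a 0) -> W (a 1) -> (0 < n)%N ->
  devs C (fun u : set B => u) n i a -> is_lift q a l ->
  transport sheet_path (wdev U n i W) (l 0) (l 1).
Proof.
move=> CU CW Ua Wa n0 D hl.
have h0 : l 0 = l (0%:R / n%:R) by rewrite mul0r.
have h1 : l 1 = l (n%:R / n%:R) by rewrite divff // pnatr_eq0 -lt0n.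
have [cl ql] := hl.
have cst u e : u (q e) -> sheet_path u e e by exists (fun=> e); split=> //; exact: within_cst.
have Ua' : U (q (l 0)) by rewrite ql //; exact: II0.
have Wa' : W (q (l 1)) by rewrite ql //; exact: II1.
rewrite {1}h0 {1}h1; apply: (transport_wdev (e := fun k : nat => l (k%:R / n%:R))).
- by rewrite -h0; exact: cst.
- by rewrite -h1; exact: cst.
move=> k kn; have [Ck Hk] := D k kn.
have n0' : 0 < n%:R :> RR by rewrite ltr0n.
pose p (t : RR) := (k%:R + t) / n%:R.
have np t : n%:R * p t = k%:R + t by rewrite /p mulrC divfK // gt_eqF.
have pI t : II t -> II (p t).
  move=> /IIP [t0 t1]; apply/IIP; split; first by rewrite /p divr_ge0 // addr_ge0 ?ler0n.
  rewrite /p ler_pdivrMr // mul1r; apply: (@le_trans _ _ k.+1%:R); last by rewrite ler_nat.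
  by rewrite -natr1 lerD2l.
exists (fun t => l (p t)); split.
- by apply: cpath_comp => //; rewrite /p; wcont.
- by rewrite /p addr0.
- by rewrite /p natr1.
- move=> t It; rewrite ql; last exact: pI.
  apply: Hk; first exact: pI.
  by have /IIP [? ?] := It; rewrite np -natr1; apply/andP; split; lra.
Qed.

(** Transport along the common word puts both ends on one sheet over [W], and such a sheet has only
    one element over a given point. *)
Lemma words_same_end a b U W w la lb : cpath a -> cpath b -> a 0 = b 0 -> a 1 = b 1 ->
  C U -> C W -> U (a 0) -> W (a 1) -> mono a U W w -> mono b U W w ->
  is_lift q a la -> is_lift q b lb -> la 0 = lb 0 -> la 1 = lb 1.
Proof.
move=> ca cb e0 e1 CU CW Ua Wa [n [i [n0 Da Ha]]] [m [j [m0 Db Hb]]] hla hlb e.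
have cst u e2 : C u -> u (q e2) -> sheet_path u e2 e2.
  by move=> _ ue; exists (fun=> e2); split=> //; exact: within_cst.
have move_pt u v x e2 p : C u -> C v -> C x -> u p -> v p -> x p -> u (q e2) ->
    exists e', [/\ sheet_path u e2 e', v (q e') & x (q e')].
  move=> Cu Cv Cx up vp xp ue.
  have [c [[cc [c0 c1]] cu]] := Cpc Cu ue up.
  have [k [hk k0]] := path_lift dq cc (esym c0).
  have qk1 : q (k 1) = p by case: hk => _ ->; [|exact: II1].
  exists (k 1); rewrite qk1; split=> //.
  by rewrite -k0; exact: sheet_path_lift hk cu.
have tr := transport_weq (dom := fun u e => u (q e)) sheet_path_dom cst sheet_path_sym
  sheet_path_trans sheet_path_change move_pt.
have ta := words_lifts CU CW Ua Wa n0 Da hla.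
rewrite e0 in Ua; rewrite e1 in Wa.
have tb := words_lifts CU CW Ua Wa m0 Db hlb.
rewrite -e0 in Ua; rewrite -e1 in Wa.
have tb' : transport sheet_path (wdev U n i W) (la 0) (lb 1).
  rewrite e; apply/(tr _ _ (weq_trans (weq_sym Ha) Hb)); exact: tb.
have qa0 : q (la 0) = a 0 by case: hla => _ ->; [|exact: II0].
have ch : chain C U (rcons (mkseq i n) W) /\ last U (rcons (mkseq i n) W) = W.
  split; last by rewrite last_rcons.
  exact: (wdev_chain (@Cpoint B C) CU CW Ua Wa n0 Da).
have := transport_functional sheet_path_dom sheet_path_sym sheet_path_trans
  sheet_path_change CU ch.1 (cst U (la 0) CU _) ta tb'.
rewrite qa0 ch.2 => /(_ Ua) h.
apply: (sheet_path_functional CW h).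
by have [_ qla] := hla; have [_ qlb] := hlb; rewrite (qla _ II1) (qlb _ II1).
Qed.
End Cover.

Theorem hequiv_words a b U W : cpath a -> cpath b -> a 0 = b 0 -> a 1 = b 1 ->
  C U -> C W -> U (a 0) -> W (a 1) ->
  hequiv a b <-> exists w, mono a U W w /\ mono b U W w.
Proof.
move=> ca cb e0 e1 CU CW Ua Wa; rewrite hequivE //; split=> [/same_lifts_words [_ _ _ _ H]|].
  have [w m] := mono_exists Copen Ccover U W ca.
  have [w' m'] := mono_exists Copen Ccover U W cb.
  exists w; split=> //; apply: (mono_weq _ m'); apply: weq_sym; exact: (H U W).
move=> [w [m m']]; split=> // E q dq la lb ha hb e.
exact: (words_same_end dq ca cb e0 e1 CU CW Ua Wa m m').
Qed.
End SameLiftsWords.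

(** * The nerve as a topological space *)

Section NervePoints.
Variables (B : Type) (C : set (set B)).
Implicit Types (w : set B -> RR) (s : set (set B)) (u v : set B).

Lemma nerve_sum w s : supp w `<=` s ->
  \sum_(V \in s) w V = \sum_(V \in supp w) w V.
Proof.
move=> ws; apply/esym/fsbig_widen => // V [_]; rewrite /supp /=.
by move=> /negP; rewrite negbK => /eqP.
Qed.

Lemma nerve_pt_sum w : nerve_pt C w -> \sum_(V \in supp w) w V = 1.
Proof. by case. Qed.

Lemma nerve_pt_supp w : nerve_pt C w -> simplex C (supp w).
Proof.
move=> nw; have w1 := nerve_pt_sum nw; case: nw => wC w0 fw _ cw; split=> //.
apply: contrapT => /set0P /negP; rewrite negbK => /eqP e.
by move: w1; rewrite e fsbig_set0 => /esym /eqP; rewrite oner_eq0.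
Qed.

Lemma nerve_ptI w s : simplex C s -> supp w `<=` s -> (forall V, 0 <= w V) ->
  \sum_(V \in s) w V = 1 -> nerve_pt C w.
Proof.
move=> [fs _ sC [x xs]] ws w0 w1; split=> //.
- exact: subset_trans sC.
- exact: sub_finite_set fs.
- by rewrite -(nerve_sum ws).
- by exists x => V /ws; exact: xs.
Qed.

Lemma nerve_pt_out w s V : supp w `<=` s -> ~ s V -> w V = 0.
Proof. by move=> ws nsV; apply/eqP; apply: contra_notT nsV => h; exact: ws. Qed.

Lemma nerve_pt_le1 w V : nerve_pt C w -> w V <= 1.
Proof.
move=> nw; have w1 := nerve_pt_sum nw; case: nw => _ w0 fw _ _; have [sV|nsV] := pselect (supp w V).
  rewrite -w1 (fsbigD1 V) //= lerDl; exact: fsumr_ge0.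
by rewrite (nerve_pt_out (s := supp w) _ nsV) // ler01.
Qed.

Definition mix w w' (t : RR) : set B -> RR := fun V => (1 - t) * w V + t * w' V.

Lemma mix0 w w' : mix w w' 0 = w.
Proof. by apply/funext => V; rewrite /mix subr0 mul1r mul0r addr0. Qed.

Lemma mix1 w w' : mix w w' 1 = w'.
Proof. by apply/funext => V; rewrite /mix subrr mul1r mul0r add0r. Qed.

Lemma supp_mix s w w' t : supp w `<=` s -> supp w' `<=` s -> supp (mix w w' t) `<=` s.
Proof.
move=> ws ws' V; rewrite /supp /= => h; apply: contrapT => nsV; move: h.
by rewrite /mix (nerve_pt_out ws nsV) (nerve_pt_out ws' nsV) !mulr0 addr0 eqxx.
Qed.

Lemma nerve_pt_mix s w w' t : simplex C s -> nerve_pt C w -> nerve_pt C w' ->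
  supp w `<=` s -> supp w' `<=` s -> II t -> nerve_pt C (mix w w' t).
Proof.
move=> Ss nw nw' ws ws' /IIP [t0 t1]; have [fs _ _ _] := Ss.
have w1 := nerve_pt_sum nw; have w1' := nerve_pt_sum nw'.
case: (nw) => _ w0 _ _ _; case: (nw') => _ w0' _ _ _.
apply: (nerve_ptI Ss); first exact: supp_mix.
  by move=> V; rewrite /mix addr_ge0 // mulr_ge0 // subr_ge0.
rewrite fsbig_split // -!mulr_fsumr (nerve_sum ws) (nerve_sum ws') w1 w1' !mulr1; exact: subrK.
Qed.

Lemma supp_vertex u : supp (vertex u) = [set u].
Proof.
apply/seteqP; split=> V; rewrite /supp /vertex /=.
  by case: (V =P u) => [->|_] // /eqP; case.
by move=> ->; rewrite eqxx oner_eq0.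
Qed.

Lemma nerve_pt_vertex u : C u -> u !=set0 -> nerve_pt C (vertex u).
Proof.
move=> Cu [x ux]; apply: (@nerve_ptI _ [set u]).
- by split; [exact: finite_set1|exists u|move=> V ->|exists x => V ->].
- by rewrite supp_vertex.
- by move=> V; rewrite /vertex; case: ifP => // _; exact: ler01.
- by rewrite fsbig_set1 /vertex eqxx.
Qed.
End NervePoints.

(** The realization as a type, so that it carries a topology and the theory of words applies to it;
    [nerve_cont_within] and [nerve_lift] lead back to coordinate functions. *)
Definition nerve (B : Type) (C : set (set B)) : Type := {w : set B -> RR | nerve_pt C w}.

Section NerveTopology.
Variables (B : Type) (C : set (set B)).
Local Notation NT := (nerve C).

Definition nerve_top (O : set NT) : Prop :=
  nerve_open C [set w | exists h : nerve_pt C w, O (exist _ w h)].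

Lemma nerve_topT : nerve_top setT.
Proof. by move=> s _ w _ _ _; exists 1 => // w' nw' _ _; exists nw'. Qed.

Lemma nerve_topI : setI_closed nerve_top.
Proof.
move=> O P oO oP s Ss w nw ws [h [Oh Ph]].
have [e e0 He] := oO s Ss w nw ws (ex_intro _ h Oh).
have [d d0 Hd] := oP s Ss w nw ws (ex_intro _ h Ph).
exists (Num.min e d); first by rewrite lt_min e0 d0.
move=> w' nw' ws' cl.
have [h1 O1] : [set w | exists h : nerve_pt C w, O (exist _ w h)] w'.
  by apply: He => // V sV; have := cl V sV; rewrite lt_min => /andP [].
have [h2 P2] : [set w | exists h : nerve_pt C w, P (exist _ w h)] w'.
  by apply: Hd => // V sV; have := cl V sV; rewrite lt_min => /andP [].
by exists h1; split=> //; rewrite (Prop_irrelevance h1 h2).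
Qed.

Lemma nerve_top_bigU (I : Type) (O : I -> set NT) :
  (forall i, nerve_top (O i)) -> nerve_top (\bigcup_i O i).
Proof.
move=> oO s Ss w nw ws [h [i _ Oi]].
have [e e0 He] := oO i s Ss w nw ws (ex_intro _ h Oi).
exists e => // w' nw' ws' cl; have [h' Oi'] := He w' nw' ws' cl.
by exists h'; exists i.
Qed.

HB.instance Definition _ := gen_eqMixin NT.
HB.instance Definition _ := gen_choiceMixin NT.
HB.instance Definition _ :=
  isOpenTopological.Build NT nerve_topT nerve_topI nerve_top_bigU.
End NerveTopology.

Section NerveMaps.
Variables (B : Type) (C : set (set B)).
Local Notation NT := (nerve C).
Implicit Types (n m : NT) (s : set (set B)) (u v : set B).

Lemma nerve_topP (O : set NT) : open O <-> nerve_top O.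
Proof. by []. Qed.

Lemma nerve_inj n m : sval n = sval m -> n = m.
Proof. by case: n m => [w h] [w' h'] /= e; subst w'; congr exist; exact: Prop_irrelevance. Qed.

Lemma nerve_ball (O : set NT) s n : open O -> simplex C s -> O n -> supp (sval n) `<=` s ->
  exists2 e : RR, 0 < e & forall m, supp (sval m) `<=` s ->
    (forall V, s V -> `|sval n V - sval m V| < e) -> O m.
Proof.
move=> /nerve_topP oO Ss On ns.
have [|e e0 He] := oO s Ss (sval n) (svalP n) ns.
  by exists (svalP n); have -> : exist _ (sval n) (svalP n) = n by exact: nerve_inj.
exists e => // m ms cl.
have [h] := He (sval m) (svalP m) ms cl.
by case: m ms cl h => w h /= _ _ h'; rewrite (Prop_irrelevance h' h).
Qed.

Lemma nerve_openI (O : set NT) :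
  (forall s n, simplex C s -> supp (sval n) `<=` s -> O n ->
    exists2 e : RR, 0 < e & forall m, supp (sval m) `<=` s ->
    (forall V, s V -> `|sval n V - sval m V| < e) -> O m) -> open O.
Proof.
move=> H; apply/nerve_topP => s Ss w nw ws [h Oh].
have [e e0 He] := H s (exist _ w h) Ss ws Oh.
by exists e => // w' nw' ws' cl; exists nw'; exact: He.
Qed.

Lemma nerve_coord V : continuous (fun n : NT => sval n V).
Proof.
apply/continuousP => O oO; apply: nerve_openI => s n Ss ns On.
have [sV|nsV] := pselect (s V); last first.
  exists 1 => // m ms _; move: On; rewrite /preimage /=.
  by rewrite (nerve_pt_out ns nsV) (nerve_pt_out ms nsV).
have /nbhs_ballP [e /= e0 He] : nbhs (sval n V) O by apply: open_nbhs_nbhs.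
by exists e => // m ms cl; apply: He; exact: cl.
Qed.

(** On one closed simplex the coherent topology is Euclidean, so finitely many coordinates decide
    continuity. *)
Lemma nerve_within (X : topologicalType) (D : set X) (h : X -> NT) s :
  simplex C s -> (forall x, D x -> supp (sval (h x)) `<=` s) ->
  (forall V, s V -> {within D, continuous (fun x => sval (h x) V)}) ->
  {within D, continuous h}.
Proof.
move=> Ss hs ch; apply: nbhs_within => x O Dx oO Ox.
have [e e0 He] := nerve_ball oO Ss Ox (hs x Dx).
have [fs _ _ _] := Ss; move/finite_seqP: fs => [r rE].
have rs V : V \in r -> s V by rewrite rE.
have [N nN HN] : exists2 N, nbhs x N & forall y, N y -> D y -> forall V, V \in r ->
    `|sval (h x) V - sval (h y) V| < e.
  elim: r rs {rE} => [|V r IH] rs; first by exists setT; [exact: filterT|].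
  have [|N nN HN] := IH; first by move=> V' V'r; apply: rs; rewrite inE V'r orbT.
  have sV : s V by apply: rs; rewrite inE eqxx.
  have [M nM HM] := within_nbhs (ch V sV) Dx (@ball_open RR RR^o (sval (h x) V) e)
    (ballxx _ e0).
  exists (N `&` M); first exact: filterI.
  by move=> y [Ny My] Dy V'; rewrite inE => /orP [/eqP ->|]; [exact: HM|exact: HN].
exists N => // y Ny Dy; apply: He; first exact: hs.
by move=> V sV; apply: HN => //; move: sV; rewrite rE.
Qed.

(* Outside a common simplex the value is the junk value [n]. *)
Definition nmix n m (t : RR) : NT :=
  if pselect (nerve_pt C (mix (sval n) (sval m) t)) is left h then exist _ _ h else n.

Lemma nmixE s n m t : simplex C s -> supp (sval n) `<=` s -> supp (sval m) `<=` s -> II t ->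
  sval (nmix n m t) = mix (sval n) (sval m) t.
Proof.
move=> Ss ns ms It; rewrite /nmix; case: pselect => // nh; exfalso; apply: nh.
exact: (nerve_pt_mix Ss (svalP n) (svalP m)).
Qed.

Lemma nmix0 n m : nmix n m 0 = n.
Proof.
apply: nerve_inj; rewrite /nmix; case: pselect => //= _; exact: mix0.
Qed.

Lemma nmix1 n m : nmix n m 1 = m.
Proof.
apply: nerve_inj; rewrite /nmix; case: pselect => /= [_|]; first exact: mix1.
by rewrite mix1 => -[]; exact: svalP.
Qed.

Lemma simplex_htpy s (p r : RR -> NT) : simplex C s -> cpath p -> cpath r ->
  (forall t, II t -> supp (sval (p t)) `<=` s) -> (forall t, II t -> supp (sval (r t)) `<=` s) ->
  p 0 = r 0 -> p 1 = r 1 -> htpy p r.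
Proof.
move=> Ss cp cr ps rs e0 e1; exists (fun x => nmix (p x.1) (r x.1) x.2); split.
- have hE x : sq x -> sval (nmix (p x.1) (r x.1) x.2) = mix (sval (p x.1)) (sval (r x.1)) x.2.
    by move=> [I1 I2]; apply: (nmixE Ss) => //; [exact: ps|exact: rs].
  apply: (nerve_within Ss).
    move=> x Dx; rewrite hE //; case: Dx => I1 I2.
    by apply: supp_mix; [exact: ps|exact: rs].
  move=> V sV; apply: (within_ext (f := fun x : RR * RR =>
    (1 - x.2) * sval (p x.1) V + x.2 * sval (r x.1) V)).
    by move=> x Dx; rewrite hE.
  have cV (k : RR -> NT) : cpath k -> {within sq, continuous (fun x : RR * RR => sval (k x.1) V)}.
    move=> ck; apply: (within_comp (A := setT) (g := fun n : NT => sval n V)) => //.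
      by apply: within_of_continuous; exact: nerve_coord.
    by apply: (within_comp (A := II) _ ck); [move=> x []|wcont].
  by have cVp := cV p cp; have cVr := cV r cr; wcont.
- by move=> t _ /=; rewrite nmix0 nmix1.
- move=> t It /=; rewrite -e0 -e1.
  have same n s' : simplex C s' -> supp (sval n) `<=` s' -> nmix n n t = n.
    move=> Ss' ns; apply: nerve_inj; rewrite (nmixE Ss') //.
    by apply/funext => V; rewrite /mix -mulrDl subrK mul1r.
  by rewrite !(same _ s) //; apply: ps; [exact: II1|exact: II0].
Qed.

Definition nstar u : set NT := [set n | 0 < sval n u].

Lemma nstar_open u : open (nstar u).
Proof.
have cu : continuous (fun n : NT => sval n u) by exact: nerve_coord.
by move/continuousP: cu => /(_ [set x | 0 < x]); apply; exact: (@open_gt RR).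
Qed.

Lemma nstar_supp u n : nstar u n <-> supp (sval n) u.
Proof.
rewrite /nstar /supp /=; have [_ h _ _ _] := svalP n.
by rewrite lt0r h andbT.
Qed.

Lemma nstar_cover n : exists2 u, C u & nstar u n.
Proof.
have [_ [u su] sC _] := nerve_pt_supp (svalP n).
by exists u; [exact: sC|exact/nstar_supp].
Qed.

Lemma nstar_point n : exists b, forall u, C u -> nstar u n -> u b.
Proof.
have [_ _ _ [b Hb]] := nerve_pt_supp (svalP n).
by exists b => u _ /nstar_supp; exact: Hb.
Qed.

(** * Contraction of open stars to their vertices *)

Section Cone.
Variable u : set B.
Hypotheses (Cu : C u) (u0 : u !=set0).

Definition nvertex : NT := exist _ (vertex u) (nerve_pt_vertex Cu u0).

(** The straight contraction to the vertex [u]. A point in the open star of [u] has [u] in its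
    support, so the segment never leaves the simplex spanned by that support. *)
Definition cone n : RR -> NT := nmix n nvertex.

Lemma nvertex_supp s : s u -> supp (sval nvertex) `<=` s.
Proof. by move=> su; rewrite supp_vertex => V ->. Qed.

Lemma cone_val n t : nstar u n -> II t -> sval (cone n t) = mix (sval n) (vertex u) t.
Proof.
move=> /nstar_supp su It; apply: (nmixE (nerve_pt_supp (svalP n))) => //.
exact: nvertex_supp.
Qed.

Lemma cone_supp n t : nstar u n -> II t -> supp (sval (cone n t)) `<=` supp (sval n).
Proof.
move=> nu It; rewrite cone_val //; apply: supp_mix => //.
by rewrite supp_vertex => V ->; exact/nstar_supp.
Qed.

Lemma cone0 n : cone n 0 = n. Proof. exact: nmix0. Qed.
Lemma cone1 n : cone n 1 = nvertex. Proof. exact: nmix1. Qed.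

Lemma cone_star n t : nstar u n -> II t -> nstar u (cone n t).
Proof.
move=> nu It; rewrite /nstar /= cone_val // /mix /vertex eqxx mulr1.
move: nu; rewrite /nstar /= => nu; have /IIP [t0 t1] := It.
have := nerve_pt_le1 u (svalP n); nra.
Qed.

Lemma cpath_cone n : nstar u n -> cpath (cone n).
Proof.
move=> nu; apply: (nerve_within (nerve_pt_supp (svalP n))).
  by move=> t It; exact: cone_supp.
move=> V _.
have h : {within II, continuous (fun t : RR => (1 - t) * sval n V + t * vertex u V)} by wcont.
by apply: within_ext h => t It; rewrite cone_val.
Qed.

(* Compactness of [J] makes the radii of the neighbourhoods uniform in [t]. *)
Lemma cone_tube (O : set NT) (J : set RR) : open O -> compact J -> J `<=` II ->
  open [set n | nstar u n /\ forall t, J t -> O (cone n t)].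
Proof.
move=> oO cJ JI; apply: nerve_openI => s n Ss ns [nu nO].
have su : s u by apply: ns; exact/nstar_supp.
have cs m : nstar u m -> supp (sval m) `<=` s -> forall t, J t -> supp (sval (cone m t)) `<=` s.
  by move=> mu ms t Jt; apply: subset_trans ms; exact/cone_supp/JI.
pose P (k : nat) (t : RR) := forall m, supp (sval m) `<=` s -> nstar u m ->
  (forall V, s V -> `|sval n V - sval m V| < k.+1%:R^-1) -> J t -> O (cone m t).
have [k0 _ Hk] : \forall k \near \oo, J `<=` P k.
  apply: (iffLR (compact_near_coveringP J) cJ) => t Jt.
  have [e e0 He] := nerve_ball oO Ss (nO t Jt) (cs n nu ns t Jt).
  have h0 : 0 < e / 2 by rewrite divr_gt0.
  near=> t' k => /=.
  move=> m ms mu cl Jt'.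
  apply: He; first exact: cs.
  move=> V sV; rewrite !cone_val //; try exact: JI.
  have kle : k.+1%:R^-1 < e / 2.
    by near: k; exact: (near_infty_natSinv_lt (PosNum h0)).
  have tt' : `|t - t'| < e / 2 by near: t'; exact: nbhsx_ballx.
  have nV := nerve_pt_le1 V (svalP n); have [_ /(_ V) nV0 _ _ _] := svalP n.
  have vV : 0 <= (vertex u V : RR) <= 1.
    by rewrite /vertex; case: ifP => _; rewrite ?lexx ?ler01.
  have clV := lt_trans (cl V sV) kle.
  have /IIP [t0 t1] := JI _ Jt; have /IIP [t0' t1'] := JI _ Jt'.
  rewrite /mix.
  (* The change of the point and the change of the parameter are separated; each contributes less
     than e/2. *)
  have -> : (1 - t) * sval n V + t * vertex u V - ((1 - t') * sval m V + t' * vertex u V) =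
    (1 - t') * (sval n V - sval m V) + (t' - t) * (sval n V - vertex u V) by lra.
  have a1 : `|(1 - t') * (sval n V - sval m V)| <= `|sval n V - sval m V|.
    by rewrite normrM ler_piMl // ger0_norm; lra.
  have a2 : `|(t' - t) * (sval n V - vertex u V)| <= `|t - t'|.
    rewrite normrM distrC ler_piMr // ler_norml; have /andP [? ?] := vV.
    by apply/andP; split; lra.
  by apply: le_lt_trans (ler_normD _ _) _; lra.
have nu' : 0 < sval n u by [].
(* The first bound keeps the coordinate at [u] positive, so that [m] stays in the star. *)
exists (Num.min (sval n u) k0.+1%:R^-1); first by rewrite lt_min nu' invr_gt0 ltr0n.
move=> m ms cl.
have mu : nstar u m.
  have := cl u su; rewrite lt_min => /andP [h _].
  by move: h; rewrite /nstar /= ltr_norml => /andP [? ?]; lra.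
split=> // t Jt; apply: (Hk k0 (leqnn _) t Jt) => // V sV.
by have := cl V sV; rewrite lt_min => /andP [].
Unshelve. all: by end_near.
Qed.

(** The topology of the nerve is tested one simplex at a time, so joint continuity in the point and
    the parameter is obtained from [cone_tube], with a compact interval [J] around [t0]. *)
Lemma within_cone (g : RR -> NT) : cpath g -> (forall t, II t -> nstar u (g t)) ->
  {within sq, continuous (fun x => cone (g x.1) x.2)}.
Proof.
move=> cg gu; apply: nbhs_within => -[a t0] O [/= Ia It0] oO Oa.
have [N nN HN] := within_nbhs (cpath_cone (gu a Ia)) It0 oO Oa.
have /nbhs_ballP [e /= e0 He] := nN.
have h0 : 0 < e / 2 by rewrite divr_gt0.
pose J := `[t0 - e / 2, t0 + e / 2]%classic `&` II.
have cJ : compact J.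
  apply: (@compact_closedI RR); first exact: (@segment_compact RR).
  exact: (@interval_closed RR).
have JI : J `<=` II by move=> t [].
have aJ : nstar u (g a) /\ forall t, J t -> O (cone (g a) t).
  split; first exact: gu.
  move=> t [/=]; rewrite in_itv /= => /andP [t1 t2] It; apply: HN => //; apply: He.
  by rewrite /ball /= ltr_norml; apply/andP; split; lra.
have [M nM HM] := within_nbhs cg Ia (cone_tube oO cJ JI) aJ.
exists (M `*` ball t0 (e / 2)).
  exists (M, ball t0 (e / 2)) => //; split=> //; exact: nbhsx_ballx.
move=> [b t] [/= Mb bt] [/= Ib It].
have [_] := HM b Mb Ib; apply; split=> //=.
move: bt; rewrite /ball /= ltr_norml => /andP [h1 h2].
by rewrite in_itv /=; apply/andP; split; lra.
Qed.

(** The square with value [cone (g s) t] at [(s, t)] has bottom edge [g] and a constant top edge.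
    Its two boundary routes between opposite corners are homotopic. *)
Lemma cone_htpy (g : RR -> NT) : cpath g -> (forall t, II t -> nstar u (g t)) ->
  htpy (pcat g (cone (g 1))) (cone (g 0)).
Proof.
move=> cg gu; have HC := htpy_path_congruence NT.
pose K (x : RR * RR) := cone (g x.1) x.2.
have c0 := cpath_cone (gu 0 II0).
apply: (pc_trans HC (b := pcat (cone (g 0)) (fun=> cone (g 0) 1))); last exact: pc_pcat_cst.
have -> : pcat g (cone (g 1)) = fun t => K (pcat (fun t => (t, 0)) (fun t => (1, t)) t).
  by rewrite -pcat_comp; congr pcat; apply/funext => t; rewrite /K /= cone0.
have -> : pcat (cone (g 0)) (fun=> cone (g 0) 1) =
    fun t => K (pcat (fun t => (0, t)) (fun t => (t, 1)) t).
  by rewrite -pcat_comp; congr pcat; apply/funext => t; rewrite /K /= !cone1.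
apply: (htpy_straight convex2_sq (within_cone cg gu)).
- by apply: cpath_pcat => //; wcont.
- by apply: cpath_pcat => //; wcont.
- by apply: pcat_in => t It; split=> //; [exact: II0|exact: II1].
- by apply: pcat_in => t It; split=> //; [exact: II0|exact: II1].
- by rewrite !pcat0.
- by rewrite !pcat1.
Qed.
End Cone.
End NerveMaps.

Arguments cpath_cone {B C u} Cu u0 {n}.

(** * Words and homotopies in the nerve *)

Section NerveSheets.
Variables (B : Type) (C : set (set B)).
Local Notation NT := (nerve C).
Implicit Types (n m : NT) (s : set (set B)) (u v : set B).
Local Notation HC := (htpy_path_congruence NT).

Lemma nstar_C u n : nstar u n -> C u /\ u !=set0.
Proof.
move=> /nstar_supp su; have [_ _ sC [b Hb]] := nerve_pt_supp (svalP n).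
by split; [exact: sC|exists b; exact: Hb].
Qed.

Lemma nmix_supp s n m t : simplex C s -> supp (sval n) `<=` s -> supp (sval m) `<=` s ->
  II t -> supp (sval (nmix n m t)) `<=` s.
Proof. by move=> Ss ns ms It; rewrite (nmixE Ss) //; exact: supp_mix. Qed.

Lemma cpath_nmix s n m : simplex C s -> supp (sval n) `<=` s -> supp (sval m) `<=` s ->
  cpath (nmix n m).
Proof.
move=> Ss ns ms; apply: (nerve_within Ss).
  by move=> t It; exact: nmix_supp.
move=> V _.
have h : {within II, continuous (fun t : RR => (1 - t) * sval n V + t * sval m V)} by wcont.
by apply: within_ext h => t It; rewrite (nmixE Ss).
Qed.

(** The triangle spanned by [n] and the two vertices lies in the simplex of the support of [n]. *)
Lemma cone_edge u v (Cu : C u) (u0 : u !=set0) (Cv : C v) (v0 : v !=set0) n :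
  nstar u n -> nstar v n ->
  htpy (pcat (cone Cu u0 n) (nmix (nvertex Cu u0) (nvertex Cv v0))) (cone Cv v0 n).
Proof.
move=> nu nv; have Ss := nerve_pt_supp (svalP n).
have su : supp (sval (nvertex Cu u0)) `<=` supp (sval n) by apply: nvertex_supp; exact/nstar_supp.
have sv : supp (sval (nvertex Cv v0)) `<=` supp (sval n) by apply: nvertex_supp; exact/nstar_supp.
apply: (simplex_htpy Ss).
- apply: cpath_pcat; [exact: cpath_cone|exact: cpath_nmix Ss su sv|by rewrite cone1 nmix0].
- exact: cpath_cone.
- apply: (pcat_in (A := fun m => supp (sval m) `<=` supp (sval n))).
    by move=> t It; exact: cone_supp.
  by move=> t It; exact: nmix_supp.
- by move=> t It; exact: cone_supp.
- by rewrite pcat0 !cone0.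
- by rewrite pcat1 nmix1 cone1.
Qed.

(** The point has weights 1/4, 1/4, 1/2 at [u], [v], [x]. These letters may coincide, hence the
    estimates by nonnegativity instead of exact coordinates. *)
Lemma nstar_meet u v x b : C u -> C v -> C x -> u b -> v b -> x b ->
  exists n, [/\ nstar u n, nstar v n & nstar x n].
Proof.
move=> Cu Cv Cx ub vb xb.
pose s := [set u] `|` [set v] `|` [set x].
have Ss : simplex C s.
  split.
  - by rewrite /s !finite_setU; split; [split|]; exact: finite_set1.
  - by exists u; left; left.
  - by move=> V [[->|->]|->].
  - by exists b => V [[->|->]|->].
have u0 : u !=set0 by exists b. have v0 : v !=set0 by exists b. have x0 : x !=set0 by exists b.
have I2 : II 2^-1 by apply/IIP; split; lra.
have su : supp (sval (nvertex Cu u0)) `<=` s by apply: nvertex_supp; left; left.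
have sv : supp (sval (nvertex Cv v0)) `<=` s by apply: nvertex_supp; left; right.
have sx : supp (sval (nvertex Cx x0)) `<=` s by apply: nvertex_supp; right.
pose m := nmix (nvertex Cu u0) (nvertex Cv v0) 2^-1.
have sm : supp (sval m) `<=` s by exact: nmix_supp.
exists (nmix m (nvertex Cx x0) 2^-1).
have vge (V W : set B) : 0 <= (vertex V W : RR) by rewrite /vertex; case: ifP.
have v1 (V : set B) : (vertex V V : RR) = 1 by rewrite /vertex eqxx.
have E V : sval (nmix m (nvertex Cx x0) 2^-1) V =
    2^-1 * (2^-1 * vertex u V + 2^-1 * vertex v V) + 2^-1 * vertex x V.
  by rewrite (nmixE Ss) // /mix (nmixE Ss) // /mix /=; lra.
split; rewrite /nstar /= E v1.
- by have := vge v u; have := vge x u; lra.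
- by have := vge u v; have := vge x v; lra.
- by have := vge u x; have := vge v x; lra.
Qed.

Lemma nstar_path_connected u n m : C u -> nstar u n -> nstar u m ->
  exists a : RR -> NT, [/\ cpath a, a 0 = n, a 1 = m & forall t, II t -> nstar u (a t)].
Proof.
move=> Cu nu mu; have [_ u0] := nstar_C nu.
exists (pcat (cone Cu u0 n) (prev (cone Cu u0 m))); split.
- apply: cpath_pcat; [exact: cpath_cone|apply: cpath_prev; exact: cpath_cone|].
  by rewrite prev0 !cone1.
- by rewrite pcat0 cone0.
- by rewrite pcat1 prev1 cone0.
- apply: pcat_in => t It; first exact: cone_star.
  by apply: cone_star => //; exact: prev_II.
Qed.

Variable n0 : NT.

(** Paths from [n0] play the role of points of the universal covering of the nerve, lying over their
    ends. Two of them are on one sheet over the star of [u] when, continued by the cones to the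
    vertex [u], they become homotopic. *)
Definition nerve_dom u (a : RR -> NT) := [/\ cpath a, a 0 = n0 & nstar u (a 1)].

Definition nerve_sheet u (a b : RR -> NT) := [/\ nerve_dom u a, nerve_dom u b &
  forall (Cu : C u) (u0 : u !=set0),
    htpy (pcat a (cone Cu u0 (a 1))) (pcat b (cone Cu u0 (b 1)))].

Lemma nerve_sheet_dom u a b : nerve_sheet u a b -> nerve_dom u a.
Proof. by case. Qed.

Lemma cpath_dom u a (Cu : C u) (u0 : u !=set0) : nerve_dom u a -> cpath (pcat a (cone Cu u0 (a 1))).
Proof.
by move=> [ca _ au]; apply: cpath_pcat => //; [exact: cpath_cone|rewrite cone0].
Qed.

Local Arguments cpath_dom {u a} Cu u0.

Lemma nerve_sheet_refl u a : C u -> nerve_dom u a -> nerve_sheet u a a.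
Proof. by move=> _ da; split=> // Cu u0; apply: (pc_refl HC); exact: cpath_dom. Qed.

Lemma nerve_sheet_sym u a b : nerve_sheet u a b -> nerve_sheet u b a.
Proof. by move=> [da db h]; split=> // Cu u0; exact: (pc_sym HC). Qed.

Lemma nerve_sheet_trans u a b c : nerve_sheet u a b -> nerve_sheet u b c -> nerve_sheet u a c.
Proof.
by move=> [da _ h] [_ dc k]; split=> // Cu u0; exact: (pc_trans HC (h Cu u0) (k Cu u0)).
Qed.

(** Passing from [u] to [v] appends the edge between the two vertices. That edge is the same for
    every path, which is why sheets over two stars match. *)
Lemma cone_change u v (Cu : C u) (u0 : u !=set0) (Cv : C v) (v0 : v !=set0) a : nerve_dom u a -> nerve_dom v a ->
  htpy (pcat a (cone Cv v0 (a 1)))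
    (pcat (pcat a (cone Cu u0 (a 1))) (nmix (nvertex Cu u0) (nvertex Cv v0))).
Proof.
move=> [ca _ au] [_ _ av]; have Ss := nerve_pt_supp (svalP (a 1)).
have cu := cpath_cone Cu u0 au; have cv := cpath_cone Cv v0 av.
have ce : cpath (nmix (nvertex Cu u0) (nvertex Cv v0)).
  by apply: (cpath_nmix Ss); apply: nvertex_supp; exact/nstar_supp.
apply: (pc_trans HC (b := pcat a (pcat (cone Cu u0 (a 1)) (nmix (nvertex Cu u0) (nvertex Cv v0))))).
  apply: (pc_pcat HC); [exact: (pc_refl HC)| |by rewrite cone0].
  by apply: (pc_sym HC); exact: cone_edge.
by apply: (pc_sym HC); apply: (pc_assoc HC) => //; [rewrite cone0|rewrite cone1 nmix0].
Qed.

Lemma nerve_sheet_change u v a b : C u -> C v -> nerve_sheet u a b ->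
  nerve_dom v a -> nerve_dom v b -> nerve_sheet v a b.
Proof.
move=> Cu _ [dua dub h] dva dvb; split=> // Cv v0.
have [_ _ au] := dua; have [_ u0] := nstar_C au.
apply: (pc_trans HC (cone_change Cu u0 Cv v0 dua dva)).
apply: (pc_trans HC _ (pc_sym HC (cone_change Cu u0 Cv v0 dub dvb))).
apply: (pc_pcat HC (h Cu u0)); last by rewrite pcat1 cone1 nmix0.
apply: (pc_refl HC); apply: (cpath_nmix (nerve_pt_supp (svalP (a 1)))); apply: nvertex_supp; apply/nstar_supp => //.
by have [_ _] := dva.
Qed.

Lemma nerve_sheet_move u v x a b : C u -> C v -> C x -> u b -> v b -> x b -> nerve_dom u a ->
  exists a', [/\ nerve_sheet u a a', nerve_dom v a' & nerve_dom x a'].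
Proof.
move=> Cu Cv Cx ub vb xb da; have [ca a0 au] := da.
have [z [zu zv zx]] := nstar_meet Cu Cv Cx ub vb xb.
have u0 : u !=set0 by exists b.
(* [a] is continued to the vertex [u] and out again to the point [z] common to the three stars. *)
pose a' := pcat (pcat a (cone Cu u0 (a 1))) (prev (cone Cu u0 z)).
have cz := cpath_cone Cu u0 zu; have cpz := cpath_prev cz.
have caa := cpath_dom Cu u0 da.
have j : pcat a (cone Cu u0 (a 1)) 1 = prev (cone Cu u0 z) 0 by rewrite pcat1 prev0 !cone1.
have ca' : cpath a' by exact: cpath_pcat.
have a'0 : a' 0 = n0 by rewrite /a' !pcat0.
have a'1 : a' 1 = z by rewrite /a' pcat1 prev1 cone0.
have da' : nerve_dom u a' by split=> //; rewrite a'1.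
exists a'; split; [|by split=> //; rewrite a'1|by split=> //; rewrite a'1].
split=> // Cu' u0'; rewrite (Prop_irrelevance Cu' Cu) (Prop_irrelevance u0' u0) a'1.
apply: (pc_sym HC); apply: (pc_trans HC (pc_assoc HC caa cpz cz j _)); first by rewrite prev1.
apply: (pc_trans HC _ (pc_pcat_cst HC caa)).
apply: (pc_pcat HC); [exact: (pc_refl HC)| |by rewrite pcat0].
by rewrite j prev0; exact: (pc_prev_pcat HC).
Qed.

Lemma nerve_sheet_functional u a b : nerve_sheet u a b -> a 1 = b 1 -> htpy a b.
Proof.
move=> [[ca a0 au] [cb b0' bu] h] e; have [Cu u0] := nstar_C au.
have cc := cpath_cone Cu u0 au.
have step c : cpath c -> c 1 = a 1 ->
    htpy (pcat (pcat c (cone Cu u0 (a 1))) (prev (cone Cu u0 (a 1)))) c.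
  move=> ck e1.
  apply: (pc_trans HC (pc_assoc HC ck cc (cpath_prev cc) _ _)); rewrite ?cone0 ?prev0 //.
  apply: (pc_trans HC _ (pc_pcat_cst HC ck)).
  apply: (pc_pcat HC); [exact: (pc_refl HC)| |by rewrite pcat0 cone0].
  by rewrite e1 -[in X in htpy _ X](cone0 Cu u0 (a 1)); exact: (pc_pcat_prev HC).
apply: (pc_trans HC (pc_sym HC (step a ca erefl))).
apply: (pc_trans HC _ (step b cb (esym e))).
apply: (pc_pcat HC); [by have := h Cu u0; rewrite -e|exact: (pc_refl HC (cpath_prev cc))|].
by rewrite pcat1 prev0.
Qed.

Local Notation devs := (devs C (fun u => @nstar B C u)).
Local Notation mono := (mono C (fun u => @nstar B C u)).

(** The elements transported are the initial parts [al j] of [g]. Consecutive ones differ by a piece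
    inside one star, which [cone_htpy] slides into the cone. The start is the initial part of length
    zero, hence the form [g (0 * t)]. *)
Lemma nerve_words_transport U W k i (g : RR -> NT) : cpath g -> g 0 = n0 ->
  C U -> C W -> nstar U (g 0) -> nstar W (g 1) -> (0 < k)%N -> devs k i g ->
  transport nerve_sheet (wdev U k i W) (fun t => g (0 * t)) g.
Proof.
move=> cg g0 CU CW Ug Wg k0 D.
have k0' : 0 < k%:R :> RR by rewrite ltr0n.
pose al (j : nat) t := g (j%:R / k%:R * t).
have al0 : (fun t => g (0 * t)) = al 0%N by apply/funext => t; rewrite /al !mul0r.
have al1 : g = al k.
  by apply/funext => t; rewrite /al divff ?mul1r // pnatr_eq0 -lt0n.
rewrite al0 [X in transport _ _ _ X]al1.
have cal j : (j <= k)%N -> cpath (al j) by move=> jk; apply: cpath_scale => //; exact: grid_II.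
have doms j u : (j <= k)%N -> nstar u (g (j%:R / k%:R)) -> nerve_dom u (al j).
  move=> jk h; split; [exact: cal|by rewrite /al mulr0|by rewrite /al mulr1].
apply: (transport_wdev (e := al)).
- by apply: nerve_sheet_refl => //; apply: doms => //; rewrite mul0r.
- by apply: nerve_sheet_refl => //; apply: doms => //; rewrite divff // pnatr_eq0 -lt0n.
move=> j jk; have [Cj Hj] := D j jk.
have [_ j0 j1] := devs_points k0 D jk.
have d0 := doms j (i j) (ltnW jk) j0; have d1 := doms j.+1 (i j) jk j1.
split=> // Cu u0.
pose p (t : RR) := (j%:R + t) / k%:R.
have kp t : k%:R * p t = j%:R + t by rewrite /p mulrC divfK // gt_eqF.
have pI t : II t -> II (p t).
  move=> /IIP [t0 t1]; apply/IIP; split; first by rewrite /p divr_ge0 // addr_ge0 ?ler0n.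
  rewrite /p ler_pdivrMr // mul1r; apply: (@le_trans _ _ j.+1%:R); last by rewrite ler_nat.
  by rewrite -natr1 lerD2l.
have cp : cpath p by rewrite /p; wcont.
have cgp : cpath (fun t => g (p t)) by exact: cpath_comp.
have pe0 : p 0 = j%:R / k%:R by rewrite /p addr0.
have pe1 : p 1 = j.+1%:R / k%:R by rewrite /p natr1.
have gpu t : II t -> nstar (i j) (g (p t)).
  move=> It; apply: Hj; first exact: pI.
  by have /IIP [? ?] := It; rewrite kp -natr1; apply/andP; split; lra.
have [c1 _ u1] := d1.
have e1 : al j.+1 1 = g (p 1) by rewrite /al mulr1 pe1.
have e0 : al j 1 = g (p 0) by rewrite /al mulr1 pe0.
have cl := cpath_cone Cu u0 u1.
have split1 : htpy (al j.+1) (pcat (al j) (fun t => g (p t))).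
  rewrite /al (pcat_comp g (fun t => j%:R / k%:R * t) p).
  apply: (pc_reparam HC) => //.
  - by wcont.
  - by apply: cpath_pcat => //; [wcont|rewrite mulr1 pe0].
  - move=> t It; have /IIP [x0 x1] := grid_II k0 jk; have /IIP [t0 t1] := It.
    by apply/IIP; split; nra.
  - apply: pcat_in => // t It.
    have /IIP [x0 x1] := grid_II k0 (ltnW jk); have /IIP [t0 t1] := It.
    by apply/IIP; split; nra.
  - by rewrite pcat0 !mulr0.
  - by rewrite pcat1 mulr1 pe1.
apply: (pc_sym HC).
apply: (pc_trans HC (b := pcat (pcat (al j) (fun t => g (p t))) (cone Cu u0 (al j.+1 1)))).
  by apply: (pc_pcat HC split1); [exact: (pc_refl HC)|rewrite cone0].
apply: (pc_trans HC (pc_assoc HC _ cgp cl _ _)).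
- exact: cal (ltnW jk).
- by rewrite e0.
- by rewrite e1 cone0.
apply: (pc_pcat HC); [apply: (pc_refl HC); exact: cal (ltnW jk)| |by rewrite pcat0 e0].
by rewrite e1 e0; exact: (cone_htpy Cu u0 cgp gpu).
Qed.

Lemma nerve_words_htpy U W w (g g' : RR -> NT) : cpath g -> cpath g' ->
  g 0 = n0 -> g' 0 = n0 -> g 1 = g' 1 -> C U -> C W -> nstar U (g 0) -> nstar W (g 1) ->
  mono g U W w -> mono g' U W w -> htpy g g'.
Proof.
move=> cg cg' g0 g0' e CU CW Ug Wg [k [i [k0 D H]]] [k' [i' [k0' D' H']]].
have t := nerve_words_transport cg g0 CU CW Ug Wg k0 D.
have Ug' : nstar U (g' 0) by rewrite g0' -g0.
have Wg' : nstar W (g' 1) by rewrite -e.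
have t' := nerve_words_transport cg' g0' CU CW Ug' Wg' k0' D'.
have tr := transport_weq nerve_sheet_dom nerve_sheet_refl nerve_sheet_sym
  nerve_sheet_trans nerve_sheet_change nerve_sheet_move.
have cE : (fun t => g (0 * t)) = (fun t => g' (0 * t)).
  by apply/funext => s; rewrite !mul0r g0 g0'.
have t2 : transport nerve_sheet (wdev U k i W) (fun t => g (0 * t)) g'.
  by rewrite cE; apply/(tr _ _ (weq_trans (weq_sym H) H')).
have ch := wdev_chain (@nstar_point B C) CU CW Ug Wg k0 D.
have dU : nerve_dom U (fun t => g (0 * t)).
  by split; rewrite ?mul0r //; apply: cpath_scale => //; exact: II0.
have := transport_functional nerve_sheet_dom nerve_sheet_sym nerve_sheet_trans
  nerve_sheet_change CU ch (nerve_sheet_refl CU dU) t t2.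
by rewrite last_rcons => /nerve_sheet_functional; apply.
Qed.
End NerveSheets.

(** * Coordinate functions and maps into the nerve *)

Section NerveConversion.
Variables (B : Type) (C : set (set B)).
Local Notation NT := (nerve C).

Lemma nerve_cont_within (X : topologicalType) (D : set X) (h : X -> NT) (g : X -> set B -> RR) :
  (forall x, D x -> sval (h x) = g x) -> nerve_cont C D g <-> {within D, continuous h}.
Proof.
move=> hg; split=> [[ng cg]|ch].
  apply/withinP => O oO.
  have := cg _ (iffLR (nerve_topP O) oO); congr rel_open.
  apply/seteqP; split=> x /= [Dx]; rewrite -hg //.
    by move=> [k Ok]; split=> //; have <- : exist _ _ k = h x by exact: nerve_inj.
  by move=> Oh; split=> //; exists (svalP (h x)); have -> : exist _ _ (svalP (h x)) = h x by exact: nerve_inj.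
split=> [x Dx|O oO]; first by rewrite -hg //; exact: svalP.
have oO' : open [set n : NT | O (sval n)].
  apply/nerve_topP => s Ss w nw ws [k0 Ow].
  have [e e0 He] := oO s Ss w nw ws Ow.
  by exists e => // w' nw' ws' cl; exists nw'; exact: He.
have := iffLR (withinP _ _) ch _ oO'; congr rel_open.
by apply/seteqP; split=> x /= [Dx]; rewrite hg.
Qed.

Lemma nerve_lift (X : Type) (n0 : NT) (D : set X) (g : X -> set B -> RR) :
  (forall x, D x -> nerve_pt C (g x)) -> exists h : X -> NT, forall x, D x -> sval (h x) = g x.
Proof.
move=> ng; exists (fun x => if pselect (nerve_pt C (g x)) is left k then exist _ _ k else n0).
by move=> x Dx; case: pselect => //= nk; exfalso; apply: nk; exact: ng.
Qed.

Lemma nerve_homotopicE (n0 : NT) (g g' : RR -> NT) a b :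
  (forall t, II t -> sval (g t) = a t) -> (forall t, II t -> sval (g' t) = b t) ->
  g 0 = n0 -> g 1 = n0 -> nerve_homotopic C (sval n0) a b <-> htpy g g'.
Proof.
move=> ga gb e0 e1; split=> [[h [ch h1 h2]]|[h [ch h1 h2]]].
  have [k Hk] := nerve_lift n0 ch.1.
  exists k; split.
  - exact/(nerve_cont_within Hk).
  - move=> s Is; have [k1 k2] := h1 s Is; split; apply: nerve_inj.
      by rewrite Hk ?k1 ?ga //; split=> //; exact: II0.
    by rewrite Hk ?k2 ?gb //; split=> //; exact: II1.
  - move=> t It; have [k1 k2] := h2 t It; split; apply: nerve_inj.
      by rewrite Hk ?k1 ?e0 //; split=> //; exact: II0.
    by rewrite Hk ?k2 ?e1 //; split=> //; exact: II1.
exists (fun x => sval (h x)); split.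
- exact/(nerve_cont_within (h := h)).
- by move=> s Is; have [-> ->] := h1 s Is; rewrite ga ?gb.
- by move=> t It; have [-> ->] := h2 t It; rewrite e0 e1.
Qed.
End NerveConversion.

(** * Comparison of the two groups *)

Section Comparison.
Variables (B : topologicalType) (C : set (set B)).
Hypothesis Copen : forall u, C u -> open u.
Hypothesis Ccover : forall x : B, exists2 u, C u & u x.
Hypothesis Cpc : forall u, C u -> path_connected_set u.
Hypothesis Cstar : forall (x : B) (a : RR -> B), is_loop x a ->
  (forall t, II t -> star x C (a t)) -> same_lifts a (fun=> x).

Variables (b0 xV : B) (V U0 : set B) (delta : RR -> B).
Hypotheses (CV : C V) (Vx : V xV) (CU0 : C U0) (U0b : U0 b0).
Hypotheses (cdelta : cpath delta) (delta0 : delta 0 = xV) (delta1 : delta 1 = b0).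

Local Notation NT := (nerve C).
Local Notation weq := (weq C).
Local Notation monoB := (mono C (fun u : set B => u)).
Local Notation monoN := (mono C (fun u => @nstar B C u)).

Let V0 : V !=set0. Proof. by exists xV. Qed.
Let v : NT := nvertex CV V0.

Let nstar_v : nstar V v.
Proof. by rewrite /nstar /= /vertex eqxx ltr01. Qed.

Let nstar_meet2 u w : C u -> C w -> (exists b, u b /\ w b) ->
  exists n : NT, nstar u n /\ nstar w n.
Proof.
move=> Cu Cw [b [ub wb]].
by have [n [nu nw _]] := nstar_meet Cu Cw Cw ub wb wb; exists n.
Qed.

(** The words of [delta] and of its reverse; the products in both orders develop null-homotopic
    loops. *)
Lemma words_connect : exists d d', [/\ chain C V d /\ last V d = U0,
  chain C U0 d' /\ last U0 d' = V,
  weq ((V :: d) ++ U0 :: d') [:: V] & weq ((U0 :: d') ++ V :: d) [:: U0]].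
Proof.
have HC := htpy_path_congruence B.
have cp := cpath_prev cdelta.
have [||d [md hd ld]] := mono_chain Copen Ccover (@Cpoint B C) cdelta CV CU0.
- by rewrite delta0.
- by rewrite delta1.
have [||d' [md' hd' ld']] := mono_chain Copen Ccover (@Cpoint B C) cp CU0 CV.
- by rewrite prev0 delta1.
- by rewrite prev1 delta0.
have cst (u : set B) (x : B) : C u -> u x -> monoB (fun=> x) u u [:: u].
  by move=> Cu ux; apply: mono_in => //; exact: within_cst.
exists d, d'; split=> //.
- have m : monoB (pcat delta (prev delta)) V V ((V :: d) ++ U0 :: d').
    by apply: (mono_pcat (@Cpoint B C) CU0 _ _ md md'); rewrite ?prev0 ?delta1.
  apply: (mono_htpy Copen Ccover (@Cpoint B C) (pc_pcat_prev HC cdelta) CV CV _ _ m).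
  + by rewrite pcat0 delta0.
  + by rewrite pcat1 prev1 delta0.
  + by rewrite delta0; exact: cst.
- have m : monoB (pcat (prev delta) delta) U0 U0 ((U0 :: d') ++ V :: d).
    by apply: (mono_pcat (@Cpoint B C) CV _ _ md' md); rewrite ?prev1 ?delta0.
  apply: (mono_htpy Copen Ccover (@Cpoint B C) (pc_prev_pcat HC cdelta) CU0 CU0 _ _ m).
  + by rewrite pcat0 prev0 delta1.
  + by rewrite pcat1 delta1.
  + by rewrite delta1; exact: cst.
Qed.

Theorem hedgehog_group_nerve : loop_group_iso (is_loop b0) (@hequiv B)
  (nerve_loop C (vertex V)) (nerve_homotopic C (vertex V)).
Proof.
have [d [d' [[chd ld] [chd' ld'] dd' d'd]]] := words_connect.
(* Words of loops at [b0] begin and end with [U0]; conjugation turns them into words at the vertex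
   [V]. *)
pose conjw w := (V :: d) ++ w ++ U0 :: d'.
(* [phi] will choose, for each loop, a loop in the nerve that realizes the conjugated word. *)
pose dual (a : RR -> B) (c : RR -> set B -> RR) := exists w (g : RR -> NT),
  [/\ monoB a U0 U0 w, cpath g, g 0 = v /\ g 1 = v,
      forall t, II t -> sval (g t) = c t & monoN g V V (conjw w)].
have chain_conj w : chain C U0 w -> last U0 w = U0 ->
    chain C V (d ++ (U0 :: w) ++ U0 :: d') /\ last V (d ++ (U0 :: w) ++ U0 :: d') = V.
  move=> cw lw; have UU : exists b, U0 b /\ U0 b by exists b0.
  split; last by rewrite last_cat ld /= last_cat lw.
  by apply/chain_cat; split=> //=; rewrite ld; split=> //; apply/chain_cat; rewrite lw.
have absorb a w : monoB a U0 U0 w -> weq ([:: U0] ++ w ++ [:: U0]) w.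
  move=> m; exact: (weq_trans (weq_catl [:: U0] (weq_mono_last m)) (weq_mono_head m)).
have conjK a w : monoB a U0 U0 w -> weq ((U0 :: d') ++ conjw w ++ (V :: d)) w.
  move=> m; apply: weq_trans _ (absorb a w m).
  rewrite /conjw -!catA catA; apply: weq_cat => //.
  by apply: weq_catl.
have conj_inj a b w w' : monoB a U0 U0 w -> monoB b U0 U0 w' ->
    weq w w' <-> weq (conjw w) (conjw w').
  move=> m m'; split=> h; first by apply: weq_catl; exact: weq_catr.
  apply: weq_trans (weq_sym (conjK a w m)) (weq_trans _ (conjK b w' m')).
  by apply: weq_catl; exact: weq_catr.
have loop_cpath a : is_loop b0 a -> [/\ cpath a, U0 (a 0) & U0 (a 1)].
  by move=> [ca [-> ->]].
have uniqB a w w' : is_loop b0 a -> monoB a U0 U0 w -> monoB a U0 U0 w' -> weq w w'.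
  move=> /loop_cpath [ca u0 u1].
  exact: (mono_unique Copen Ccover (@Cpoint B C) ca CU0 CU0 u0 u1).
have dual_exists a : exists c, is_loop b0 a -> dual a c.
  (* For functions that are not loops the value is arbitrary. *)
  have [la|nla] := pselect (is_loop b0 a); last by exists (fun=> vertex V).
  have [ca u0 u1] := loop_cpath a la.
  have [w [mw cw lw]] := mono_chain Copen Ccover (@Cpoint B C) ca CU0 CU0 u0 u1.
  have [chw lcw] := chain_conj w cw lw.
  have [|g [cg g0 g1 mg]] := mono_realize (y := v) (@nstar_point B C)
    (@nstar_path_connected B C) nstar_meet2 CV nstar_v chw.
    by rewrite lcw.
  rewrite lcw in mg.
  by exists (fun t => sval (g t)) => _; exists (U0 :: w), g.
have /choice [phi Hphi] := dual_exists.
have hom_words c e wa wb (ga gb : RR -> NT) : cpath ga -> cpath gb ->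
    ga 0 = v /\ ga 1 = v -> gb 0 = v /\ gb 1 = v ->
    (forall t, II t -> sval (ga t) = c t) -> (forall t, II t -> sval (gb t) = e t) ->
    monoN ga V V wa -> monoN gb V V wb ->
    nerve_homotopic C (vertex V) c e <-> weq wa wb.
  move=> cga cgb [a0 a1] [b0' b1] ac be ma mb.
  rewrite -[vertex V]/(sval v) (nerve_homotopicE ac be a0 a1); split=> h.
    apply: (mono_htpy (fun u _ => @nstar_open B C u) (@nstar_cover B C) (@nstar_point B C) h CV CV) => //.
      by rewrite a0.
    by rewrite a1.
  apply: (@nerve_words_htpy B C v V V wb) => //; try by rewrite ?a0 ?a1 ?b1.
  exact: mono_weq ma.
exists phi; split.
- move=> a la; have [w [g [_ cg [g0 g1] gphi _]]] := Hphi a la.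
  split; first exact/(nerve_cont_within gphi).
  by rewrite -(gphi 0 II0) -(gphi 1 II1) g0 g1.
- move=> a b la lb.
  have [wa [ga [ma cga ea gpa mga]]] := Hphi a la.
  have [wb [gb [mb cgb eb gpb mgb]]] := Hphi b lb.
  rewrite (hom_words _ _ _ _ _ _ cga cgb ea eb gpa gpb mga mgb).
  rewrite -(conj_inj a b wa wb ma mb).
  have [ca ua0 ua1] := loop_cpath a la; have [cb ub0 ub1] := loop_cpath b lb.
  have [_ [a0 a1]] := la; have [_ [b0' b1]] := lb.
  rewrite (hequiv_words Copen Ccover Cpc Cstar ca cb _ _ CU0 CU0 ua0 ua1) ?a0 ?a1 //.
  split=> [[w [m m']]|h].
    exact: weq_trans (uniqB a _ _ la ma m) (uniqB b _ _ lb m' mb).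
  by exists wa; split=> //; apply: mono_weq mb; exact: weq_sym.
- move=> c [nc [c0 c1]].
  have [g Hg] := nerve_lift v nc.1.
  have cg : cpath g by exact/(nerve_cont_within Hg).
  have g0 : g 0 = v by apply: nerve_inj; rewrite (Hg 0 II0) c0.
  have g1 : g 1 = v by apply: nerve_inj; rewrite (Hg 1 II1) c1.
  have [||w [mw chw lw]] := mono_chain (fun u _ => @nstar_open B C u) (@nstar_cover B C) (@nstar_point B C) cg CV CV.
  + by rewrite g0.
  + by rewrite g1.
  have VV : exists b, V b /\ V b by exists xV.
  (* The inverse conjugation gives an edge path from [U0] to itself, which is realized in [B] by a
     loop at [b0]. *)
  have ch : chain C U0 (d' ++ (V :: w) ++ V :: d).
    by apply/chain_cat; split=> //=; rewrite ld'; split=> //; apply/chain_cat; rewrite lw.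
  have lch : last U0 (d' ++ (V :: w) ++ V :: d) = U0 by rewrite last_cat ld' /= last_cat lw.
  have Bpc u x y : C u -> u x -> u y ->
      exists k : RR -> B, [/\ cpath k, k 0 = x, k 1 = y & forall t, II t -> u (k t)].
    by move=> Cu ux uy; have [k [[ck [k0 k1]] ku]] := Cpc Cu ux uy; exists k.
  have [|a [ca a0 a1 ma]] := mono_realize (y := b0) (@Cpoint B C) Bpc
    (fun u u' _ _ h => h) CU0 U0b ch; first by rewrite lch.
  rewrite lch in ma.
  have la : is_loop b0 a by [].
  exists a => //.
  have [wa [ga [ma' cga ea gpa mga]]] := Hphi a la.
  rewrite (hom_words _ _ _ _ _ _ cga cg ea (conj g0 g1) gpa Hg mga mw).
  have h1 := uniqB a _ _ la ma' ma.
  apply: (weq_trans (w' := conjw ((U0 :: d') ++ (V :: w) ++ V :: d))).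
    by apply: weq_catl; exact: weq_catr.
  rewrite /conjw -!catA catA.
  apply: (weq_trans (w' := [:: V] ++ (V :: w) ++ [:: V])).
    by apply: weq_cat => //; apply: weq_catl.
  exact: (weq_trans (weq_catl [:: V] (weq_mono_last mw)) (weq_mono_head mw)).
- move=> a b la lb.
  have [ca [a0 a1]] := la; have [cb [b0' b1]] := lb.
  have lab : is_loop b0 (pcat a b).
    by split; [apply: cpath_pcat => //; rewrite a1|rewrite pcat0 pcat1].
  have [wa [ga [ma cga ea gpa mga]]] := Hphi a la.
  have [wb [gb [mb cgb eb gpb mgb]]] := Hphi b lb.
  have [w [g [m cg e gp mg]]] := Hphi _ lab.
  have [ga0 ga1] := ea; have [gb0 gb1] := eb.
  have mab := mono_pcat (@Cpoint B C) CU0 _ _ ma mb.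
  rewrite a1 b0' in mab; have {}mab := mab U0b erefl.
  have mgab := mono_pcat (@nstar_point B C) CV _ _ mga mgb.
  rewrite ga1 gb0 in mgab; have {}mgab := mgab nstar_v erefl.
  have cgab : cpath (pcat ga gb) by apply: cpath_pcat => //; rewrite ga1.
  have gpab t : II t -> sval (pcat ga gb t) = pcat (phi a) (phi b) t.
    move=> /IIP [t0 t1]; rewrite /pcat; case: ifPn => h.
      by apply: gpa; apply/IIP; split; lra.
    by rewrite -ltNge in h; apply: gpb; apply/IIP; split; lra.
  have eab : pcat ga gb 0 = v /\ pcat ga gb 1 = v by rewrite pcat0 pcat1.
  rewrite (hom_words _ _ _ _ _ _ cg cgab e eab gp gpab mg mgab).
  have h1 := uniqB _ _ _ lab m mab.
  apply: (weq_trans (w' := conjw (wa ++ wb))).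
    by apply: weq_catl; exact: weq_catr.
  rewrite /conjw -!catA; do 2 apply: weq_catl.
  (* Between [wa] and [wb] the product contains [U0 :: d'] followed by [V :: d], which collapses to
     the letter [U0] and is absorbed by [wb]. *)
  rewrite catA; apply: weq_sym; apply: (weq_trans (w' := [:: U0] ++ wb ++ U0 :: d')).
    exact: weq_catr.
  exact: weq_catr (weq_mono_head mb).
Qed.
End Comparison.

(** Triviality of the homomorphism induced by a star is expressed on representatives: a loop at [x]
    inside the star is equivalent in [B] to the constant loop. The nonempty members of the cover are
    the vertices of the nerve, and any of them may be the base point there. *)
Theorem theorem7p5 (B : topologicalType) (C : set (set B)) :
  path_connected_space B -> paracompact B ->
  open_cover C -> (forall U, C U -> path_connected_set U) ->
  (forall (x : B) (a : RR -> B), is_loop x a ->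
     (forall t, unit_interval t -> star x C (a t)) ->
     hequiv a (fun _ => x)) ->
  forall (b0 : B) (V : set B), C V -> V !=set0 ->
    loop_group_iso (is_loop b0) (@hequiv B)
      (nerve_loop C (vertex V)) (nerve_homotopic C (vertex V)).
Proof.
move=> Bpc _ [Copen Ccov] Cpc Cstar b0 V CV [xV VxV].
have Ccover x : exists2 u, C u & u x by have [U [CU Ux]] := Ccov x; exists U.
have Cstar' (x : B) (a : RR -> B) : is_loop x a ->
    (forall t, II t -> star x C (a t)) -> same_lifts a (fun=> x).
  move=> la ha; have [ca [a0 a1]] := la.
  apply/hequivE => //; [exact: within_cst|exact: Cstar].
have [U0 CU0 U0b] := Ccover b0.
have [delta [[cd [d0 d1]] _]] := Bpc xV b0 I I.
exact: (hedgehog_group_nerve Copen Ccover Cpc Cstar' CV VxV CU0 U0b cd d0 d1).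
Qed.
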